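(* Let $\mathbb{K}$ be a field of characteristic $0$. Let $V=V_{\bar 0}\oplus V_{\bar 1}$ be a finite-dimensional vector superspace over $\mathbb{K}$ with $(\dim V_{\bar 0},\dim V_{\bar 1})=(m,\ell)$, let $\mathrm{GL}(V)$ be the general linear supergroup on $V$, and let $\delta_V=\mathrm{sdim}\,V=m-\ell$. Let $F:\mathcal{OB}(\delta_V)\to\mathcal{T}_{\mathrm{GL}}(V)$ be the tensor functor from the oriented Brauer category to the category of tensor representations of $\mathrm{GL}(V)$ described in the context. (1) The functor $F$ is full. (2) For any $\eta,\theta\in\mathcal{N}$, let $F_\eta^\theta: OB_\eta^\theta(\delta_V)\to \mathrm{Hom}_{\mathrm{GL}(V)}(V^\eta,V^\theta)$ be the linear map given by the restriction of $F$ to the space of morphisms. Then the kernel of $F_\eta^\theta$ is equal to $\mathcal{J}(m,\ell)_\eta^\theta$.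
   Context: Oriented Brauer category. A $(k,\ell)$ Brauer diagram is a partition into pairs (arcs) of a set of $k+\ell$ nodes, $k$ placed on a lower horizontal line and $\ell$ on an upper one. An oriented Brauer diagram is a Brauer diagram with an orientation chosen on each arc. $\mathcal{N}$ is the set of all finite (possibly empty) sequences in $\{+,-\}$. The source $s(\Gamma)$ of an oriented diagram $\Gamma$ is the sequence whose $p$-th entry is $+$ if the $p$-th bottom node is the end point (head) of its arc and $-$ if it is the starting point; the target $t(\Gamma)$ is the sequence whose $q$-th entry is $+$ if the $q$-th top node is the starting point of its arc and $-$ if it is the end point (head). For $\delta\in\mathbb{K}$, $OB_s^t(\delta)$ is the $\mathbb{K}$-vector space with basis the oriented Brauer diagrams with source $s$ and target $t$. Composition $D_1\circ D_2$ (defined if $t(D_2)=s(D_1)$) is: place $D_1$ above $D_2$, identify the corresponding nodes, and replace every closed loop (of either orientation) by a factor $\delta$. Tensor product is juxtaposition ($D\otimes D'$ has $D'$ to the right of $D$). $\mathcal{OB}(\delta)$ is the $\mathbb{K}$-linear tensor category with object set $\mathcal{N}$, $\mathrm{Hom}(\eta,\eta')=OB_\eta^{\eta'}(\delta)$, and tensor product of objects given by concatenation of sequences. Its morphisms are generated under composition and tensor product by: $I^+$, $I^-$ (single vertical arcs, identities of the objects $(+)$ and $(-)$), $X:(+,+)\to(+,+)$ (crossing, both arcs directed downwards), the caps $A^+:(-,+)\to\emptyset$ and $A^-:(+,-)\to\emptyset$, and the cups $U^+:\emptyset\to(+,-)$ and $U^-:\emptyset\to(-,+)$ (each cap or cup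 is the single arc with the orientation determined by its source/target). Representation category and functor. $[v]\in\mathbb{Z}_2$ denotes the degree of a homogeneous $v$. $\mathrm{GL}(V)$ is the general linear supergroup (affine group superscheme), acting naturally on $V$, on $V^*$ by $(g\cdot\bar w)(v)=\bar w(g^{-1}v)$, and diagonally on tensor products. Put $V^+=V$, $V^-=V^*$ and, for $\eta=(\varepsilon_1,\dots,\varepsilon_r)\in\mathcal{N}$, $V^\eta=V^{\varepsilon_1}\otimes\cdots\otimes V^{\varepsilon_r}$, with $V^{\emptyset}=\mathbb{K}$. $\mathcal{T}_{\mathrm{GL}}(V)$ is the full subcategory of $\mathrm{GL}(V)$-modules with objects $V^\eta$, $\eta\in\mathcal{N}$. Let $\{b_i\}$ be a homogeneous basis of $V$ and $\{b_i^*\}$ the dual basis of $V^*$. $F$ is the unique $\mathbb{K}$-linear functor with $F(\eta)=V^\eta$, respecting tensor products of objects and morphisms, and with $F(I^+)=\mathrm{id}_V$, $F(I^-)=\mathrm{id}_{V^*}$, $F(X)(v\otimes w)=(-1)^{[v][w]}w\otimes v$, $F(U^+)(1)=\sum_i b_i\otimes b_i^*$, $F(U^-)(1)=\sum_i(-1)^{[b_i]}b_i^*\otimes b_i$, $F(A^+)(\bar w\otimes v)=\bar w(v)$, $F(A^-)(v\otimes\bar w)=(-1)^{[v][\bar w]}\bar w(v)$. The ideal $\mathcal{J}(m,\ell)$. Let $r_c=(m+1)(\ell+1)$. For the sequence $(+)^{r_c}=(+,\dots,+)$ of length $r_c$, the algebra $OB_{(+)^{r_c}}^{(+)^{r_c}}(\delta_V)$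 is canonically the group algebra $\mathbb{K}\mathrm{Sym}_{r_c}$. Fill the $(m+1)\times(\ell+1)$ rectangle (with $m+1$ rows and $\ell+1$ columns) with $1,2,\dots,r_c$ row by row, left to right and top to bottom; let $R,C\subseteq\mathrm{Sym}_{r_c}$ be the stabilisers of the rows and of the columns respectively, and set $e(m,\ell)=\big(\sum_{\pi\in R}\pi\big)\big(\sum_{\sigma\in C}\mathrm{sgn}(\sigma)\sigma\big)\in\mathbb{K}\mathrm{Sym}_{r_c}$. $\mathcal{J}(m,\ell)$ is the subspace of $\bigoplus_{\eta,\zeta\in\mathcal{N}}OB_\eta^\zeta(\delta_V)$ spanned by the morphisms of $\mathcal{OB}(\delta_V)$ generated by $e(m,\ell)$ under composition and tensor product with arbitrary morphisms (the tensor ideal generated by $e(m,\ell)$), and $\mathcal{J}(m,\ell)_\eta^\zeta=\mathcal{J}(m,\ell)\cap OB_\eta^\zeta(\delta_V)$. *)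

(* Defs.v *)
From HB Require Import structures.
From mathcomp Require Import all_boot all_order all_fingroup all_algebra.

Set Implicit Arguments.
Unset Strict Implicit.
Unset Printing Implicit Defensive.

Import GRing.Theory.
Local Open Scope ring_scope.

(* Objects are sign sequences of type [seq bool]; [true] stands for +.        *)

(* [inl] are the k bottom nodes and [inr] the l top nodes, left to right.     *)
Definition node (k l : nat) : finType := ('I_k + 'I_l)%type.

(* An oriented arc is a pair (starting point, end point); an oriented diagram *)
(* is a set of such arcs with every node on exactly one of them.              *)
Definition arcs (k l : nat) := {set node k l * node k l}.

Definition is_obdiag k l (E : arcs k l) : bool :=
  [forall a in E, a.1 != a.2] &&
  [forall x, #|[set a in E | (a.1 == x) || (a.2 == x)]| == 1%N].

Definition obdiag k l := {E : arcs k l | is_obdiag E}.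

Definition is_start k l (E : arcs k l) x := [exists a in E, a.1 == x].
Definition is_end k l (E : arcs k l) x := [exists a in E, a.2 == x].

Definition source k l (D : obdiag k l) : seq bool :=
  [seq is_end (val D) (inl i) | i <- enum 'I_k].
Definition target k l (D : obdiag k l) : seq bool :=
  [seq is_start (val D) (inr i) | i <- enum 'I_l].

Definition obhom (s t : seq bool) :=
  {D : obdiag (size s) (size t) | (source D == s) && (target D == t)}.

Definition oarcs s t (D : obhom s t) : arcs (size s) (size t) := val (val D).

Definition OB (K : fieldType) (s t : seq bool) : vectType K :=
  {ffun obhom s t -> K^o}.

(* The basis vector of the diagram with set of arcs E. (It is 0 if E is not   *)
(* the set of arcs of a diagram from s to t, which never happens below.)      *)
Definition diagv (K : fieldType) s t (E : arcs (size s) (size t)) : OB K s t :=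
  [ffun D => (oarcs D == E)%:R].

Definition arc_seq k l (e : seq (node k l * node k l)) : arcs k l :=
  [set a in e].

Section Composition.
Variables (a b c : nat).

(* Bottom, middle (after identification) and top nodes of the stacked picture *)
Definition node3 : finType := ('I_a + 'I_b + 'I_c)%type.

Definition lower_node (x : node a b) : node3 := inl x.
Definition upper_node (x : node b c) : node3 :=
  match x with inl i => inl (inr i) | inr i => inr i end.
Definition outer_node (x : node a c) : node3 :=
  match x with inl i => inl (inl i) | inr i => inr i end.

(* E1 is placed above E2.                                                     *)
Definition stack (E1 : arcs b c) (E2 : arcs a b) : rel node3 := fun x y =>
  ((x, y) \in [set (lower_node e.1, lower_node e.2) | e in E2]) ||
  ((x, y) \in [set (upper_node e.1, upper_node e.2) | e in E1]).

Definition comp_arcs (E1 : arcs b c) (E2 : arcs a b) : arcs a c :=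
  [set e | (e.1 != e.2) &&
           connect (stack E1 E2) (outer_node e.1) (outer_node e.2)].

(* A node lies on a closed loop iff no outer node is reachable from it along  *)
(* the arcs; the loop is then the set of all reachable nodes.                 *)
Definition on_loop (E1 : arcs b c) (E2 : arcs a b) (x : node3) : bool :=
  [forall y, ~~ connect (stack E1 E2) x (outer_node y)].

Definition nloops (E1 : arcs b c) (E2 : arcs a b) : nat :=
  #|[set [set y | connect (stack E1 E2) x y] | x in on_loop E1 E2]|.

End Composition.

Definition ob_comp (K : fieldType) (delta : K) s t u
    (f : OB K t u) (g : OB K s t) : OB K s u :=
  \sum_(D1 : obhom t u) \sum_(D2 : obhom s t)
    (f D1 * g D2 * delta ^+ nloops (oarcs D1) (oarcs D2)) *:
      diagv K (comp_arcs (oarcs D1) (oarcs D2)).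

Definition lpos (s s' : seq bool) (i : 'I_(size s)) : 'I_(size (s ++ s')) :=
  cast_ord (esym (size_cat s s')) (lshift (size s') i).
Definition rpos (s s' : seq bool) (i : 'I_(size s')) : 'I_(size (s ++ s')) :=
  cast_ord (esym (size_cat s s')) (rshift (size s) i).

Definition lnode s t s' t' (x : node (size s) (size t)) :
    node (size (s ++ s')) (size (t ++ t')) :=
  match x with inl i => inl (lpos s' i) | inr i => inr (lpos t' i) end.
Definition rnode s t s' t' (x : node (size s') (size t')) :
    node (size (s ++ s')) (size (t ++ t')) :=
  match x with inl i => inl (rpos s i) | inr i => inr (rpos t i) end.

Definition tens_arcs s t s' t'
    (E : arcs (size s) (size t)) (E' : arcs (size s') (size t')) :
    arcs (size (s ++ s')) (size (t ++ t')) :=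
  [set (lnode s' t' e.1, lnode s' t' e.2) | e in E] :|:
  [set (rnode s t e.1, rnode s t e.2) | e in E'].

Definition ob_tens (K : fieldType) s t s' t' (f : OB K s t) (g : OB K s' t') :
    OB K (s ++ s') (t ++ t') :=
  \sum_(D : obhom s t) \sum_(D' : obhom s' t')
    (f D * g D') *: diagv K (tens_arcs (oarcs D) (oarcs D')).

(* Vertical arcs, directed downwards at + and upwards at -. In particular     *)
(* I^+ = ob_id [:: true] and I^- = ob_id [:: false].                          *)
Definition ob_id (K : fieldType) (s : seq bool) : OB K s s :=
  diagv K [set (if nth true s i then (inr i, inl i) else (inl i, inr i))
            | i : 'I_(size s)].

Definition plus (r : nat) : seq bool := nseq r true.

(* The downward diagram of a permutation, with bottom node i joined to top    *)
(* node p i; ob_perm (p \o q) is ob_perm p composed with ob_perm q.           *)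
Definition ob_perm (K : fieldType) r (p : 'S_(size (plus r))) :
    OB K (plus r) (plus r) :=
  diagv K [set (inr (p i), inl i) | i : 'I_(size (plus r))].

Definition ob_X (K : fieldType) : OB K [:: true; true] [:: true; true] :=
  @diagv K [:: true; true] [:: true; true]
    (arc_seq [:: (inr (@inord 1 0), inl (@inord 1 1));
                 (inr (@inord 1 1), inl (@inord 1 0))]).

Definition ob_Aplus (K : fieldType) : OB K [:: false; true] [::] :=
  @diagv K [:: false; true] [::]
    (arc_seq [:: (inl (@inord 1 0), inl (@inord 1 1))]).
Definition ob_Aminus (K : fieldType) : OB K [:: true; false] [::] :=
  @diagv K [:: true; false] [::]
    (arc_seq [:: (inl (@inord 1 1), inl (@inord 1 0))]).
Definition ob_Uplus (K : fieldType) : OB K [::] [:: true; false] :=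
  @diagv K [::] [:: true; false]
    (arc_seq [:: (inr (@inord 1 0), inr (@inord 1 1))]).
Definition ob_Uminus (K : fieldType) : OB K [::] [:: false; true] :=
  @diagv K [::] [:: false; true]
    (arc_seq [:: (inr (@inord 1 1), inr (@inord 1 0))]).

Section Ideal.
Variables (K : fieldType) (delta : K) (m l : nat).

Definition rc : nat := (m.+1 * l.+1)%N.

(* The box with 0-based label i is in row i %/ l.+1 and column i %% l.+1.     *)
Definition row_stab : {set 'S_(size (plus rc))} :=
  [set p : 'S_(size (plus rc)) | [forall i, p i %/ l.+1 == i %/ l.+1]%N].
Definition col_stab : {set 'S_(size (plus rc))} :=
  [set p : 'S_(size (plus rc)) | [forall i, p i %% l.+1 == i %% l.+1]%N].

Definition young_e : OB K (plus rc) (plus rc) :=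
  ob_comp delta
    (\sum_(p in row_stab) ob_perm K p)
    (\sum_(q in col_stab) (-1) ^+ odd_perm q *: ob_perm K q).

Inductive generated : forall s t, OB K s t -> Prop :=
| gen_e : generated young_e
| gen_compl s t u (f : OB K t u) (g : OB K s t) :
    generated g -> generated (ob_comp delta f g)
| gen_compr s t u (f : OB K t u) (g : OB K s t) :
    generated f -> generated (ob_comp delta f g)
| gen_tensl s t s' t' (f : OB K s t) (g : OB K s' t') :
    generated g -> generated (ob_tens f g)
| gen_tensr s t s' t' (f : OB K s t) (g : OB K s' t') :
    generated f -> generated (ob_tens f g).

Definition ideal_J s t (f : OB K s t) : Prop :=
  exists (n : nat) (c : 'I_n -> K) (g : 'I_n -> OB K s t),
    (forall i, generated (g i)) /\ f = \sum_i c i *: g i.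

End Ideal.

Record superspace (K : fieldType) := SuperSpace {
  ss_vect :> vectType K;
  ss_part : bool -> {vspace ss_vect};     (* false: even, true: odd *)
  ss_direct : (ss_part false :&: ss_part true = 0)%VS;
  ss_full : (ss_part false + ss_part true = fullv)%VS
}.

Definition sdim (K : fieldType) (V : superspace K) : K :=
  (\dim (ss_part V false))%:R - (\dim (ss_part V true))%:R.

Definition spr (K : fieldType) (V : superspace K) (p : bool) : 'End(V) :=
  daddv_pi (ss_part V p) (ss_part V (~~ p)).

Section Dual.
Variables (K : fieldType) (V : superspace K).

Definition dual_res (p : bool) (f : 'Hom(V, K^o)) : 'Hom(V, K^o) :=
  (f \o spr V p)%VF.

Fact dual_res_linear p : linear (dual_res p).
Proof.
by move=> a f g; apply/lfunP=> v; rewrite comp_lfunE !add_lfunE !scale_lfunE !comp_lfunE.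
Qed.
HB.instance Definition _ p :=
  GRing.isLinear.Build K 'Hom(V, K^o) 'Hom(V, K^o) *:%R (dual_res p)
    (dual_res_linear p).

(* The functionals of degree p are those vanishing on vectors of degree p + 1 *)
Definition dual_part (p : bool) : {vspace 'Hom(V, K^o)} :=
  lker (linfun (dual_res (~~ p))).

Lemma ss_capC p : (ss_part V p :&: ss_part V (~~ p) = 0)%VS.
Proof. by case: p => /=; [rewrite capvC|]; exact: ss_direct. Qed.

Lemma spr_add p v : spr V p v + spr V (~~ p) v = v.
Proof.
rewrite /spr negbK daddv_pi_add ?ss_capC //.
by case: p => /=; rewrite 1?[(_ + ss_part V false)%VS]addvC ss_full memvf.
Qed.

Lemma dual_partP p (f : 'Hom(V, K^o)) :
  reflect (forall v, v \in ss_part V (~~ p) -> f v = 0) (f \in dual_part p).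
Proof.
rewrite memv_ker lfunE /=; apply: (iffP eqP) => [f0 v vV | f0].
  have := congr1 (fun h : 'Hom(V, K^o) => h v) f0.
  by rewrite comp_lfunE zero_lfunE daddv_pi_id // ss_capC.
by apply/lfunP=> v; rewrite comp_lfunE zero_lfunE f0 // memv_pi.
Qed.

Fact dual_direct : (dual_part false :&: dual_part true = 0)%VS.
Proof.
apply/eqP; rewrite -subv0; apply/subvP=> f; rewrite memv_cap memv0.
case/andP=> /dual_partP f1 /dual_partP f0; apply/eqP/lfunP=> v.
by rewrite -(spr_add false v) linearD /= f0 ?f1 ?memv_pi // addr0 zero_lfunE.
Qed.

Lemma dual_res_part p f : dual_res p f \in dual_part p.
Proof.
apply/dual_partP=> v vV; rewrite comp_lfunE.
have := spr_add p v; rewrite [X in _ + X]daddv_pi_id ?ss_capC // => /eqP.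
by rewrite -subr_eq0 addrK => /eqP->; rewrite linear0.
Qed.

Fact dual_full : (dual_part false + dual_part true = fullv)%VS.
Proof.
apply/eqP; rewrite eqEsubv subvf /=; apply/subvP=> f _.
have -> : f = dual_res false f + dual_res true f.
  apply/lfunP=> v; rewrite add_lfunE !comp_lfunE -linearD /=.
  by rewrite (spr_add false).
by rewrite memv_add ?dual_res_part.
Qed.

Definition dual : superspace K := SuperSpace dual_direct dual_full.

End Dual.

(* U is an arbitrary space; bas U is an auxiliary basis, not homogeneous in   *)
(* general, that only serves to write coordinates.                            *)
Notation bas U := (vbasis {:U}).
Notation dimf U := (\dim {:U}).

Section Tensor.
Variables (K : fieldType).

(* U (x) W as matrices: u (x) w has (i, j) entry u_i w_j.                     *)
Definition tensT (U W : vectType K) : vectType K := 'M[K]_(dimf U, dimf W).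
Definition tens (U W : vectType K) (u : U) (w : W) : tensT U W :=
  \matrix_(i, j) (coord (bas U) i u * coord (bas W) j w).

Definition ssign (V : superspace K) (e : bool) : superspace K :=
  if e then V else dual V.

Fixpoint tpow (V : superspace K) (s : seq bool) : vectType K :=
  if s is e :: s' then tensT (ssign V e) (tpow V s') else K^o.

(* The bilinear identification V^s x V^t -> V^(s ++ t), (x, y) |-> x (x) y.   *)
Fixpoint tcat (V : superspace K) (s t : seq bool) :
    tpow V s -> tpow V t -> tpow V (s ++ t) :=
  match s return tpow V s -> tpow V t -> tpow V (s ++ t) with
  | [::] => fun a y => (a : K) *: y
  | e :: s' => fun x y =>
      \sum_(i < dimf (ssign V e)) \sum_(j < dimf (tpow V s'))
        (x : 'M[K]_(_, _)) i j *:
          tens (bas (ssign V e))`_i (tcat ((bas (tpow V s'))`_j) y)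
  end.

(* v in V^e, and v (x) w, as elements of V^[:: e] and V^[:: e; e'].           *)
Definition pure1 (V : superspace K) e (v : ssign V e) : tpow V [:: e] :=
  tens v (1 : K^o).
Definition pure2 (V : superspace K) e e' (v : ssign V e) (w : ssign V e') :
  tpow V [:: e; e'] := tens v (pure1 w).

End Tensor.

(* Commutative superalgebras; sa_pr p is the projection onto degree p.        *)
Record superalg (K : fieldType) := SuperAlg {
  sa_alg :> algType K;
  sa_pr : bool -> {linear sa_alg -> sa_alg};
  sa_sum : forall a, sa_pr false a + sa_pr true a = a;
  sa_prK : forall p q a, sa_pr p (sa_pr q a) = if p == q then sa_pr q a else 0;
  sa_one : sa_pr false 1 = 1;
  sa_mul : forall p q a b, sa_pr p a = a -> sa_pr q b = b ->
    sa_pr (p (+) q) (a * b) = a * b;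
  sa_comm : forall p q a b, sa_pr p a = a -> sa_pr q b = b ->
    a * b = (-1) ^+ (p && q) * (b * a)
}.

Section Extension.
Variables (K : fieldType) (A : superalg K).

(* A (x) U as a free left A-module: row x stands for \sum_i x_i (x) (bas U)_i. *)
Definition scal (U : vectType K) : lmodType A := 'rV[A]_(dimf U).

Definition atens (U : vectType K) (a : A) (u : U) : scal U :=
  \row_i (coord (bas U) i u *: a).

(* id_A (x) f *)
Definition ext (U W : vectType K) (f : 'Hom(U, W)) (x : scal U) : scal W :=
  \sum_i x 0 i *: atens 1 (f (bas U)`_i).

(* (a (x) u)(b (x) w) = (-1)^([u][b]) ab (x) (u (x) w) *)
Definition kmul (U : superspace K) (W : vectType K) (x : scal U) (y : scal W) :
    scal (tensT U W) :=
  \sum_(p : bool) \sum_(q : bool) \sum_(i < dimf U) \sum_(j < dimf W)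
    ((-1) ^+ (p && q) * ext (spr U p) x 0 i * sa_pr A q (y 0 j)) *:
      atens 1 (tens (bas U)`_i (bas W)`_j).

(* <a (x) f, b (x) v> = (-1)^([f][b]) f(v) ab, for f in V^* and v in V        *)
Definition kpair (V : superspace K) (f : scal (dual V)) (v : scal V) : A :=
  \sum_(p : bool) \sum_(q : bool)
  \sum_(i < dimf (dual V)) \sum_(j < dimf V)
    ((bas (dual V))`_i : 'Hom(V, K^o)) (bas V)`_j *:
      ((-1) ^+ (p && q) * ext (spr (dual V) p) f 0 i * sa_pr A q (v 0 j)).

(* The degree p component of an element of A (x) V, for the total grading.    *)
Definition apart (V : superspace K) (p : bool) (x : scal V) : scal V :=
  \sum_(q : bool) map_mx (sa_pr A (p (+) q)) (ext (spr V q) x).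

(* The A-points of GL(V): even A-linear automorphisms x |-> x *m g of A (x) V *)
Record glpoint (V : superspace K) := GLpoint {
  gl_mx : 'M[A]_(dimf V);
  gl_inv : 'M[A]_(dimf V);
  gl_mulmxV : gl_mx *m gl_inv = 1%:M;
  gl_mulVmx : gl_inv *m gl_mx = 1%:M;
  gl_even : forall p (x : scal V), apart p (x *m gl_mx) = apart p x *m gl_mx
}.

(* On the dual, (g f)(v) = f(g^-1 v): its value at the basis vector e_k is    *)
(* the coefficient of the coordinate form e_k^*.                              *)
Definition act1 (V : superspace K) (g : glpoint V) (e : bool) :
    scal (ssign V e) -> scal (ssign V e) :=
  match e return scal (ssign V e) -> scal (ssign V e) with
  | true => fun x => x *m gl_mx g
  | false => fun f =>
      \sum_(k < dimf V)
        atens (kpair f (row k (gl_inv g)))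
              (linfun (coord (bas V) k : V -> K^o) : dual V)
  end.

(* The diagonal action on A (x) V^s, i.e. the A-linear map with               *)
(* g (x y) = (g x)(g y) for the product kmul.                                 *)
Fixpoint act (V : superspace K) (g : glpoint V) (s : seq bool) :
    scal (tpow V s) -> scal (tpow V s) :=
  match s return scal (tpow V s) -> scal (tpow V s) with
  | [::] => fun z => z
  | e :: s' => fun z =>
      \sum_(k < dimf (tpow V (e :: s'))) z 0 k *:
        \sum_(i < dimf (ssign V e)) \sum_(j < dimf (tpow V s'))
          (((bas (tpow V (e :: s')))`_k : 'M[K]_(_, _)) i j)%:A *:
            kmul (act1 g (atens 1 (bas (ssign V e))`_i))
                 (act g (atens 1 (bas (tpow V s'))`_j))
  end.

End Extension.

Definition gl_hom (K : fieldType) (V : superspace K) s t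
    (f : 'Hom(tpow V s, tpow V t)) : Prop :=
  forall (A : superalg K) (g : glpoint A V) (x : scal A (tpow V s)),
    ext f (act g x) = act g (ext f x).

(* F : OB(sdim V) -> T_GL(V), s |-> V^s, is the tensor functor determined by  *)
(* its values on X and on the caps and cups, (b_i) being a basis of V with    *)
(* b_i homogeneous of degree d i. The conditions on I^+ and I^- are among     *)
(* rf_id.                                                                     *)
Record brauer_functor (K : fieldType) (V : superspace K) (n : nat)
    (b : n.-tuple V) (d : 'I_n -> bool)
    (F : forall s t, OB K s t -> 'Hom(tpow V s, tpow V t)) : Prop := {
  rf_gl : forall s t (f : OB K s t), gl_hom (F s t f);
  rf_lin : forall s t, linear (F s t);
  rf_id : forall s, F s s (ob_id K s) = \1%VF;
  rf_comp : forall s t u (f : OB K t u) (g : OB K s t),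
    F s u (ob_comp (sdim V) f g) = (F t u f \o F s t g)%VF;
  rf_tens : forall s t s' t' (f : OB K s t) (g : OB K s' t') x y,
    F _ _ (ob_tens f g) (tcat x y) = tcat (F s t f x) (F s' t' g y);
  rf_X : forall (p q : bool) (v w : V),
    v \in ss_part V p -> w \in ss_part V q ->
    F _ _ (ob_X K) (@pure2 K V true true v w) =
      (-1) ^+ (p && q) *: @pure2 K V true true w v;
  rf_Uplus : F _ _ (ob_Uplus K) (1 : K^o) =
    \sum_(i < n) @pure2 K V true false b`_i (linfun (coord b i : V -> K^o));
  rf_Uminus : F _ _ (ob_Uminus K) (1 : K^o) =
    \sum_(i < n) (-1) ^+ d i *:
      @pure2 K V false true (linfun (coord b i : V -> K^o)) b`_i;
  rf_Aplus : forall (f : 'Hom(V, K^o)) (v : V),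
    F _ _ (ob_Aplus K) (@pure2 K V false true f v) = f v;
  rf_Aminus : forall (p q : bool) (f : 'Hom(V, K^o)) (v : V),
    v \in ss_part V p -> f \in ss_part (dual V) q ->
    F _ _ (ob_Aminus K) (@pure2 K V true false v f) = (-1) ^+ (p && q) * f v
}.

(* Main.v *)
(* Bending a strand identifies Hom(e s, t) with Hom(s, e' t), where e' is the sign opposite to e;
   this is compatible with F, with the ideal J and with GL(V)-invariance. Together with
   permutations of the top nodes it reduces both claims to Hom(+^a, +^b).

   Fullness there: the points 1 + tE of GL(V) over the dual numbers show that an invariant map f
   commutes with the super derivations extending the homogeneous endomorphisms E of V. For E = 1
   this gives (a - b) f = 0. If a = b, the derivations generate the algebra of all symmetrised
   endomorphisms of the tensor power, so f commutes with the centraliser of the symmetric group,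
   and a Maschke projection shows that f is a combination of permutations.

   Kernel there: D is given by an element x of the group algebra. The two-sided ideal I generated
   by the Young elements of rectangles with m + 1 rows and l + 1 columns acts by zero, since no
   nonzero vector of the left ideal of such an element has the symmetry of a word in m even and
   l odd letters. If x acts by zero but is not in I, then, I being generated by an idempotent f as
   a left ideal, x may be replaced by x - x f, which is killed by I. The left ideal of all such
   elements contains a nonzero vector with the symmetry of such a word: among its vectors invariant
   under the rows of some arrangement, one with the largest sum of squared row lengths has at most
   m rows longer than l, and it is antisymmetrised along the columns of the other rows.
   Testing x on the tensor of that word contradicts x acting by zero. *)

From HB Require Import structures.
Require Import Defs.
From mathcomp Require Import all_boot all_order all_fingroup all_algebra.
From Stdlib Require Import Classical.

Set Implicit Arguments.
Unset Strict Implicit.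
Unset Printing Implicit Defensive.

Import GRing.Theory.
Local Open Scope ring_scope.

(** * Group algebras *)

(** No irreducible module is classified: symmetric groups enter through single vectors, over any
    field of characteristic 0. Two devices carry the argument. The first is a vector symmetric along
    rows and killed by every move of a letter into a row at least as long. On all such vectors, in
    every algebra carrying the group, the row sum times a permutation acts by a scalar depending
    only on the arrangement and the permutation. So the row sum times the signed column sum acts by
    one constant; tested on the Young symmetriser itself it is nonzero, because the square of that
    element is. As the algebra is arbitrary, this applies equally to the permutations of the short
    rows alone, acting on a vector for the whole group. The sum of squared row lengths replaces the
    dominance order, since it grows whenever a letter moves into a row at least as long. The second
    device is von Neumann regularity, z = z y z: it turns a nonzero product z s, with s the signed
    symmetriser of a word, into the nonzero element s y z, which has the symmetry of the word and
    lies in the left ideal of z. *)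

Lemma natr_neq0 (K : fieldType) (charK : [pchar K] =i pred0) n :
  (n > 0)%N -> n%:R != 0 :> K.
Proof. by move=> n0; rewrite pcharf0P in charK; rewrite charK -lt0n. Qed.

Section LinearMap.
Variables (K : fieldType) (U W : lmodType K) (h : U -> W).
Hypothesis hl : linear h.
Lemma lin0 : h 0 = 0.
Proof. by have := hl (-1) 0 0; rewrite scaler0 addr0 scaleN1r addNr. Qed.
Lemma linD x y : h (x + y) = h x + h y.
Proof. by have := hl 1 x y; rewrite !scale1r. Qed.
Lemma linZ c x : h (c *: x) = c *: h x.
Proof. by have := hl c x 0; rewrite lin0 !addr0. Qed.
Lemma lin_sum I (r : seq I) (P : pred I) (G : I -> U) :
  h (\sum_(i <- r | P i) G i) = \sum_(i <- r | P i) h (G i).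
Proof. exact: (big_morph h linD lin0). Qed.
Lemma lin_comb I (r : seq I) (P : pred I) (c : I -> K) (G : I -> U) :
  h (\sum_(i <- r | P i) c i *: G i) = \sum_(i <- r | P i) c i *: h (G i).
Proof. by rewrite lin_sum; apply: eq_bigr => i _; rewrite linZ. Qed.
End LinearMap.

Section Maschke.
Variables (K : fieldType) (charK : [pchar K] =i pred0) (gT : finGroupType).
Variables (X : vectType K) (r : gT -> 'End(X)).
Hypothesis r1 : r 1%g = \1%VF.
Hypothesis rM : forall g h, r (g * h)%g = (r g \o r h)%VF.

(** The conjugates of an arbitrary projection onto [U] are averaged. The group and the module are
    left general, as this serves both the left regular module and the endomorphisms of a tensor
    power. *)
Lemma maschke (U : {vspace X}) : (forall g x, x \in U -> r g x \in U) ->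
  exists2 P : 'End(X), (forall g x, P (r g x) = r g (P x)) &
    (forall x, P x \in U) /\ (forall x, x \in U -> P x = x).
Proof.
move=> stU; have n0 : #|gT|%:R != 0 :> K by apply: natr_neq0 => //; apply/card_gt0P; exists 1%g.
have rK g x : r g (r g^-1%g x) = x by rewrite -comp_lfunE -rM mulgV r1 lfunE.
pose P := #|gT|%:R^-1 *: \sum_g (r g \o (projv U \o r g^-1%g))%VF.
have PE x : P x = #|gT|%:R^-1 *: \sum_g r g (projv U (r g^-1%g x)).
  rewrite scale_lfunE sum_lfunE; congr (_ *: _); apply: eq_bigr => g _.
  by rewrite !comp_lfunE.
exists P => [g x|]; last split=> x.
- rewrite !PE [RHS]linearZ /=; congr (_ *: _); rewrite linear_sum /=.
  rewrite (reindex_inj (mulgI g)) /=; apply: eq_bigr => h _.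
  by rewrite rM comp_lfunE invMg rM comp_lfunE /= -(comp_lfunE (r g^-1%g)) -rM mulVg r1 lfunE.
- by rewrite PE memvZ // memv_suml // => g _; apply/stU/memv_proj.
- move=> xU; rewrite PE (eq_bigr (fun=> x)) => [|g _]; last by rewrite projv_id ?rK ?stU.
  by rewrite sumr_const -scaler_nat scalerA mulVf ?scale1r.
Qed.
End Maschke.

Section GroupAlgebra.
Variables (K : fieldType) (gT : finGroupType).
Definition galg : Type := {ffun gT -> K^o}.
HB.instance Definition _ := Vector.on galg.

Definition dl (g : gT) : galg := [ffun h => (h == g)%:R].
Definition galg_mul (x y : galg) : galg :=
  [ffun g => \sum_h x h * y (h^-1 * g)%g].

Lemma galgD (x y : galg) g : (x + y) g = x g + y g. Proof. by rewrite ffunE. Qed.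
Lemma galgZ c (x : galg) g : (c *: x) g = c * x g. Proof. by rewrite ffunE. Qed.

Lemma galg_mulA : associative galg_mul.
Proof.
move=> x y z; apply/ffunP=> g; rewrite !ffunE.
under eq_bigr => h _ do rewrite ffunE big_distrr /=.
under [RHS]eq_bigr => h _ do rewrite ffunE big_distrl /=.
rewrite [RHS]exchange_big /=; apply: eq_bigr => h _.
rewrite [RHS](reindex_inj (mulgI h)) /=; apply: eq_bigr => k _.
by rewrite mulKg invMg mulrA mulgA.
Qed.
Lemma galg_mulDl : left_distributive galg_mul +%R.
Proof.
move=> x y z; apply/ffunP=> g; rewrite !ffunE -big_split; apply: eq_bigr => h _.
by rewrite ffunE mulrDl.
Qed.
Lemma galg_mulDr : right_distributive galg_mul +%R.
Proof.
move=> x y z; apply/ffunP=> g; rewrite !ffunE -big_split; apply: eq_bigr => h _.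
by rewrite ffunE mulrDr.
Qed.
Lemma galg_mul1x : left_id (dl 1%g) galg_mul.
Proof.
move=> x; apply/ffunP=> g; rewrite ffunE (bigD1 1%g) //= big1 => [|h /negPf h1].
  by rewrite ffunE eqxx mul1r addr0 invg1 mul1g.
by rewrite ffunE h1 mul0r.
Qed.
Lemma galg_mulx1 : right_id (dl 1%g) galg_mul.
Proof.
move=> x; apply/ffunP=> g; rewrite ffunE (bigD1 g) //= big1 => [|h /negPf h1].
  by rewrite ffunE mulVg eqxx mulr1 addr0.
by rewrite ffunE -eq_invg_mul invgK h1 mulr0.
Qed.
Lemma dl1_neq0 : dl 1%g != 0.
Proof. by apply/eqP=> /ffunP/(_ 1%g); rewrite !ffunE eqxx => /eqP; rewrite oner_eq0. Qed.

HB.instance Definition _ := GRing.Zmodule_isNzRing.Build galg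
  galg_mulA galg_mul1x galg_mulx1 galg_mulDl galg_mulDr dl1_neq0.
Lemma galg_scalerAl (a : K) (x y : galg) : a *: (x * y) = (a *: x) * y.
Proof.
apply/ffunP=> g; rewrite galgZ ![galg_mul _ _ g]ffunE big_distrr; apply: eq_bigr => h _.
by rewrite galgZ [LHS]mulrA.
Qed.
HB.instance Definition _ := GRing.Lmodule_isLalgebra.Build K galg galg_scalerAl.
Lemma galg_scalerAr (a : K) (x y : galg) : a *: (x * y) = x * (a *: y).
Proof.
apply/ffunP=> g; rewrite galgZ ![galg_mul _ _ g]ffunE big_distrr; apply: eq_bigr => h _.
by rewrite galgZ [LHS]mulrCA.
Qed.
HB.instance Definition _ := GRing.Lalgebra_isAlgebra.Build K galg galg_scalerAr.

Lemma galgM (x y : galg) g : (x * y) g = \sum_h x h * y (h^-1 * g)%g.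
Proof. by rewrite ffunE. Qed.
Lemma galg_sumE I (r : seq I) (P : pred I) (F : I -> galg) g :
  (\sum_(i <- r | P i) F i) g = \sum_(i <- r | P i) F i g.
Proof. by elim/big_rec2: _ => [|i y x _ <-]; rewrite ffunE. Qed.
Lemma galg_expand (x : galg) : x = \sum_g x g *: dl g.
Proof.
apply/ffunP=> g; rewrite galg_sumE (bigD1 g) //= galgZ ffunE eqxx mulr1.
by rewrite big1 ?addr0 // => h /negPf hg; rewrite galgZ ffunE eq_sym hg mulr0.
Qed.
Lemma galg_sandwich (a z b : galg) : a * z * b = \sum_g z g *: (a * dl g * b).
Proof.
rewrite [z in LHS]galg_expand mulr_sumr mulr_suml; apply: eq_bigr => g _.
by rewrite -scalerAr -scalerAl.
Qed.
Lemma galg_lin_ext (W : lmodType K) (f g : galg -> W) : linear f -> linear g ->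
  (forall p, f (dl p) = g (dl p)) -> f =1 g.
Proof.
move=> fl gl H x; rewrite [x]galg_expand (lin_comb fl) (lin_comb gl).
by apply: eq_bigr => p _; rewrite H.
Qed.
Lemma dl1 : dl 1%g = 1. Proof. by []. Qed.
Lemma dlE g h : dl g h = (h == g)%:R. Proof. by rewrite ffunE. Qed.
Lemma mul_dlE g (x : galg) h : (dl g * x) h = x (g^-1 * h)%g.
Proof.
rewrite galgM (bigD1 g) //= dlE eqxx mul1r big1 ?addr0 // => k /negPf kg.
by rewrite dlE kg mul0r.
Qed.
Lemma mulr_dlE g (x : galg) h : (x * dl g) h = x (h * g^-1)%g.
Proof.
rewrite galgM (bigD1 (h * g^-1)%g) //= dlE invMg invgK mulgKV eqxx mulr1 big1 ?addr0 // => k kg.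
by rewrite dlE; case: eqP => [gE|_]; [case/eqP: kg; rewrite -gE invMg invgK mulKVg | rewrite mulr0].
Qed.
Lemma dlM g h : dl (g * h)%g = dl g * dl h.
Proof. by apply/ffunP=> k; rewrite mul_dlE !dlE -(inj_eq (mulgI g^-1%g)) mulKg. Qed.

Hypothesis charK : [pchar K] =i pred0.

Definition lmulg (x y : galg) : galg := x * y.
Definition rmulg (x y : galg) : galg := y * x.
Lemma lmulg_linear x : linear (lmulg x).
Proof. by move=> c y z; rewrite /lmulg mulrDr -scalerAr. Qed.
HB.instance Definition _ x := GRing.isLinear.Build K galg galg *:%R (lmulg x) (lmulg_linear x).
Lemma rmulg_linear x : linear (rmulg x).
Proof. by move=> c y z; rewrite /rmulg mulrDl -scalerAl. Qed.
HB.instance Definition _ x := GRing.isLinear.Build K galg galg *:%R (rmulg x) (rmulg_linear x).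

(** The right unit is the image of 1 under an equivariant projection P onto the left ideal: z * P(1)
    = P(z) = z. *)
Lemma left_ideal_idem (U : {vspace galg}) : (forall g x, x \in U -> dl g * x \in U) ->
  exists2 f, f \in U & forall z, z \in U -> z * f = z.
Proof.
move=> stU; pose r g := linfun (lmulg (dl g)).
have r1 : r 1%g = \1%VF by apply/lfunP=> x; rewrite !lfunE /= /lmulg mul1r.
have rM g h : r (g * h)%g = (r g \o r h)%VF.
  by apply/lfunP=> x; rewrite comp_lfunE !lfunE /= /lmulg dlM mulrA.
have [g x|P PC [PU Pid]] := maschke charK r1 rM (U := U); first by rewrite lfunE; apply: stU.
exists (P 1) => // z zU; rewrite -[RHS]Pid //.
rewrite {2}[z]galg_expand -[in RHS](mulr1 (\sum_g _)) mulr_suml linear_sum {1}[z]galg_expand mulr_suml.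
by apply: eq_bigr => g _; rewrite -!scalerAl linearZ /=; congr (_ *: _); have := PC g 1; rewrite !lfunE.
Qed.

(** The left ideal generated by [z] has a right unit, which is itself of the form y * z. *)
Lemma galg_regular (z : galg) : exists y, z * y * z = z.
Proof.
pose L := linfun (rmulg z).
have LP x : reflect (exists y, x = y * z) (x \in limg L).
  by apply: (iffP memv_imgP) => [[y _ ->]|[y ->]]; exists y; rewrite ?memvf ?lfunE.
have [g x /LP[y ->]|f /LP[y ->] zf] := @left_ideal_idem (limg L).
  by apply/LP; exists (dl g * y); rewrite mulrA.
by exists y; rewrite -mulrA zf //; apply/LP; exists 1; rewrite mul1r.
Qed.
End GroupAlgebra.

(** * Row and column sums in the symmetric group *)

Section Stab.
Variables (T : finType) (C : eqType) (c : T -> C).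

Definition stab : {set {perm T}} := [set p : {perm T} | [forall x, c (p x) == c x]].

Lemma stabP (p : {perm T}) : reflect (forall x, c (p x) = c x) (p \in stab).
Proof. by rewrite inE; apply: (iffP forallP) => H x; apply/eqP. Qed.
Lemma stab1 : 1%g \in stab. Proof. by apply/stabP=> x; rewrite perm1. Qed.
Lemma stabM p q : p \in stab -> q \in stab -> (p * q)%g \in stab.
Proof. by move=> /stabP pc /stabP qc; apply/stabP=> x; rewrite permM qc pc. Qed.
Lemma stabV p : p \in stab -> p^-1%g \in stab.
Proof. by move=> /stabP pc; apply/stabP=> x; rewrite -[in RHS](permKV p x) pc. Qed.
Lemma stabMl p q : p \in stab -> ((p * q)%g \in stab) = (q \in stab).
Proof.
by move=> pc; apply/idP/idP=> [H|]; [rewrite -(mulKg p q) stabM ?stabV|exact: stabM].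
Qed.
Lemma stabMr p q : p \in stab -> ((q * p)%g \in stab) = (q \in stab).
Proof.
move=> pc; apply/idP/idP=> [H|H]; last exact: stabM.
by rewrite -(mulgK p q) stabM ?stabV.
Qed.
Lemma stabVE p : (p^-1%g \in stab) = (p \in stab).
Proof. by apply/idP/idP=> /stabV; rewrite ?invgK. Qed.
Lemma stab_tperm x y : c x = c y -> tperm x y \in stab.
Proof. by move=> cxy; apply/stabP=> z; case: tpermP => [->|->|]. Qed.

(** A Young subgroup is generated by the transpositions of points of equal colour: composing with
    one that sends a moved point back lowers the number of moved points. *)
Lemma stab_ind (Q : {perm T} -> Prop) : Q 1%g ->
  (forall p q, Q p -> Q q -> Q (p * q)%g) ->
  (forall x y, c x = c y -> Q (tperm x y)) -> forall p, p \in stab -> Q p.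
Proof.
move=> Q1 QM Qt p; move: {2}_.+1 (ltnSn #|[set x | p x != x]|) => n.
elim: n p => // n IHn p pn pc; case: (pickP (fun x => p x != x)) => [x px|p1]; last first.
  by suff -> : p = 1%g by []; apply/permP=> x; rewrite perm1; apply/eqP/negbFE/p1.
have -> : p = ((p * tperm (p x) x) * tperm (p x) x)%g by rewrite -mulgA tperm2 mulg1.
have cx : c (p x) = c x by apply/stabP.
apply: QM; last exact: Qt; apply: IHn; last by rewrite stabM ?stab_tperm.
rewrite -ltnS; apply: leq_trans pn; rewrite ltnS; apply: proper_card; apply/properP; split; last first.
  by exists x; rewrite !inE // permM tpermL eqxx.
apply/subsetP=> z; rewrite !inE permM; apply: contraNN => /eqP pz.
case: tpermP => [zx|zx|_ _]; last by rewrite pz.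
- by rewrite (perm_inj zx).
- by move: px; rewrite -zx pz pz eqxx.
Qed.
End Stab.

Section Rep.
Variables (K : fieldType) (charK : [pchar K] =i pred0) (T : finType) (A : algType K).
Variable h : {perm T} -> A.
(** The target is an arbitrary algebra, so that the permutations of a subset of the letters can also
    act on the group algebra of all of them. *)
Definition is_rep := h 1%g = 1 /\ forall p q, h (p * q)%g = h p * h q.
Hypothesis hrep : is_rep.
Let h1 := hrep.1.
Let hM := hrep.2.

Definition rsum (C : eqType) (c : T -> C) : A := \sum_(p in stab c) h p.
Definition csum (C : eqType) (c : T -> C) : A := \sum_(p in stab c) (-1) ^+ odd_perm p *: h p.

Lemma rsum_mulr (C : eqType) (c : T -> C) p : p \in stab c -> rsum c * h p = rsum c.
Proof.
move=> pc; rewrite mulr_suml [RHS](reindex_inj (mulIg p)) /=.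
by apply: eq_big => q; rewrite ?stabMr // -hM.
Qed.
Lemma csum_mull (C : eqType) (c : T -> C) p :
  p \in stab c -> h p * csum c = (-1) ^+ odd_perm p *: csum c.
Proof.
move=> pc; rewrite mulr_sumr scaler_sumr [RHS](reindex_inj (mulgI p)) /=.
apply: eq_big => q; rewrite ?stabMl // => _.
by rewrite -scalerAr -hM scalerA odd_permM signr_addb mulrA -signr_addb addbb mul1r.
Qed.

(** [Q] selects the colours along which symmetry is required. It is [predT] except in the vanishing
    argument for rectangles, where the last colour collects the odd letters. *)
Definition inv (C : eqType) (c : T -> C) (Q : pred C) (v : A) :=
  forall x y, c x = c y -> Q (c x) -> h (tperm x y) * v = v.

Lemma inv_stab (C : eqType) (c : T -> C) v p : inv c predT v -> p \in stab c -> h p * v = v.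
Proof.
move=> cv; move: p; apply: stab_ind => [|p q pv qv|x y cxy]; first by rewrite h1 mul1r.
- by rewrite hM -mulrA qv.
- exact: cv.
Qed.
Lemma rsum_inv (C : eqType) (c : T -> C) v : inv c predT v -> rsum c * v = #|stab c|%:R *: v.
Proof.
move=> cv; rewrite mulr_suml (eq_bigr (fun=> v)) => [|p]; last exact: inv_stab.
by rewrite sumr_const scaler_nat.
Qed.
Lemma card_stab_neq0 (C : eqType) (c : T -> C) : #|stab c|%:R != 0 :> K.
Proof. by apply: natr_neq0 => //; apply/card_gt0P; exists 1%g; apply: stab1. Qed.

Lemma tperm_conj (s : {perm T}) x y : (s * tperm (s x) (s y) = tperm x y * s)%g.
Proof. by rewrite -tpermJ /conjg !mulgA mulgV mul1g. Qed.

Lemma eq_opp0 (w : A) : w = - w -> w = 0.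
Proof.
move=> /eqP; rewrite -addr_eq0 -mulr2n -scaler_nat scaler_eq0 => /orP[|/eqP//].
by rewrite (negPf (natr_neq0 charK _)).
Qed.

(** Carried across [s], the same transposition fixes the product from the left and negates it from
    the right, and 2 is invertible. *)
Lemma antisym0 (a v : A) (s : {perm T}) x y : a * h (tperm x y) = a ->
  h (tperm (s x) (s y)) * v = - v -> a * h s * v = 0.
Proof.
move=> ax sv; apply: eq_opp0.
by rewrite -{1}ax -(mulrA a) -hM -tperm_conj hM mulrA -[LHS]mulrA sv mulrN.
Qed.

(* Recolouring x with the colour i: [raise] sums over the cosets of the stabiliser of the
   colour class i in that of its enlargement by x. *)
Definition recol (C : eqType) (c : T -> C) x i := fun y => if y == x then i else c y.
Definition raise (C : eqType) (c : T -> C) x i (v : A) :=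
  \sum_(y | recol c x i y == i) h (tperm x y) * v.

Lemma raiseE (C : eqType) (c : T -> C) x i v : c x != i ->
  raise c x i v = v + \sum_(y | c y == i) h (tperm x y) * v.
Proof.
move=> cx; rewrite /raise (bigD1 x) /recol ?eqxx //= tperm1 h1 mul1r; congr (_ + _).
by apply: eq_bigl => y; have [->|_] := eqVneq y x; rewrite ?andbT ?andbF ?(negPf cx).
Qed.

(** A transposition of the new class permutes the summands. If it fixes [x], conjugation turns
    [tperm x y] into another summand. If it is [tperm x z], then [tperm x z * tperm x y] equals
    [tperm x y * tperm y z], and the last factor fixes [v]. *)
Lemma raise_inv (C : eqType) (c : T -> C) (Q : pred C) x i v : c x != i -> Q i ->
  inv c Q v -> inv (recol c x i) Q (raise c x i v).
Proof.
move=> cx Qi cv y1 y2; set ps := recol c x i => py Qy; set p := tperm y1 y2.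
case: (eqVneq y1 y2) => [yy|yy]; first by rewrite /p yy tperm1 h1 mul1r.
have pst : p \in stab ps by apply: stab_tperm.
rewrite /raise mulr_sumr [RHS](reindex_inj (@perm_inj _ p)) /=.
apply: eq_big => [y|y /eqP pyi]; first by rewrite -/ps (stabP _ _ pst).
rewrite !mulrA -hM.
have [px|px] := eqVneq (p x) x.
  have -> : (p * tperm x y = tperm x (p y) * p)%g.
    by rewrite -(tperm_conj p x (p y)) px /p tpermK.
  rewrite hM -mulrA (cv y1 y2) //.
  - move: py Qy; rewrite /ps /recol; have [|_] := eqVneq y1 x; last have [|//] := eqVneq y2 x.
    + by move=> yx; move: px; rewrite /p -yx tpermL => /esym/eqP; rewrite (negPf yy).
    + by move=> yx; move: px; rewrite /p -yx tpermR => /eqP; rewrite (negPf yy).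
  - move: Qy; rewrite /ps /recol; have [yx|//] := eqVneq y1 x.
    by move: px; rewrite /p -yx tpermL => /esym/eqP; rewrite (negPf yy).
pose z := p x; have zx : p = tperm x z.
  rewrite /z /p; case: tpermP => [->|->|/eqP E1 /eqP E2] //; first by rewrite tpermC.
  by move: px; rewrite /p tpermD ?eqxx // eq_sym.
have psz : ps z = i.
  by rewrite /z (stabP _ _ pst) /ps /recol eqxx.
have cz : c z = i by move: psz; rewrite /ps /recol (negPf px).
rewrite zx; have [->|yx] := eqVneq y x; first by rewrite tperm1 tpermL mulg1.
have [->|yz] := eqVneq y z; first by rewrite tperm2 tpermR tperm1.
rewrite [in RHS]tpermD 1?eq_sym //.
have -> : (tperm x z * tperm x y = tperm x y * tperm y z)%g.
  have := tperm_conj (tperm x y) x z; rewrite tpermL (tpermD (z := z)) // ?[x == _]eq_sym //.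
rewrite hM -mulrA (cv y z) //; last by move: pyi; rewrite /ps /recol (negPf yx) => ->.
by move: pyi; rewrite /ps /recol (negPf yx) => ->.
Qed.

(** The number of points that [s] sends to a place of the right colour. The number of the others is
    the induction measure of both straightening arguments below. *)
Definition agr (C : eqType) (t f : T -> C) (s : {perm T}) := #|[set z | f (s z) == t z]|.

Lemma agr_lt (C : eqType) (t f : T -> C) (s : {perm T}) x y : f (s x) != t x -> f (s y) = t x ->
  t y != t x -> (agr t f s < agr t f (tperm x y * s)%g)%N.
Proof.
move=> fx fy ty; apply: proper_card; apply/properP; split; last first.
  by exists x; rewrite !inE // permM tpermL fy.
apply/subsetP=> z; rewrite !inE permM; case: tpermP => [->|->|//]; first by rewrite (negPf fx).
by rewrite fy eq_sym (negPf ty).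
Qed.

(** A straightening relation. The vanishing raised vector is multiplied by a h(s) and its summands
    are pulled back through [s]. Those with [t y = t x] equal a h(s) v again, because [a] absorbs
    the transposition; the others involve permutations that agree better, by [agr_lt]. *)
Lemma elim_step (C : eqType) (t f : T -> C) (a v : A) (s : {perm T}) x : f (s x) != t x ->
  (forall y, t x = t y -> a * h (tperm x y) = a) ->
  raise f (s x) (t x) v = 0 ->
  (1 + #|[set y | (f (s y) == t x) && (t y == t x)]|)%:R *: (a * h s * v)
    = - \sum_(y | (f (s y) == t x) && (t y != t x)) a * h (tperm x y * s)%g * v.
Proof.
move=> fx ax; rewrite raiseE // => rel.
have {rel} : a * h s * (v + \sum_(y | f y == t x) h (tperm (s x) y) * v) = 0 by rewrite rel mulr0.
rewrite mulrDr (reindex_inj (@perm_inj _ s)) /= mulr_sumr.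
rewrite [X in _ + X = 0](eq_bigr (fun y => a * h (tperm x y * s)%g * v)) => [|y _]; last first.
  by rewrite mulrA -(mulrA a) -hM tperm_conj.
rewrite (bigID (fun y => t y == t x)) /=.
rewrite (eq_bigr (fun=> a * h s * v)) => [|y /andP[_ /eqP tyx]]; last by rewrite hM mulrA ax.
rewrite sumr_const addrA => /eqP; rewrite addr_eq0 => /eqP <-.
rewrite natrD scalerDl scale1r scaler_nat; congr (_ + _ *+ _).
by apply: eq_card => y; rewrite !inE.
Qed.
End Rep.

(** * Highest vectors and Young symmetrisers *)

Definition rowsize (T : finType) (C : eqType) (c : T -> C) i := #|[set y | c y == i]|.

(** The analogue of a highest weight vector. Rows are compared by length only, so between rows of
    equal length the moves in both directions have to kill [v]. *)
Definition highest (K : fieldType) (T : finType) (A : algType K) (h : {perm T} -> A)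
    (C : eqType) (c : T -> C) (v : A) :=
  forall x i, c x != i -> (rowsize c (c x) <= rowsize c i)%N -> raise h c x i v = 0.

Section Chi.
Variables (K : fieldType) (charK : [pchar K] =i pred0) (T : finType) (C : eqType) (c : T -> C).

(** If the whole row of [s x] were in place, [s] would map it onto itself and could not send [x],
    from another row, into it as well. *)
Lemma misplaced_row (s : {perm T}) x : c (s x) != c x ->
  exists2 z, c z = c (s x) & c (s z) != c z.
Proof.
move=> sx; case: (pickP (fun z => (c z == c (s x)) && (c (s z) != c z))) => [z /andP[/eqP ? ?]|H].
  by exists z.
have : ([set z | c z == c (s x)] \proper [set z | c (s z) == c (s x)]).
  apply/properP; split; last by exists x; rewrite !inE // eq_sym.
  apply/subsetP=> z; rewrite !inE => /eqP cz; by have := H z; rewrite cz eqxx /= => /negbFE.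
move/proper_card; rewrite -[X in (_ < X)%N](card_imset _ (@perm_inj _ s)) ltnNge.
by rewrite subset_leq_card //; apply/subsetP=> w /imsetP[z zz ->]; move: zz; rewrite !inE.
Qed.

(** The scalar is chosen before the algebra, the representation and the vector, so it can be
    computed on one vector and used on another. The induction is on the number of misplaced points;
    without any, [s] preserves the rows and fixes [v]. *)
Lemma chi (s : {perm T}) : exists k : K, forall (A : algType K) (h : {perm T} -> A) (v : A),
  is_rep h -> inv h c predT v -> highest h c v -> rsum h c * h s * v = k *: v.
Proof.
move: {2}(#|T| - agr c c s)%N (leqnn (#|T| - agr c c s)) => n.
elim: n s => [|n IHn] s sn; case: (pickP (fun x => c (s x) != c x)) => [x0 x0P|sP].
- suff : (agr c c s < #|T|)%N by rewrite -subn_gt0 ltnNge sn.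
  rewrite -cardsT; apply: proper_card; apply/properP; split; first exact: subsetT.
  by exists x0; rewrite !inE.
- exists #|stab c|%:R => A h v hrep vi _; rewrite -mulrA (inv_stab hrep vi) ?(rsum_inv hrep vi) //.
  by apply/stabP=> x; apply/eqP/negbFE/sP.
(* A misplaced point in a longest possible row: the row of [s x] also has a misplaced point, by
   [misplaced_row], and so is not longer. Thus [highest] applies to moving [s x] into the row of
   [x]. *)
- pose x := [arg max_(x > x0 | c (s x) != c x) rowsize c (c x)].
  have [xP xmax] : c (s x) != c x /\ forall y, c (s y) != c y -> (rowsize c (c y) <= rowsize c (c x))%N.
    by rewrite /x; case: arg_maxnP => [|y yP ym]; [exact: x0P|split].
  have [z cz zP] := misplaced_row xP.
  have xz : (rowsize c (c (s x)) <= rowsize c (c x))%N by rewrite -cz xmax.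
  have /fin_all_exists[k kP] : forall y, exists k : K, c (s y) = c x -> c y != c x ->
      forall (A : algType K) (h : {perm T} -> A) (v : A), is_rep h -> inv h c predT v ->
      highest h c v -> rsum h c * h (tperm x y * s)%g * v = k *: v.
    move=> y; have [cy|/eqP ne] := eqVneq (c (s y)) (c x); last by exists 0 => /ne.
    have [_|yx] := eqVneq (c y) (c x); first by exists 0.
    have [|k kP] := IHn (tperm x y * s)%g; last by exists k => _ _; apply: kP.
    rewrite leq_subLR; move: sn; rewrite leq_subLR => /leq_trans-> //.
    by rewrite addnS -addSn leq_add2r agr_lt.
  pose N := (1 + #|[set y | (c (s y) == c x) && (c y == c x)]|)%N.
  exists (- N%:R^-1 * \sum_(y | (c (s y) == c x) && (c y != c x)) k y) => A h v hrep vi vh.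
  have := elim_step (a := rsum h c) (v := v) hrep xP.
  move/(_ (fun y cxy => rsum_mulr hrep (stab_tperm cxy)) (vh _ _ xP xz)).
  rewrite -/N => /(congr1 (fun w => N%:R^-1 *: w)).
  rewrite scalerA mulVf ?natr_neq0 // scale1r => ->.
  rewrite mulNr scaleNr scalerN; congr (- _); rewrite -scalerA; congr (_ *: _).
  by rewrite scaler_suml; apply: eq_bigr => y /andP[/eqP cy yx]; rewrite kP.
- exists #|stab c|%:R => A h v hrep vi _; rewrite -mulrA (inv_stab hrep vi) ?(rsum_inv hrep vi) //.
  by apply/stabP=> x; apply/eqP/negbFE/sP.
Qed.
End Chi.

Section Tableau.
Variables (T : finType) (C : eqType) (c : T -> C).

(* The letters are arranged in left-justified rows, one for each colour; [col x] is the column of x. *)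
Definition rowseq i := [seq y <- enum T | c y == i].
Definition col x := index x (rowseq (c x)).

Lemma mem_rowseq x i : (x \in rowseq i) = (c x == i).
Proof. by rewrite mem_filter mem_enum andbT. Qed.
Lemma size_rowseq i : size (rowseq i) = rowsize c i.
Proof.
by rewrite /rowsize -sum1dep_card -sum1_size big_filter big_enum_cond.
Qed.
Lemma col_inj x y : c x = c y -> col x = col y -> x = y.
Proof.
rewrite /col => cxy; rewrite cxy => E.
by rewrite -(nth_index x (s := rowseq (c y)) (x := x)) ?mem_rowseq ?cxy // E nth_index // mem_rowseq.
Qed.
Lemma col_lt x : (col x < rowsize c (c x))%N.
Proof. by rewrite -size_rowseq index_mem mem_rowseq. Qed.
Lemma cellP i j : (j < rowsize c i)%N -> exists y, c y = i /\ col y = j.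
Proof.
move=> ji; have [x0 _] : exists x0, x0 \in rowseq i.
  by move: ji; rewrite -size_rowseq; case: (rowseq i) => [//|x s] _; exists x; rewrite mem_head.
move: ji; rewrite -size_rowseq => ji; exists (nth x0 (rowseq i) j).
have E : c (nth x0 (rowseq i) j) = i by apply/eqP; rewrite -mem_rowseq mem_nth.
by split=> //; rewrite /col E index_uniq // filter_uniq ?enum_uniq.
Qed.

Definition cell x j := if [pick y | (c y == c x) && (col y == j)] is Some y then y else x.
Lemma cell_le x j : (j <= col x)%N -> c (cell x j) = c x /\ col (cell x j) = j.
Proof.
move=> jx; rewrite /cell; case: pickP => [y /andP[/eqP ? /eqP ?] //|H].
have [|y [cy yj]] := @cellP (c x) j; first exact: leq_ltn_trans jx (col_lt x).
by have := H y; rewrite cy yj !eqxx.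
Qed.

(** The sum of the squared row lengths, as a number of ordered pairs so that it can be compared by
    injections. *)
Definition sq := #|[set u : T * T | c u.1 == c u.2]|.
End Tableau.

(** Of two letters in a common [c']-row, take the one that [s] sends further to the right in the
    arrangement [c]. Its [c]-row reaches both columns; pairing its image with the cell of that row
    in the other column loses no information, since [c']-row and column determine a letter. *)
Lemma sq_le (T : finType) (C C' : eqType) (c : T -> C) (c' : T -> C') (s : {perm T}) :
  (forall x y, c' x = c' y -> col c (s x) = col c (s y) -> x = y) -> (sq c' <= sq c)%N.
Proof.
move=> inj; pose d x := col c (s x).
pose f u := if (d u.2 <= d u.1)%N then (s u.1, cell c (s u.1) (d u.2))
            else (cell c (s u.2) (d u.1), s u.2).
have fP u : c (f u).1 = c (f u).2 /\ col c (f u).1 = d u.1 /\ col c (f u).2 = d u.2.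
  rewrite /f; case: leqP => [le|/ltnW le] /=.
  - by have [-> ->] := cell_le le.
  - by have [-> ->] := cell_le le.
rewrite /sq -(card_in_imset (f := f) (D := mem [set u : T * T | c' u.1 == c' u.2])) => [|u1 u2]; last first.
  rewrite !inE => /eqP E1 /eqP E2 fE.
  have [_ [d11 d12]] := fP u1; have [_ [d21 d22]] := fP u2.
  have e1 : d u1.1 = d u2.1 by rewrite -d11 fE d21.
  have e2 : d u1.2 = d u2.2 by rewrite -d12 fE d22.
  move: fE; rewrite /f e1 e2; case: leqP => _ [].
  - move=> /perm_inj w1 _; have w2 : u1.2 = u2.2 by apply: inj; rewrite -?E1 -?E2 ?w1.
    by case: u1 u2 w1 w2 {E1 E2 d11 d12 d21 d22 e1 e2} => [? ?] [? ?] /= -> ->.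
  - move=> _ /perm_inj w2; have w1 : u1.1 = u2.1 by apply: inj; rewrite ?E1 ?E2 ?w2.
    by case: u1 u2 w1 w2 {E1 E2 d11 d12 d21 d22 e1 e2} => [? ?] [? ?] /= -> ->.
apply: subset_leq_card; apply/subsetP=> _ /imsetP[u _ ->].
by rewrite inE; case: (fP u) => -> _.
Qed.

Lemma sq_recol (T : finType) (C : eqType) (c : T -> C) x i : c x != i ->
  (rowsize c (c x) <= rowsize c i)%N -> (sq c < sq (recol c x i))%N.
Proof.
move=> xi le; set ps := recol c x i.
(* The pairs are split into those with [x] first, those with [x] only second, and those avoiding
   [x]; the last kind is unaffected by recolouring [x]. *)
have sqE (f : T -> C) : sq f = (rowsize f (f x) + ((rowsize f (f x)).-1 +
    #|[set u : T * T | [&& f u.1 == f u.2, u.1 != x & u.2 != x]]|))%N.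
  rewrite /sq -(cardsID [set u : T * T | u.1 == x]); congr (_ + _)%N.
    rewrite /rowsize -[RHS](card_imset _ (f := fun y => (x, y))) => [|? ? []] //.
    apply: eq_card => -[u1 u2]; rewrite !inE /=; apply/andP/imsetP => [[/eqP E /eqP ux]|[y]].
      by exists u2; rewrite ?inE -?E ux.
    by rewrite inE => /eqP yE [-> ->]; rewrite yE !eqxx.
  rewrite -(cardsID [set u : T * T | u.2 == x]); congr (_ + _)%N; last first.
    by apply: eq_card => -[u1 u2]; rewrite !inE /=; do 3!case: (_ == _).
  rewrite /rowsize (cardsD1 x [set y | f y == f x]) inE eqxx /=.
  rewrite -[RHS](card_imset _ (f := fun y => (y, x))) => [|? ? []] //.
  apply: eq_card => -[u1 u2]; rewrite !inE /=; apply/andP/imsetP => [[/andP[ux /eqP E] /eqP u2x]|[y]].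
    by exists u1; [rewrite !inE ux E u2x eqxx | rewrite u2x].
  by rewrite !inE => /andP[yx /eqP yE] [-> ->]; rewrite yE !eqxx yx.
have -> : sq ps = ((rowsize c i).+1 + (rowsize c i +
    #|[set u : T * T | [&& c u.1 == c u.2, u.1 != x & u.2 != x]]|))%N.
  have E : rowsize ps (ps x) = (rowsize c i).+1.
    rewrite {2}/ps /recol eqxx /rowsize (cardsD1 x) inE {1}/ps /recol eqxx eqxx add1n; congr _.+1.
    apply: eq_card => y; rewrite !inE /ps /recol; have [->|] //= := eqVneq y x.
    by rewrite (negPf xi).
  rewrite sqE E; congr (_ + (_ + _))%N; apply: eq_card => -[u1 u2]; rewrite !inE /= /ps /recol.
  by have [_|_] := eqVneq u1 x; have [_|_] := eqVneq u2 x; rewrite ?andbF.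
rewrite sqE addSn ltnS leq_add // leq_add2r; exact: leq_trans (leq_pred _) le.
Qed.

Section Young.
Variables (K : fieldType) (charK : [pchar K] =i pred0) (T : finType).
Notation KG := (galg K {perm T}).
Notation d := (@dl K {perm T}).

Lemma dl_rep : is_rep (d : {perm T} -> KG).
Proof. by split=> // p q; rewrite dlM. Qed.

(** The sandwich argument for Young symmetrisers: for each [s], the transposition of the two points
    is absorbed on the left and changes the sign on the right. *)
Lemma pigeon0 (C D : eqType) (c : T -> C) (f : T -> D) (z : KG) :
  (forall s : {perm T}, exists x y, [/\ x != y, c x = c y & f (s x) = f (s y)]) ->
  rsum d c * z * csum d f = 0.
Proof.
move=> H; rewrite galg_sandwich big1 // => s _; have [x [y [xy cxy fxy]]] := H s.
rewrite (antisym0 charK dl_rep (rsum_mulr dl_rep (stab_tperm cxy))) ?scaler0 //.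
rewrite (csum_mull dl_rep (stab_tperm fxy)) odd_tperm (inj_eq perm_inj) xy.
by rewrite scaleN1r.
Qed.

Lemma sq_pigeon (C C' : eqType) (c : T -> C) (c' : T -> C') (z : KG) : (sq c < sq c')%N ->
  rsum d c' * z * csum d (col c) = 0.
Proof.
move=> sqc; apply: pigeon0 => s.
case: (pickP (fun u : T * T => [&& u.1 != u.2, c' u.1 == c' u.2 & col c (s u.1) == col c (s u.2)])).
  by move=> [x y] /and3P[xy /eqP cxy /eqP fxy]; exists x, y.
move=> H; suff : (sq c' <= sq c)%N by rewrite leqNgt sqc.
apply: (sq_le (s := s)) => x y cxy fxy; apply/eqP/negPn/negP => xy.
by have := H (x, y); rewrite /= xy cxy fxy !eqxx.
Qed.

Lemma raiseM (C : eqType) (c : T -> C) x i (v w : KG) : raise d c x i (v * w) = raise d c x i v * w.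
Proof. by rewrite mulr_suml; apply: eq_bigr => y _; rewrite mulrA. Qed.

Lemma rsum_invd (C : eqType) (c : T -> C) (w : KG) : inv d c predT (rsum d c * w).
Proof.
move=> x y cxy _; rewrite mulrA; congr (_ * _); rewrite mulr_sumr.
rewrite [RHS](reindex_inj (mulgI (tperm x y))) /=.
by apply: eq_big => q; rewrite ?stabMl ?stab_tperm // dlM.
Qed.

(** The raised vector is invariant under the new rows, hence proportional to its own symmetrisation
    along them, and this vanishes by [sq_pigeon] because raising increases [sq]. *)
Lemma young_highest (C : eqType) (c : T -> C) : highest d c (rsum d c * csum d (col c) : KG).
Proof.
move=> x i xi le; rewrite raiseM.
set u := raise _ _ _ _ _; have ui : inv d (recol c x i) predT u.
  by apply: raise_inv => //; [exact: dl_rep|have := rsum_invd (c := c) 1; rewrite mulr1].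
have := rsum_inv dl_rep ui; move/(congr1 (fun w => w * csum d (col c))).
rewrite (sq_pigeon _ (sq_recol xi le)) -scalerAl => /esym/eqP.
by rewrite scaler_eq0 (negPf (card_stab_neq0 charK _)) => /eqP.
Qed.

Lemma galg_setE (S : {set {perm T}}) (w : {perm T} -> K) g :
  (\sum_(p in S) w p *: d p) g = if g \in S then w g else 0.
Proof.
rewrite galg_sumE; case: ifP => gS.
  rewrite (bigD1 g) //= galgZ dlE eqxx mulr1 big1 ?addr0 // => p /andP[_ pg].
  by rewrite galgZ dlE eq_sym (negPf pg) mulr0.
rewrite big1 // => p pS; rewrite galgZ dlE; case: eqP => [E|_]; last by rewrite mulr0.
by rewrite E pS in gS.
Qed.
Lemma rsumE (C : eqType) (c : T -> C) g : rsum d c g = (g \in stab c)%:R :> K.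
Proof.
rewrite /rsum (eq_bigr (fun p => 1 *: d p)) => [|p _]; last by rewrite scale1r.
by rewrite galg_setE; case: ifP.
Qed.
Lemma csumE (C : eqType) (c : T -> C) g :
  csum d c g = if g \in stab c then (-1) ^+ odd_perm g else 0 :> K.
Proof. by rewrite /csum galg_setE. Qed.

(** In a field of characteristic 0 a sum of nonzero squares may vanish; with integral coefficients
    it is the image of a positive natural number and cannot. *)
Definition integral (x : K) := exists k : int, x = k%:~R.
Lemma integral_sum I (r : seq I) (P : pred I) (F : I -> K) :
  (forall i, P i -> integral (F i)) -> integral (\sum_(i <- r | P i) F i).
Proof.
move=> H; elim/big_rec: _ => [|i x Pi [k ->]]; first by exists 0.
by have [j ->] := H i Pi; exists (j + k); rewrite rmorphD.
Qed.
Lemma integral_mul (x y : KG) : (forall g, integral (x g)) -> (forall g, integral (y g)) ->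
  forall g, integral ((x * y) g).
Proof.
move=> Hx Hy g; rewrite galgM; apply: integral_sum => p _.
by have [j ->] := Hx p; have [k ->] := Hy (p^-1 * g)%g; exists (j * k); rewrite rmorphM.
Qed.

Lemma galg_mulV (x y z w : KG) : (forall g, z g^-1%g = x g) -> (forall g, w g^-1%g = y g) ->
  forall g, (w * z) g^-1%g = (x * y) g.
Proof.
move=> zx wy g; rewrite !galgM [RHS](reindex_inj (mulgI g)) /=.
by apply: eq_bigr => p _; rewrite -zx -wy mulrC !invMg !invgK mulKg.
Qed.

Lemma trace_mulC (x y : KG) : (x * y) 1%g = (y * x) 1%g.
Proof.
rewrite !galgM (reindex_inj invg_inj) /=; apply: eq_bigr => p _.
by rewrite invgK !mulg1 mulrC.
Qed.

(* With a = [rsum] and b = [csum], the element z = aba has integral coefficients, is symmetric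
   under inversion and has nonzero trace, so the trace of zz = |R| ababa is a nonzero sum of squares. *)
Lemma young_sqr_neq0 (C : eqType) (c : T -> C) :
  rsum d c * csum d (col c) * (rsum d c * csum d (col c)) != 0 :> KG.
Proof.
set a := rsum d c; set b := csum d (col c).
have aa : a * a = #|stab c|%:R *: a.
  by have := rsum_invd (c := c) 1; rewrite mulr1 => /(rsum_inv dl_rep).
pose z := a * b * a.
apply/eqP=> abab; have zz : z * z = 0.
  have -> : z * z = (a * b) * (a * a) * (b * a) by rewrite /z !mulrA.
  rewrite aa -scalerAr -scalerAl; have -> : a * b * a * (b * a) = a * b * (a * b) * a by rewrite !mulrA.
  by rewrite abab mul0r scaler0.
have aint g : integral (a g) by rewrite rsumE; case: (_ \in _); [exists 1|exists 0].
have bint g : integral (b g).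
  by rewrite csumE; case: ifP => _; [exists ((-1) ^+ odd_perm g); rewrite rmorphXn rmorphN1|exists 0].
have zint g : integral (z g) by apply: integral_mul => // g'; apply: integral_mul.
have aV g : a g^-1%g = a g by rewrite !rsumE stabVE.
have bV g : b g^-1%g = b g.
  by rewrite !csumE odd_permV stabVE.
have zV g : z g^-1%g = z g.
  by rewrite {2}/z -mulrA; apply: galg_mulV => // g'; apply: galg_mulV.
have z1 : z 1%g = #|stab c|%:R.
  rewrite /z trace_mulC mulrA aa -scalerAl galgZ -[RHS]mulr1; congr (_ * _).
  rewrite galgM (bigD1 1%g) //= rsumE stab1 csumE invg1 mul1g stab1 odd_perm1 mul1r big1 ?addr0 // => p p1.
  rewrite rsumE csumE mulg1; case: (boolP (p \in stab c)) => [/stabP pr|_]; last by rewrite mul0r.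
  case: ifP => [/stabV|_]; last by rewrite mulr0.
  rewrite invgK => /stabP pc; case/eqP: p1; apply/permP=> x; rewrite perm1.
  exact: col_inj (pr x) (pc x).
have /fin_all_exists[k kE] : forall g, exists k : int, z g = k%:~R by exact: zint.
have : (\sum_g `|k g|%N ^ 2)%N%:R = 0 :> K.
  transitivity ((z * z) 1%g); last by rewrite zz ffunE.
  rewrite natr_sum galgM; apply: eq_bigr => g _.
  rewrite mulg1 zV kE natrX -expr2; case: (k g) => j; first by rewrite -pmulrn.
  by rewrite NegzE mulrNz sqrrN abszN -pmulrn.
apply/eqP/natr_neq0 => //; rewrite (bigD1 1%g) //= ltn_addr // expn_gt0.
rewrite lt0n absz_eq0; apply/orP; left; apply/eqP => k0; move: z1; rewrite kE k0 => /esym/eqP.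
by rewrite (negPf (card_stab_neq0 charK _)).
Qed.

(** The scalars of [chi] are added up with signs over the column stabiliser. The total is nonzero
    because the Young symmetriser is itself highest, and on it the operator gives its square. *)
Lemma chi_young (C : eqType) (c : T -> C) : exists2 k : K, k != 0 &
  forall (A : algType K) (h : {perm T} -> A) (v : A),
  is_rep h -> inv h c predT v -> highest h c v -> rsum h c * csum h (col c) * v = k *: v.
Proof.
have /fin_all_exists[k kP] := chi charK c.
pose k0 := \sum_(p in stab (col c)) (-1) ^+ odd_perm p * k p.
have k0P (A : algType K) (h : {perm T} -> A) (v : A) :
    is_rep h -> inv h c predT v -> highest h c v -> rsum h c * csum h (col c) * v = k0 *: v.
  move=> hrep vi vh; rewrite {1}/csum; have kPv p := kP p A h v hrep vi vh.
  move: (rsum h c) kPv => a kPv; rewrite mulr_sumr mulr_suml scaler_suml; apply: eq_bigr => p _.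
  by rewrite -scalerAr -scalerAl kPv scalerA.
exists k0 => //; apply/eqP=> k00; have /eqP[] := young_sqr_neq0 c.
rewrite k0P ?k00 ?scale0r //; [exact: dl_rep|exact: rsum_invd|exact: young_highest].
Qed.
End Young.

(** Applied to predicates that quantify over vectors, hence the classical case distinction. *)
Lemma ex_max (P : nat -> Prop) N : (exists n, P n) -> (forall n, P n -> (n <= N)%N) ->
  exists2 n, P n & forall k, P k -> (k <= n)%N.
Proof.
move=> [n0 Pn0] PN; have [j nj] : exists j, (N - n0 <= j)%N by exists (N - n0)%N.
elim: j n0 Pn0 nj => [|j IHj] n Pn nj.
  by exists n => // k /PN kN; apply: leq_trans kN _; rewrite -subn_eq0 -leqn0.
case: (classic (exists2 k, P k & (n < k)%N)) => [[k Pk nk]|H].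
  apply: (IHj k) => //; have := PN _ Pk; move: nj; rewrite !leq_subLR => nj kN.
  by apply: leq_trans nj _; rewrite addnS -addSn leq_add2r.
by exists n => // k Pk; rewrite leqNgt; apply/negP=> nk; case: H; exists k.
Qed.

(** * Rectangular Young elements and vectors with the symmetry of a word *)

Section ExtPerm.
Variables (T T' : finType) (io : T -> T') (ioI : injective io).

Definition ext_fun (p : {perm T}) x := if [pick y | io y == x] is Some y then io (p y) else x.
Lemma ext_funE p y : ext_fun p (io y) = io (p y).
Proof.
by rewrite /ext_fun; case: pickP => [z /eqP/ioI-> //|/(_ y)]; rewrite eqxx.
Qed.
Lemma ext_fun_out p x : (forall y, io y != x) -> ext_fun p x = x.
Proof. by move=> H; rewrite /ext_fun; case: pickP => // y; rewrite (negPf (H y)). Qed.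
Lemma io_case x : (exists y, x = io y) \/ (forall y, io y != x).
Proof.
by case: (pickP (fun y => io y == x)) => [y /eqP <-|H]; [left; exists y|right=> y; rewrite H].
Qed.
Lemma ext_fun_inj p : injective (ext_fun p).
Proof.
apply: (can_inj (g := ext_fun p^-1%g)) => x; case: (io_case x) => [[y ->]|H].
  by rewrite !ext_funE permK.
by rewrite !ext_fun_out.
Qed.
Definition ext_perm p : {perm T'} := perm (@ext_fun_inj p).
Lemma ext_permE p y : ext_perm p (io y) = io (p y). Proof. by rewrite permE ext_funE. Qed.
Lemma ext_perm_out p x : (forall y, io y != x) -> ext_perm p x = x.
Proof. by move=> H; rewrite permE ext_fun_out. Qed.
Lemma ext_perm1 : ext_perm 1 = 1%g.
Proof.
apply/permP=> x; rewrite perm1; case: (io_case x) => [[y ->]|H]; last exact: ext_perm_out.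
by rewrite ext_permE perm1.
Qed.
Lemma ext_permM p q : ext_perm (p * q) = (ext_perm p * ext_perm q)%g.
Proof.
apply/permP=> x; rewrite permM; case: (io_case x) => [[y ->]|H].
  by rewrite !ext_permE permM.
by rewrite !ext_perm_out.
Qed.
Lemma ext_tperm x y : ext_perm (tperm x y) = tperm (io x) (io y).
Proof.
apply/permP=> z; case: (io_case z) => [[u ->]|H]; last by rewrite ext_perm_out // tpermD.
by rewrite ext_permE; case: (tpermP x y u) => [->|->|/eqP ux /eqP uy];
  rewrite ?tpermL ?tpermR // tpermD // (inj_eq ioI) eq_sym.
Qed.
Lemma odd_ext p : odd_perm (ext_perm p) = odd_perm p.
Proof.
have pt : p \in stab (fun _ : T => tt) by apply/stabP.
move: p pt; apply: stab_ind => [|p q Hp Hq|x y _]; first by rewrite ext_perm1 !odd_perm1.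
  by rewrite ext_permM !odd_permM Hp Hq.
by rewrite ext_tperm !odd_tperm (inj_eq ioI).
Qed.
Lemma ext_stab (C C' : eqType) (c : T' -> C) (c' : T -> C') p :
  (forall x y, c' x = c' y -> c (io x) = c (io y)) -> p \in stab c' -> ext_perm p \in stab c.
Proof.
move=> cc /stabP pc; apply/stabP=> x; case: (io_case x) => [[y ->]|H].
  by rewrite ext_permE; apply/cc/pc.
by rewrite ext_perm_out.
Qed.
End ExtPerm.

Section Ideals.
Variables (K : fieldType) (charK : [pchar K] =i pred0).

Definition dl_ext (T T' : finType) (io : T -> T') (ioI : injective io) : {perm T} -> galg K {perm T'} :=
  fun p => dl K (ext_perm ioI p).
Lemma dl_ext_rep (T T' : finType) (io : T -> T') (ioI : injective io) : is_rep (dl_ext ioI).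
Proof. by split=> [|p q]; rewrite /dl_ext ?ext_perm1 // ext_permM dlM. Qed.

(** The Young element of a diagram with set of boxes [T], placed in [T'] by [io]. Going through
    [dl_ext] makes the lemmas on arbitrary representations available for it. *)
Definition young (T T' : finType) (C D : eqType) (c : T -> C) (f : T -> D) (io : T -> T')
  (ioI : injective io) : galg K {perm T'} := rsum (dl_ext ioI) c * csum (dl_ext ioI) f.

(* [hook_vec w v]: v transforms like a word w of a super tensor power with even letters
   ['I_m] and odd letters ['I_l] under the permutations fixing w. *)
Definition oddl m l (a : 'I_m + 'I_l) : bool := if a is inr _ then true else false.
Definition hook_vec (T : finType) (C : eqType) (w : T -> C) (o : C -> bool) (v : galg K {perm T}) :=
  forall x y, x != y -> w x = w y -> dl K (tperm x y) * v = (-1) ^+ o (w x) *: v.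

Section HookVector.
Variables (T : finType) (m l : nat).
Notation d := (dl K (gT := {perm T})).
Notation KG := (galg K {perm T}).
Variable M : KG -> Prop.
Hypothesis ML : forall g v, M v -> M (d g * v).
Hypothesis MD : forall v w, M v -> M w -> M (v + w).
Hypothesis MZ : forall a v, M v -> M (a *: v).

Lemma M_sum I (r : seq I) (P : pred I) (F : I -> KG) v : M v ->
  (forall i, P i -> M (F i)) -> M (\sum_(i <- r | P i) F i).
Proof.
move=> Mv H; elim/big_rec: _ => [|i x Pi Mx]; last by apply: MD => //; apply: H.
by rewrite -(scale0r v); apply: MZ.
Qed.
Lemma M_mul z v : M v -> M (z * v).
Proof.
move=> Mv; rewrite [z]galg_expand mulr_suml; apply: (M_sum _ Mv) => g _.
by rewrite -scalerAl; apply/MZ/ML.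
Qed.

Hypothesis kill : forall (io : 'I_m.+1 * 'I_l.+1 -> T) (ioI : injective io) v, M v ->
  young fst snd ioI * v = 0.

(** In m + 1 rows longer than l the first l + 1 columns form a rectangle. Its row sum is absorbed by
    the row sum of [c], and its column sum by the column sum of [c]. So, up to nonzero factors, the
    rectangle can be inserted into the product that sends [v] to [k *: v]; but it kills [M]. *)
Lemma big_rows (c : {ffun T -> T}) v : M v -> v != 0 -> inv d c predT v -> highest d c v ->
  (#|[set i | l < rowsize c i]| <= m)%N.
Proof.
move=> Mv v0 vi vh; rewrite leqNgt; apply/negP=> mB.
have [k k0 kP] := chi_young charK c.
pose ka (i : 'I_m.+1) : T := enum_val (widen_ord mB i).
have kaB i : (l < rowsize c (ka i))%N by have := enum_valP (widen_ord mB i); rewrite inE.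
have kaI : injective ka by move=> i j /enum_val_inj/(congr1 val) /= ij; apply: val_inj.
pose io (u : 'I_m.+1 * 'I_l.+1) :=
  if [pick y | (c y == ka u.1) && (col c y == u.2)] is Some y then y else ka u.1.
have ioP u : c (io u) = ka u.1 /\ col c (io u) = u.2.
  rewrite /io; case: pickP => [y /andP[/eqP ? /eqP ?] //|H].
  have [|y [cy yj]] := @cellP _ _ c (ka u.1) u.2.
    by apply: leq_trans (kaB u.1); rewrite ltn_ord.
  by have := H y; rewrite cy yj !eqxx.
have ioI : injective io.
  move=> u1 u2 E; have [E1 E2] := ioP u1; have [F1 F2] := ioP u2.
  case: u1 u2 E E1 E2 F1 F2 => [i j] [i' j'] /= E; rewrite E => -> -> /kaI-> /val_inj-> //.
have := kP _ _ _ (dl_rep _ _) vi vh.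
have := kill ioI (M_mul (csum d (col c)) Mv).
have aA : rsum d c * rsum (dl_ext ioI) fst = #|stab (fst : 'I_m.+1 * 'I_l.+1 -> _)|%:R *: rsum d c.
  rewrite [X in _ * X]/rsum mulr_sumr (eq_bigr (fun=> rsum d c)) ?sumr_const ?scaler_nat // => p pst.
  rewrite rsum_mulr //; first exact: dl_rep.
  apply: ext_stab pst => x y xy; have [-> _] := ioP x; have [-> _] := ioP y; by rewrite xy.
have bB : csum (dl_ext ioI) snd * csum d (col c)
    = #|stab (snd : 'I_m.+1 * 'I_l.+1 -> _)|%:R *: csum d (col c).
  rewrite [X in X * _]/csum mulr_suml (eq_bigr (fun=> csum d (col c))) ?sumr_const ?scaler_nat // => p pst.
  rewrite -scalerAl (csum_mull (dl_rep K T)).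
    by rewrite scalerA odd_ext -signr_addb addbb scale1r.
  apply: ext_stab pst => x y xy; have [_ ->] := ioP x; have [_ ->] := ioP y; by rewrite xy.
rewrite /young -[X in X = 0 -> _]mulrA [X in _ * X = 0 -> _]mulrA bB => /(congr1 (fun z => rsum d c * z)).
rewrite mulr0 -scalerAl -!scalerAr mulrA aA -!scalerAl => /eqP; rewrite !scaler_eq0.
rewrite !(negPf (card_stab_neq0 charK _)) mulrA /= => /eqP -> /esym/eqP.
by rewrite scaler_eq0 (negPf k0) (negPf v0).
Qed.

Lemma hook_vector v : M v -> v != 0 ->
  exists w : T -> 'I_m + 'I_l, exists v', [/\ M v', v' != 0 & hook_vec w (@oddl m l) v'].
Proof.
move=> Mv v0.
pose P n := exists c : {ffun T -> T}, exists v', [/\ M v', v' != 0, inv d c predT v' & sq c = n].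
have [|n [c' [v' [_ _ _ <-]]]|n [c [u [Mu u0 ui sqc]]] nmax] := @ex_max P #|[set: T * T]|.
- exists (sq [ffun x : T => x]), [ffun x => x], v; split=> // x y; rewrite !ffunE => -> _.
  by rewrite tperm1 mul1r.
- by apply: subset_leq_card; apply: subsetT.
(* Otherwise the raised vector, still in [M], would belong to an arrangement with a larger sum of
   squares. *)
have uh : highest d c u.
  move=> x i xi le; apply/eqP/negP=> /negP r0.
  have : P (sq (recol c x i)).
    exists (finfun (recol c x i)), (raise d c x i u); split=> //.
    - by apply: (M_sum _ Mu) => y _; apply: ML.
    - have := raise_inv (dl_rep K T) xi (erefl : predT i) ui.
      by move=> H y z; rewrite !ffunE; apply: H.
    - by apply: eq_card => -[y z]; rewrite !inE !ffunE.
  by move/nmax; rewrite leqNgt -sqc sq_recol.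
have Bm := big_rows Mu u0 ui uh.
pose small x := (rowsize c (c x) <= l)%N.
pose D := {x | small x}; pose io : D -> T := val; have ioI : injective io by exact: val_inj.
pose cD (x : D) := c (val x).
have row_small i : (rowsize c i <= l)%N -> rowsize cD i = rowsize c i.
  move=> il; rewrite /rowsize -(card_imset _ ioI); apply: eq_card => y; rewrite inE.
  apply/imsetP/eqP=> [[x]|yi]; first by rewrite inE => /eqP <- ->.
  have ys : small y by rewrite /small yi.
  by exists (Sub y ys : D); rewrite ?inE /cD /= ?yi.
have row_empty i : (l < rowsize c i)%N -> rowsize cD i = 0.
  move=> il; apply/eqP; rewrite cards_eq0; apply/eqP/setP=> x; rewrite !inE; apply/negP=> /eqP xi.
  by have := valP x; rewrite /small -/(cD x) xi leqNgt il.
have hrep := dl_ext_rep ioI.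
have ui' : inv (dl_ext ioI) cD predT u.
  by move=> x y xy _; rewrite /dl_ext ext_tperm; apply: ui.
(* A colour whose class inside [D] is at least as large as a nonempty short row cannot be a long
   row, since long rows do not meet [D]. Hence the raising inside [D] has the same summands as the
   one in [T]. *)
have uh' : highest (dl_ext ioI) cD u.
  move=> x i xi; rewrite (row_small (cD x)) => [le|]; last exact: (valP x).
  have il : (rowsize c i <= l)%N.
    rewrite leqNgt; apply/negP=> il; move: le; rewrite row_empty // leqn0 cards_eq0 => /eqP/setP/(_ (val x)).
    by rewrite !inE eqxx.
  rewrite -[RHS](uh (val x) i xi); last by rewrite -(row_small i).
  rewrite (raiseE hrep) // (raiseE (dl_rep K T)) //.
  congr (_ + _); rewrite [RHS](@reindex_omap _ _ _ _ _ (val : D -> T) (insub : T -> option D)) /=; last first.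
    move=> y /eqP yi; have ys : small y by rewrite /small yi.
    by rewrite insubT.
  apply: eq_big => y; first by rewrite valK eqxx andbT.
  by move=> _; rewrite /dl_ext ext_tperm.
have [k k0 kP] := chi_young charK cD.
have := kP _ _ _ hrep ui' uh'; set b := csum _ _ => bE.
pose B := [set i | (l < rowsize c i)%N].
(* A row longer than [l] is an even letter, numbered by its position in [B]. A point of a short row
   carries the odd letter of its column, which is less than [l]. *)
pose spec x (a : 'I_m + 'I_l) := match a with
  | inl i => ~~ small x /\ i = index (c x) (enum B) :> nat
  | inr j => exists xs : small x, j = col cD (Sub x xs) :> nat end.
have /fin_all_exists[w wP] : forall x, exists a, spec x a.
  move=> x; have [xs|xs] := boolP (small x).
    have lt : (col cD (Sub x xs) < l)%N.
      by apply: leq_trans (col_lt cD _) _; rewrite row_small; exact: xs.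
    by exists (inr (Ordinal lt)), xs.
  have lt : (index (c x) (enum B) < m)%N.
    by apply: leq_trans Bm; rewrite cardE index_mem mem_enum inE ltnNge.
  by exists (inl (Ordinal lt)).
(* The vector is nonzero because the row sum of the short rows maps it to [k *: u]. *)
exists w, (b * u); split; first exact: M_mul.
  apply/eqP=> bu0; move: bE; rewrite -mulrA bu0 mulr0 => /esym/eqP.
  by rewrite scaler_eq0 (negPf k0) (negPf u0).
move=> x y xy wxy; have := wP x; have := wP y; rewrite -wxy; case: (w x) => [i|j] /=.
  move=> [ys yi] [xs xi]; rewrite expr0 scale1r.
  have cxy : c x = c y.
    rewrite -(nth_index (c x) (s := enum B) (x := c x)) ?mem_enum ?inE ?ltnNge //.
    by rewrite -xi yi nth_index // mem_enum inE ltnNge.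
  rewrite /b mulrA mulr_sumr !mulr_suml; apply: eq_bigr => p _.
  rewrite -scalerAr -!scalerAl /dl_ext -dlM; congr (_ *: _).
  have out z : ~~ small z -> forall t : D, io t != z.
    by move=> zs t; apply/eqP=> tz; move: zs; rewrite -tz (valP t).
  rewrite -tperm_conj !ext_perm_out; try exact: out.
  by rewrite dlM -mulrA ui.
move=> [ys yj] [xs xj]; rewrite expr1 scaleN1r.
have -> : tperm x y = ext_perm ioI (tperm (Sub x xs) (Sub y ys)) by rewrite ext_tperm.
rewrite mulrA; have -> : dl K (ext_perm ioI (tperm (Sub x xs) (Sub y ys)))
  = dl_ext ioI (tperm (Sub x xs) (Sub y ys)) by [].
rewrite (csum_mull hrep) ?stab_tperm -?xj // odd_tperm -(inj_eq val_inj) /= xy.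
by rewrite expr1 -scalerAl scaleN1r.
Qed.
End HookVector.
End Ideals.

(** * Vanishing of rectangles on words with m even and l odd letters *)

Lemma pigeonhole (T C : finType) (S : {set T}) (R : {set C}) (f : T -> C) :
  (forall x, x \in S -> f x \in R) -> (#|R| < #|S|)%N ->
  exists x y, [/\ x \in S, y \in S, x != y & f x = f y].
Proof.
move=> fR CS; case: (pickP (fun u : T * T => [&& u.1 \in S, u.2 \in S, u.1 != u.2 & f u.1 == f u.2])).
  by move=> [x y] /and4P[xS yS xy /eqP fxy]; exists x, y.
move=> H; move: CS; rewrite ltnNge -(card_in_imset (f := f) (D := mem S)) => [|x y xS yS fxy]; last first.
  by apply/eqP/negPn/negP=> xy; have := H (x, y); rewrite /= xy fxy eqxx xS yS.
by rewrite subset_leq_card //; apply/subsetP=> _ /imsetP[x xS ->]; apply: fR.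
Qed.

Section Vanish.
Variables (K : fieldType) (charK : [pchar K] =i pred0) (T : finType) (m l : nat).
Notation d := (dl K (gT := {perm T})).
Notation KG := (galg K {perm T}).
Variables (t : T -> 'I_m.+1) (cc : T -> 'I_l.+1).
Hypothesis tsize : forall i, rowsize t i = l.+1.

(** A colouring whose Young subgroup is the symmetric group of [S]. *)
Definition cset (S : {set T}) (x : T) := if x \in S then None else Some x.

Lemma cset_eq S x y : cset S x = cset S y -> x != y -> x \in S /\ y \in S.
Proof. by rewrite /cset; case: ifP; case: ifP => // _ _ [->]; rewrite eqxx. Qed.

(** [cc] takes only l + 1 values. On a larger set two points always share one, so symmetrising [v]
    over it gives 0 by [pigeon0], although invariance makes the result a nonzero multiple of [v]. *)
Lemma card_class_le (S : {set T}) (u v : KG) : v = u * csum d cc -> v != 0 ->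
  (forall x y, x \in S -> y \in S -> d (tperm x y) * v = v) -> (#|S| <= l.+1)%N.
Proof.
move=> vE v0 vS; rewrite leqNgt; apply/negP=> lS; case/eqP: v0.
have vi : inv d (cset S) predT v.
  move=> x y cxy _; have [->|xy] := eqVneq x y; first by rewrite tperm1 mul1r.
  by have [xS yS] := cset_eq cxy xy; apply: vS.
have := rsum_inv (dl_rep K T) vi; rewrite {1}vE mulrA pigeon0 // => [/esym/eqP|s].
  by rewrite scaler_eq0 (negPf (card_stab_neq0 charK _)) => /eqP.
have [||x [y [xS yS xy sxy]]] := @pigeonhole _ _ S setT (fun x => cc (s x)).
- by move=> y _; rewrite inE.
- by rewrite cardsT card_ord.
by exists x, y; split=> //; rewrite /cset xS yS.
Qed.

Lemma rsum_cset_conj (S : {set T}) (s : {perm T}) :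
  rsum d (cset S) * d s = d s * rsum d (cset [set s x | x in S]) :> KG.
Proof.
rewrite mulr_suml mulr_sumr (reindex_inj (h := fun p => s * p * s^-1)%g) /=; last first.
  by move=> p q /mulIg/mulgI.
apply: eq_big => [p|p _]; last by rewrite -!dlM -!mulgA mulVg mulg1.
have inS x : (s x \in [set s y | y in S]) = (x \in S) by rewrite mem_imset //; apply: perm_inj.
apply/stabP/stabP=> H x; rewrite /cset in H *.
  have := H (s^-1%g x); rewrite !permM permKV -(inS (_ x)) permKV -(inS (_ _)) permKV.
  by case: ifP; case: ifP => // _ _ [] /(congr1 s); rewrite !permKV => ->.
rewrite !permM -(inS (_ (p _))) -(inS x) permKV; have := H (s x).
by case: ifP; case: ifP => // _ _ [->]; rewrite permK.
Qed.

(** Suppose [v] is nonzero. Even letters remain separate colours, while all odd letters are merged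
    into the last colour. Of their antisymmetry one consequence is kept: symmetrising over l + 1
    points of the last colour gives 0. Among the nonzero vectors with these properties in the left
    ideal, one of largest weight is killed by all moves into smaller colours. Straightening then
    reduces to permutations putting rows 0, ..., m - 1 of [t] exactly into the colours 0, ..., m -
    1. The last row, with l + 1 points, falls into the last colour and is symmetrised to 0. *)
Lemma rect_hook_vec0 (w : T -> 'I_m + 'I_l) (u v : KG) :
  v = u * (rsum d t * csum d cc) -> hook_vec w (@oddl m l) v -> v = 0.
Proof.
move=> vE wv; apply/eqP/negPn/negP=> v0.
pose good (f : {ffun T -> 'I_m.+1}) (x : KG) := [/\ x != 0, exists u, x = u * (rsum d t * csum d cc),
  inv d f (fun i => i < m)%N x & forall S : {set T}, #|S| = l.+1 -> (forall y, y \in S -> f y = ord_max) ->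
    rsum d (cset S) * x = 0].
(* A smaller colour weighs more and the last colour weighs 0, so moving a point into a smaller
   colour increases the weight. *)
pose wt (f : {ffun T -> 'I_m.+1}) := (\sum_x (m - f x))%N.
pose P n := exists f x, good f x /\ wt f = n.
have [|n|n [f [x [[x0 [ux xE] xi xS] <-]]] nmax] := @ex_max P (\sum_(x : T) m)%N.
- pose f := [ffun x => if w x is inl i then widen_ord (leqnSn m) i else ord_max].
  exists (wt f), f, v; split=> //; split=> //; first by exists u.
    move=> y z; rewrite !ffunE => fyz fy.
    have [->|yz] := eqVneq y z; first by rewrite tperm1 mul1r.
    have wyz : w y = w z.
      move: fyz fy; case: (w y) => [i|j]; last by rewrite ltnn.
      case: (w z) => [i'|j']; first by move/(congr1 val) => /= ii _; congr inl; apply: val_inj.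
      by move/(congr1 val) => /= -> ; rewrite ltnn.
    rewrite wv //; move: fy; case: (w y) => [i|j] /=; last by rewrite ltnn.
    by rewrite expr0 scale1r.
  move=> S Sl Sf.
  have Sw y : y \in S -> exists j, w y = inr j.
    move/Sf; rewrite ffunE; case: (w y) => [i|j] E; last by exists j.
    have im : (i : nat) = m by exact: (congr1 val E).
    by have := ltn_ord i; rewrite im ltnn.
  (* Among l + 1 points carrying odd letters two carry the same one, and [v] changes sign under
     their transposition. *)
  have [y /Sw[j ->]||y [z [yS zS yz wyz]]] := @pigeonhole _ _ S [set inr j | j in 'I_l] w.
  - by rewrite imset_f.
  - by apply: leq_ltn_trans (leq_imset_card _ _) _; rewrite card_ord Sl.
  have := @antisym0 _ charK T _ _ (dl_rep K T) (rsum d (cset S)) v 1%g y z.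
  rewrite !perm1 dl1 mulr1; apply.
    by apply: rsum_mulr; [exact: dl_rep|apply: stab_tperm; rewrite /cset yS zS].
  by have [j wj] := Sw _ yS; rewrite wv // wj expr1 scaleN1r.
- by move=> [f [x [_ <-]]]; apply: leq_sum => y _; apply: leq_subr.
(* Were the raised vector nonzero, it would contradict maximality. The condition on [S] survives
   because [i < m]: the transpositions in [raise] avoid the points that keep the last colour, so the
   symmetriser of [S] commutes with them. *)
have xh y (i : 'I_m.+1) : (i < f y)%N -> raise d f y i x = 0.
  move=> ify; apply/eqP/negPn/negP=> r0.
  have im : (i < m)%N by apply: leq_trans ify _; rewrite -ltnS.
  have fyi : f y != i by rewrite -(inj_eq val_inj) gtn_eqF.
  have : P (wt (finfun (recol f y i))).
    exists (finfun (recol f y i)), (raise d f y i x); split=> //; split=> //.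
    - by exists (\sum_(z | recol f y i z == i) d (tperm y z) * ux); rewrite mulr_suml xE; apply: eq_bigr => z _; rewrite mulrA.
    - have H := @raise_inv _ _ _ _ (dl_rep K T) _ f (fun i : 'I_m.+1 => i < m)%N y i x fyi im xi.
      by move=> z1 z2; rewrite !ffunE; apply: H.
    - move=> S Sl Sf; rewrite mulr_sumr big1 // => z zi.
      have nS t' : recol f y i t' = i -> t' \notin S.
        move=> ti; apply/negP=> tS; move: (Sf _ tS); rewrite ffunE ti => im'.
        by move: im; rewrite im' ltnn.
      have yS : y \notin S by apply: nS; rewrite /recol eqxx.
      have zS : z \notin S by apply: nS; apply/eqP.
      rewrite mulrA rsum_cset_conj -mulrA.
      have -> : [set tperm y z q | q in S] = S.
        rewrite -[RHS]imset_id; apply: eq_in_imset => q qS.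
        by rewrite tpermD //; apply/eqP=> E; rewrite E qS in yS zS.
      rewrite xS ?mulr0 // => q qS; have := Sf q qS; rewrite ffunE /recol.
      by case: eqP => // E; move: yS; rewrite -E qS.
  move/nmax; rewrite leqNgt; case/negP; rewrite /wt (bigD1 y) // [X in (_ < X)%N](bigD1 y) //=.
  rewrite ffunE /recol eqxx -addSn leq_add //.
    by apply: ltn_sub2l => //; rewrite -ltnS.
  by apply: leq_sum => z zy; rewrite ffunE (negPf zy).
(* Row [k] already supplies l + 1 points of colour [k], the most that [card_class_le] allows. *)
have full (s : {perm T}) (k : 'I_m.+1) z : (k < m)%N -> (forall q, t q = k -> f (s q) = k) ->
    f (s z) = k -> t z = k.
  move=> km Hk fz; apply/eqP/negPn/negP=> zk.
  have : (#|[set s q | q in z |: [set q | t q == k]]| <= l.+1)%N.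
    apply: (@card_class_le _ (ux * rsum d t) x) => [|//|q1 q2 /imsetP[z1 zz1 ->] /imsetP[z2 zz2 ->]].
      by rewrite xE mulrA.
    have fk q : q \in z |: [set q | t q == k] -> f (s q) = k.
      by rewrite !inE => /orP[/eqP->|/eqP/Hk].
    by apply: xi; rewrite !fk.
  rewrite card_imset; last exact: perm_inj.
  by rewrite cardsU1 inE zk [#|[set _ | _]|]tsize ltnn.
(* [rsum d t] absorbs the symmetriser of its last row. Moved across [s], this becomes the
   symmetriser of l + 1 points of the last colour. *)
have last_step (s : {perm T}) : (fun z => (t z < m)%N && (f (s z) != t z)) =1 xpred0 ->
    rsum d t * d s * x = 0.
  move=> Hs; have Hm q (k : 'I_m.+1) : (k < m)%N -> t q = k -> f (s q) = k.
    by move=> km tq; have := Hs q; rewrite tq km => /negbFE/eqP.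
  pose S := [set z | t z == ord_max].
  have Sm y : y \in [set s z | z in S] -> f y = ord_max.
    case/imsetP=> z; rewrite inE => /eqP tz ->; have := ltn_ord (f (s z)).
    rewrite ltnS leq_eqVlt => /orP[/eqP fm|fm]; first exact: val_inj.
    have := full s (f (s z)) z fm (fun q => Hm q _ fm) erefl; rewrite tz => <-.
    by [].
  have N0 := card_stab_neq0 charK (cset S).
  apply: (scalerI N0); rewrite scaler0 2!scalerAl.
  have -> : #|stab (cset S)|%:R *: rsum d t = rsum d t * rsum d (cset S).
    rewrite [X in _ * X]/rsum mulr_sumr (eq_bigr (fun=> rsum d t)) ?sumr_const ?scaler_nat // => p /stabP pst.
    apply: rsum_mulr; first exact: dl_rep.
    apply/stabP=> z; have := pst z; rewrite /cset.
    have [zS|_] := boolP (z \in S); have [pS|_] := boolP (p z \in S) => //; last by case=> ->.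
    by move: zS pS => + + _; rewrite !inE => /eqP-> /eqP->.
  rewrite -(mulrA (rsum d t)) rsum_cset_conj -!mulrA xS ?mulr0 //.
  by rewrite (card_imset _ (@perm_inj _ s)); exact: tsize.
have key N (s : {perm T}) : (#|T| - agr t f s <= N)%N -> rsum d t * d s * x = 0.
  elim: N s => [|N IHn] s sn; case: (pickP (fun z => (t z < m)%N && (f (s z) != t z))).
  - move=> z0 /andP[_ z0P]; suff : (agr t f s < #|T|)%N by rewrite -subn_gt0 ltnNge sn.
    rewrite -cardsT; apply: proper_card; apply/properP; split; first exact: subsetT.
    by exists z0; rewrite !inE.
  - exact: last_step.
  (* For a misplaced point in a row of least index, all smaller colours are full. So [f (s z)]
     exceeds [t z], and moving [s z] into the colour [t z] gives 0. *)
  - move=> z0 z0P; case: (@arg_minnP _ z0 (fun z => (t z < m)%N && (f (s z) != t z)) (fun z => t z : nat) z0P) => z /andP[zm zP] zmin.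
    have tfz : (t z < f (s z))%N.
      rewrite ltn_neqAle eq_sym (inj_eq val_inj) zP leqNgt /=; apply/negP=> lt.
      have E : t z = f (s z).
        apply: (full s) => // [|q qk]; first exact: ltn_trans zm.
        apply/eqP; rewrite -qk; apply/negPn/negP=> qP; have := zmin q.
        by rewrite qP andbT qk (ltn_trans lt zm) leqNgt lt => /(_ isT).
      by rewrite E ltnn in lt.
    have := elim_step (a := rsum d t) (v := x) (dl_rep K T) zP
      (fun y tzy => rsum_mulr (dl_rep K T) (stab_tperm tzy)) (xh _ _ tfz).
    rewrite big1 ?oppr0 => [/eqP|y /andP[/eqP fy ty]].
      by rewrite scaler_eq0 (negPf (natr_neq0 charK _)) //= => /eqP.
    apply: IHn; rewrite leq_subLR; move: sn; rewrite leq_subLR => /leq_trans-> //.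
    by rewrite addnS -addSn leq_add2r agr_lt.
  - exact: last_step.
(* Since x = x y x and [x] has [rsum d t] as a factor, [x] is a combination of elements u * (rsum d
   t * d s * x), all of which vanish. *)
have [y yP] := galg_regular charK x.
case/eqP: x0; rewrite -yP {1}xE -!mulrA.
have -> : rsum d t * (csum d cc * (y * x)) = rsum d t * (csum d cc * y) * x by rewrite !mulrA.
by rewrite galg_sandwich big1 ?mulr0 // => s _; rewrite (key _ s (leqnn _)) scaler0.
Qed.
End Vanish.

(** * Oriented Brauer diagrams *)

(** Whether a node starts its arc is forced by the signs: at the bottom - means start, at the top +
    does. The orientation therefore carries no further information than the pairing. *)
Definition isst (s t : seq bool) (x : node (size s) (size t)) : bool :=
  match x with inl i => ~~ nth true s i | inr j => nth true t j end.

(* Oriented diagrams from s to t are encoded by the involution exchanging the ends of each arc. *)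
Definition mate s t (m : node (size s) (size t) -> node (size s) (size t)) :=
  involutive m /\ forall x, isst (m x) = ~~ isst x.
Definition arcs_of s t (m : node (size s) (size t) -> node (size s) (size t)) :
  arcs (size s) (size t) := [set e | isst e.1 && (e.2 == m e.1)].

Section Mates.
Variables (s t : seq bool).
Implicit Type m : node (size s) (size t) -> node (size s) (size t).


Lemma mate_neq m x : mate m -> m x != x.
Proof. by move=> [_ st]; apply/eqP=> E; have := st x; rewrite E; case: isst. Qed.

Lemma mate_incident m x : mate m ->
  [set a in arcs_of m | (a.1 == x) || (a.2 == x)] = [set if isst x then (x, m x) else (m x, x)].
Proof.
move=> mm; have [mK st] := mm; apply/setP=> -[a1 a2]; rewrite !inE /=.
apply/idP/eqP=> [/andP[/andP[s1 /eqP->] /orP[/eqP<-|/eqP<-]]|].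
- by rewrite s1.
- by rewrite st s1 /= mK.
- by case: ifP => sx [-> ->]; rewrite ?sx ?st ?sx ?mK ?eqxx ?orbT.
Qed.

Lemma mate_obdiag m : mate m -> is_obdiag (arcs_of m).
Proof.
move=> mm; apply/andP; split; apply/forallP => x; last by rewrite mate_incident ?cards1.
by apply/implyP; rewrite inE => /andP[_ /eqP ->]; rewrite eq_sym mate_neq.
Qed.
Lemma mate_end m x : mate m -> is_end (arcs_of m) x = ~~ isst x.
Proof.
move=> [mK st]; apply/exists_inP/idP => [[a]|sx].
  by rewrite inE => /andP[s1 /eqP E] /eqP <-; rewrite E st negbK.
by exists (m x, x); rewrite ?inE /= ?st ?mK ?sx ?eqxx.
Qed.
Lemma mate_start m x : mate m -> is_start (arcs_of m) x = isst x.
Proof.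
move=> [mK st]; apply/exists_inP/idP => [[a]|sx].
  by rewrite inE => /andP[s1 _] /eqP <-.
by exists (x, m x); rewrite ?inE /= ?st ?mK ?sx ?eqxx.
Qed.
Lemma seq_enum (r : seq bool) : [seq nth true r (val i) | i <- enum 'I_(size r)] = r.
Proof. by rewrite (map_comp (nth true r) val) val_enum_ord map_nth_iota0 // take_size. Qed.

Lemma mate_obhom m : mate m -> exists D : obhom s t, oarcs D = arcs_of m.
Proof.
move=> mm; pose D : obdiag (size s) (size t) := exist (fun E => is_obdiag E) _ (mate_obdiag mm).
have DP : (source D == s) && (target D == t).
  apply/andP; split; apply/eqP.
    by rewrite -[RHS]seq_enum; apply: eq_map => i; rewrite mate_end // negbK.
  by rewrite -[RHS]seq_enum; apply: eq_map => i; rewrite mate_start.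
by exists (exist (fun D => (source D == s) && (target D == t)) D DP).
Qed.

Lemma map_enum_nth (r : seq bool) (f : 'I_(size r) -> bool) :
  [seq f i | i <- enum 'I_(size r)] = r -> forall i, f i = nth true r i.
Proof.
move=> E i; rewrite -[X in nth _ X]E (nth_map i) ?size_enum_ord //.
by rewrite nth_ord_enum.
Qed.

(** The partner of a node is read off the unique arc through it. The conditions on source and target
    say that the two ends of an arc have opposite values of [isst]. *)
Lemma obhom_mate (D : obhom s t) : exists2 m, mate m & oarcs D = arcs_of m.
Proof.
case: D => -[E EP] DP; have /andP[/eqP/map_enum_nth Ds /eqP/map_enum_nth Dt] := DP.
rewrite /oarcs /= in Ds Dt *.
have /andP[/forall_inP Eneq /forallP Einc] := EP.
have uniq_inc a b x : a \in E -> b \in E -> (a.1 == x) || (a.2 == x) ->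
    (b.1 == x) || (b.2 == x) -> a = b.
  move=> aE bE ax bx; have /cards1P[c cE] := Einc x.
  have : a \in [set c] by rewrite -cE inE aE.
  have : b \in [set c] by rewrite -cE inE bE.
  by rewrite !inE => /eqP-> /eqP->.
have ex_inc x : exists2 a, a \in E & (a.1 == x) || (a.2 == x).
  have /cards1P[c cE] := Einc x; have : c \in [set c] by rewrite inE.
  by rewrite -cE inE => /andP[]; exists c.
pose m x := if [pick a in E | (a.1 == x) || (a.2 == x)] is Some a
  then (if a.1 == x then a.2 else a.1) else x.
have mE x a : a \in E -> (a.1 == x) || (a.2 == x) -> m x = if a.1 == x then a.2 else a.1.
  move=> aE ax; rewrite /m; case: pickP => [b /andP[bE bx]|/(_ a)]; last by rewrite aE ax.
  by rewrite (uniq_inc b a x).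
have m1 a : a \in E -> m a.1 = a.2 by move=> aE; rewrite (mE _ a) ?eqxx.
have m2 a : a \in E -> m a.2 = a.1.
  by move=> aE; rewrite (mE _ a) ?eqxx ?orbT //; case: eqP => // ->.
have st1 a : a \in E -> isst a.1 = true.
  move=> aE; case a1E: a.1 => [i|j] /=; last by rewrite -Dt; apply/exists_inP; exists a; rewrite ?a1E.
  rewrite -Ds; apply/exists_inP=> -[b bE /eqP b2].
  have ab : a = b by apply: (uniq_inc a b (inl i)); rewrite ?a1E ?b2 ?eqxx ?orbT.
  by have := Eneq a aE; rewrite {2}ab b2 a1E eqxx.
have st2 a : a \in E -> isst a.2 = false.
  move=> aE; case a2E: a.2 => [i|j] /=.
    by rewrite -Ds; apply/negbF/exists_inP; exists a; rewrite ?a2E.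
  rewrite -Dt; apply/exists_inP=> -[b bE /eqP b1].
  have ab : a = b by apply: (uniq_inc a b (inr j)); rewrite ?a2E ?b1 ?eqxx ?orbT.
  by have := Eneq a aE; rewrite {1}ab b1 a2E eqxx.
exists m.
  split=> x; have [a aE /orP[/eqP <-|/eqP <-]] := ex_inc x.
  - by rewrite m1 ?m2.
  - by rewrite m2 ?m1.
  - by rewrite m1 // st1 // st2.
  - by rewrite m2 // st1 // st2.
apply/setP=> -[x y]; rewrite inE /=; apply/idP/andP=> [xyE|[sx /eqP ->]].
  by split; [exact: (st1 _ xyE)|rewrite (m1 _ xyE)].
have [a aE /orP[/eqP ax|/eqP ax]] := ex_inc x.
  by rewrite -ax m1 // -surjective_pairing.
by move: sx; rewrite -ax st2.
Qed.

Lemma oarcs_inj (D D' : obhom s t) : oarcs D = oarcs D' -> D = D'.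
Proof. by move=> E; apply/val_inj/val_inj. Qed.

Variable K : fieldType.
Lemma diagvE (D D' : obhom s t) : diagv K (oarcs D) D' = (D' == D)%:R.
Proof. by rewrite ffunE; congr (nat_of_bool _)%:R; apply/eqP/eqP=> [/oarcs_inj|->]. Qed.
Lemma OB_expand (f : OB K s t) : f = \sum_D f D *: diagv K (oarcs D).
Proof.
apply/ffunP=> D; rewrite sum_ffunE (bigD1 D) //= ffunE diagvE eqxx /GRing.scale /= mulr1 big1 ?addr0 //.
by move=> D' DD; rewrite ffunE diagvE eq_sym (negPf DD) scaler0.
Qed.
Lemma OB_mate (P : OB K s t -> Prop) : P 0 -> (forall c f g, P f -> P g -> P (c *: f + g)) ->
  (forall m, mate m -> P (diagv K (arcs_of m))) -> forall f, P f.
Proof.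
move=> P0 PD Pm f; rewrite [f]OB_expand; elim/big_rec: _ => [|D g _ Pg] //.
by apply: PD => //; have [m mm ->] := obhom_mate D; apply: Pm.
Qed.
End Mates.

Lemma OBZD (K : fieldType) s t (c : K) (f g : OB K s t) D : (c *: f + g) D = c * f D + g D.
Proof. by rewrite !ffunE. Qed.

Section Bilinear.
Variables (K : fieldType) (delta : K) (s t u : seq bool).
Lemma ob_comp_linearl (g : OB K s t) : linear (fun f : OB K t u => ob_comp delta f g).
Proof.
move=> c f f'; rewrite /ob_comp scaler_sumr -big_split; apply: eq_bigr => D1 _.
rewrite scaler_sumr -big_split; apply: eq_bigr => D2 _.
by rewrite scalerA /= -scalerDl OBZD !mulrDl !mulrA.
Qed.
Lemma ob_comp_linearr (f : OB K t u) : linear (ob_comp delta f : OB K s t -> _).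
Proof.
move=> c g g'; rewrite /ob_comp scaler_sumr -big_split; apply: eq_bigr => D1 _.
rewrite scaler_sumr -big_split; apply: eq_bigr => D2 _.
by rewrite scalerA /= -scalerDl OBZD mulrDr mulrDl mulrCA -(mulrA c).
Qed.
Lemma ob_comp_diag (D1 : obhom t u) (D2 : obhom s t) :
  ob_comp delta (diagv K (oarcs D1)) (diagv K (oarcs D2)) =
  delta ^+ nloops (oarcs D1) (oarcs D2) *: diagv K (comp_arcs (oarcs D1) (oarcs D2)).
Proof.
rewrite /ob_comp (bigD1 D1) //= (bigD1 D2) //= !diagvE !eqxx !mul1r big1 ?addr0 => [|D /negPf DD].
  rewrite big1 ?addr0 // => D /negPf DD; apply: big1 => D' _; by rewrite diagvE DD !mul0r scale0r.
by rewrite !diagvE DD mulr0 mul0r scale0r.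
Qed.
End Bilinear.

Section Tens.
Variables (K : fieldType) (s t s' t' : seq bool).
Lemma ob_tens_linearl (g : OB K s' t') : linear (fun f : OB K s t => ob_tens f g).
Proof.
move=> c f f'; rewrite /ob_tens scaler_sumr -big_split; apply: eq_bigr => D1 _.
rewrite scaler_sumr -big_split; apply: eq_bigr => D2 _.
by rewrite scalerA /= -scalerDl OBZD !mulrDl !mulrA.
Qed.
Lemma ob_tens_linearr (f : OB K s t) : linear (ob_tens f : OB K s' t' -> _).
Proof.
move=> c g g'; rewrite /ob_tens scaler_sumr -big_split; apply: eq_bigr => D1 _.
rewrite scaler_sumr -big_split; apply: eq_bigr => D2 _.
by rewrite scalerA /= -scalerDl OBZD mulrDr mulrCA.
Qed.
Lemma ob_tens_diag (D1 : obhom s t) (D2 : obhom s' t') :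
  ob_tens (diagv K (oarcs D1)) (diagv K (oarcs D2)) = diagv K (tens_arcs (oarcs D1) (oarcs D2)).
Proof.
rewrite /ob_tens (bigD1 D1) //= (bigD1 D2) //= !diagvE !eqxx !mul1r scale1r big1 ?addr0 => [|D /negPf DD].
  rewrite big1 ?addr0 // => D /negPf DD; apply: big1 => D' _; by rewrite diagvE DD !mul0r scale0r.
by rewrite !diagvE DD mulr0 scale0r.
Qed.

Lemma node_catP (z : node (size (s ++ s')) (size (t ++ t'))) :
  (exists x, z = lnode s' t' x) \/ (exists x, z = rnode s t x).
Proof.
have H (r r' : seq bool) (i : 'I_(size (r ++ r'))) :
    (exists j, i = lpos r' j) \/ (exists j, i = rpos r j).
  pose i' := cast_ord (size_cat r r') i; have iE : i = cast_ord (esym (size_cat r r')) i'.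
    by apply: val_inj.
  rewrite iE; case: (split_ordP i') => j ->; [left|right]; by exists j.
case: z => i; case: (H _ _ i) => -[j ->].
- by left; exists (inl j).
- by right; exists (inl j).
- by left; exists (inr j).
- by right; exists (inr j).
Qed.
Lemma lnode_inj : injective (@lnode s t s' t').
Proof.
by move=> [i|i] [j|j] //= [] ij; congr (_ _); apply: val_inj.
Qed.
Lemma rnode_inj : injective (@rnode s t s' t').
Proof.
by move=> [i|i] [j|j] //= [] /addnI ij; congr (_ _); apply: val_inj.
Qed.
Lemma lrnode x y : lnode s' t' x != rnode s t y.
Proof.
apply/eqP; case: x => i; case: y => j //= [] E; have := ltn_ord i.
  by rewrite E ltnNge leq_addr.
by rewrite E ltnNge leq_addr.
Qed.
Lemma isst_lnode (x : node (size s) (size t)) : isst (lnode s' t' x) = isst x.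
Proof. by case: x => i /=; rewrite nth_cat ltn_ord. Qed.
Lemma isst_rnode (x : node (size s') (size t')) : isst (rnode s t x) = isst x.
Proof. by case: x => i /=; rewrite nth_cat ltnNge leq_addr /= addKn. Qed.

(** The involution is given only through its values on the left and on the right nodes, which is all
    that path computations use. *)
Lemma tens_mate m m' : mate m -> mate m' -> exists M, [/\ mate M,
  ob_tens (diagv K (arcs_of m)) (diagv K (arcs_of m')) = diagv K (arcs_of M),
  forall x, M (lnode s' t' x) = lnode s' t' (m x) & forall x, M (rnode s t x) = rnode s t (m' x)].
Proof.
move=> mm mm'; have [D1 D1E] := mate_obhom mm; have [D2 D2E] := mate_obhom mm'.
pose M z := if [pick x | lnode s' t' x == z] is Some x then lnode s' t' (m x) else
  if [pick x | rnode s t x == z] is Some x then rnode s t (m' x) else z.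
have Ml x : M (lnode s' t' x) = lnode s' t' (m x).
  by rewrite /M; case: pickP => [y /eqP/lnode_inj-> //|/(_ x)]; rewrite eqxx.
have Mr x : M (rnode s t x) = rnode s t (m' x).
  rewrite /M; case: pickP => [y|_]; first by rewrite (negPf (lrnode _ _)).
  by case: pickP => [y /eqP/rnode_inj-> //|/(_ x)]; rewrite eqxx.
exists M; split=> //.
  split=> z; case: (node_catP z) => -[x ->]; rewrite ?Ml ?Mr ?Ml ?Mr.
  - by rewrite mm.1.
  - by rewrite mm'.1.
  - by rewrite !isst_lnode mm.2.
  - by rewrite !isst_rnode mm'.2.
rewrite -D1E -D2E ob_tens_diag D1E D2E; congr (diagv K _).
apply/setP=> -[a1 a2]; rewrite !inE /=; apply/orP/andP.
  case=> /imsetP[[x1 x2]]; rewrite inE /= => /andP[sx /eqP->] [-> ->].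
    by rewrite isst_lnode Ml sx eqxx.
  by rewrite isst_rnode Mr sx eqxx.
case: (node_catP a1) => -[x ->]; rewrite ?isst_lnode ?isst_rnode ?Ml ?Mr => -[sx /eqP->].
  by left; apply/imsetP; exists (x, m x); rewrite // inE /= sx eqxx.
by right; apply/imsetP; exists (x, m' x); rewrite // inE /= sx eqxx.
Qed.
End Tens.

(** When every point has at most one successor, the path from [x] to a point without successor
    passes through everything reachable from [x]. *)
Lemma connect_terminal (X : finType) (e : rel X) x y z :
  (forall a b c, e a b -> e a c -> b = c) -> connect e x y -> connect e x z ->
  (forall a, ~~ e z a) -> connect e y z.
Proof.
move=> fn /connectP[p]; elim: p x => [|x1 p IHp] x /=; first by move=> _ ->.
move=> /andP[xx1 x1p] yE xz zt; apply: (IHp x1) => //.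
case/connectP: xz => -[|x2 q] /= => [_ zx|/andP[xx2 x2q] zE].
  by move: (zt x1); rewrite zx xx1.
by rewrite (fn _ _ _ xx1 xx2); apply/connectP; exists q.
Qed.

Section Relabel.
Variables (s0 t0 s t : seq bool).
Variables (th : node (size s0) (size t0) -> node (size s) (size t)) (th' : node (size s) (size t) -> node (size s0) (size t0)).
Definition relabel (m : node (size s0) (size t0) -> node (size s0) (size t0)) x := th (m (th' x)).
Hypotheses (thK : cancel th th') (th'K : cancel th' th) (th_st : forall x, isst (th x) = isst x).
Lemma relabel_mate m : mate m -> mate (relabel m).
Proof.
move=> [mK st]; split=> x; first by rewrite /relabel thK mK th'K.
by rewrite /relabel th_st st -th_st th'K.
Qed.
End Relabel.

Section Comp.
Variables (K : fieldType) (delta : K) (s t u : seq bool).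
Variables (m1 : node (size t) (size u) -> node (size t) (size u))
          (m2 : node (size s) (size t) -> node (size s) (size t)).
Hypotheses (mm1 : mate m1) (mm2 : mate m2).
Notation lower := (@lower_node (size s) (size t) (size u)).
Notation upper := (@upper_node (size s) (size t) (size u)).
Notation outer := (@outer_node (size s) (size t) (size u)).
Definition stk := stack (arcs_of m1) (arcs_of m2).
Notation con := (connect stk).

Lemma stkP x y : reflect ((exists a, [/\ isst a, x = lower a & y = lower (m2 a)]) \/
   (exists a, [/\ isst a, x = upper a & y = upper (m1 a)])) (stk x y).
Proof.
apply: (iffP orP) => -[].
- by case/imsetP=> -[a b]; rewrite inE /= => /andP[sa /eqP->] [-> ->]; left; exists a.
- by case/imsetP=> -[a b]; rewrite inE /= => /andP[sa /eqP->] [-> ->]; right; exists a.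
- by case=> a [sa -> ->]; left; apply/imsetP; exists (a, m2 a); rewrite // inE /= sa eqxx.
- by case=> a [sa -> ->]; right; apply/imsetP; exists (a, m1 a); rewrite // inE /= sa eqxx.
Qed.

Lemma con_lower a : isst a -> con (lower a) (lower (m2 a)).
Proof. by move=> sa; apply/connect1/stkP; left; exists a. Qed.
Lemma con_upper a : isst a -> con (upper a) (upper (m1 a)).
Proof. by move=> sa; apply/connect1/stkP; right; exists a. Qed.

(** At a node of the middle line the two diagrams assign opposite roles, so arcs join there into
    consistently directed paths. *)
Lemma lower_upper_isst a b : lower a = upper b -> isst a = ~~ isst b.
Proof. by case: a b => [i|j] [k|l] //= [->]; rewrite negbK. Qed.
Lemma upper_inj : injective upper.
Proof. by move=> [i|i] [j|j] //= [->]. Qed.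
Lemma lower_inj : injective lower. Proof. by move=> a b []. Qed.
Lemma lower_outer a y : lower a = outer y -> isst a = isst y.
Proof. by case: a y => [i|j] [k|l] //= [->]. Qed.
Lemma upper_outer a y : upper a = outer y -> isst a = isst y.
Proof. by case: a y => [i|j] [k|l] //= [->]. Qed.
Lemma outer_inj : injective outer.
Proof. by move=> [i|i] [j|j] //= [->]. Qed.

Lemma stk_fun a b c : stk a b -> stk a c -> b = c.
Proof.
move=> /stkP[] [x [sx -> ->]] /stkP[] [y [sy E ->]].
- by rewrite (lower_inj E).
- by have := lower_upper_isst E; rewrite sx sy.
- by have := lower_upper_isst (esym E); rewrite sx sy.
- by rewrite (upper_inj E).
Qed.
Lemma outer_end_terminal y : ~~ isst y -> forall a, ~~ stk (outer y) a.
Proof.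
move=> sy a; apply/negP=> /stkP[] [x [sx E _]]; move: sy.
  by rewrite -(lower_outer (esym E)) sx.
by rewrite -(upper_outer (esym E)) sx.
Qed.
Lemma outer_start_source y : isst y -> forall a, ~~ stk a (outer y).
Proof.
move=> sy a; apply/negP=> /stkP[] [x [sx _ E]]; move: sy.
  by rewrite -(lower_outer (esym E)) mm2.2 sx.
by rewrite -(upper_outer (esym E)) mm1.2 sx.
Qed.
Lemma con_last x y : con x y -> x = y \/ exists z, stk z y.
Proof.
move=> /connectP[p]; elim/last_ind: p => [_ ->|p z _]; first by left.
rewrite rcons_path last_rcons => /andP[_ zl] ->; by right; exists (last x p).
Qed.

Variable m : node (size s) (size u) -> node (size s) (size u).
Hypothesis mm : mate m.
(** The second hypothesis excludes closed loops, so no power of [delta] appears. The first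
    determines the arcs: a directed path between two distinct outer nodes begins at a start and can
    go no further than an outer end. *)
Lemma comp_mate : (forall x, isst x -> con (outer x) (outer (m x))) ->
  (forall z, exists y, con z (outer y)) ->
  ob_comp delta (diagv K (arcs_of m1)) (diagv K (arcs_of m2)) = diagv K (arcs_of m).
Proof.
move=> conm noloop.
have [D1 D1E] := mate_obhom mm1; have [D2 D2E] := mate_obhom mm2.
rewrite -D1E -D2E ob_comp_diag D1E D2E.
have -> : nloops (arcs_of m1) (arcs_of m2) = 0.
  apply/eqP; rewrite cards_eq0 -subset0; apply/subsetP=> X /imsetP[z /forallP zl _].
  by have [y yP] := noloop z; move: (zl y); rewrite -[stack _ _]/stk yP.
rewrite expr0 scale1r; congr (diagv K _); apply/setP=> -[x y]; rewrite !inE /=.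
rewrite -[stack _ _]/stk; apply/andP/andP=> [[xy cxy]|[sx /eqP->]]; last first.
  by split; [rewrite eq_sym mate_neq|apply: conm].
have sy : ~~ isst y.
  apply/negP=> sy; case: (con_last cxy) => [/outer_inj E|[z]]; first by rewrite E eqxx in xy.
  by apply/negP/outer_start_source.
have sx : isst x.
  apply: contraT => sx; move: cxy => /connectP[[|z p]] /= => [_ /outer_inj E|/andP[]].
    by rewrite E eqxx in xy.
  by rewrite (negPf (outer_end_terminal sx z)).
split=> //; have smx : ~~ isst (m x) by rewrite mm.2 sx.
have := connect_terminal stk_fun cxy (conm x sx) (outer_end_terminal smx).
move=> /connectP[[|z p]] /= => [_ /outer_inj->//|/andP[]].
by rewrite (negPf (outer_end_terminal sy z)).
Qed.
End Comp.

(* If the arcs of m0, after the embedding [emb] of its nodes in the stacked picture, are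
   prolonged by paths to the outer nodes th a, then the composite is m0 relabelled by th. *)
Section CompRelabel.
Variables (K : fieldType) (delta : K) (s0 t0 s t u : seq bool).
Variables (m1 : node (size t) (size u) -> node (size t) (size u))
          (m2 : node (size s) (size t) -> node (size s) (size t))
          (m0 : node (size s0) (size t0) -> node (size s0) (size t0)).
Hypotheses (mm1 : mate m1) (mm2 : mate m2) (mm0 : mate m0).
Notation outer := (@outer_node (size s) (size t) (size u)).
Notation con := (connect (stk m1 m2)).
Variables (th : node (size s0) (size t0) -> node (size s) (size u))
  (th' : node (size s) (size u) -> node (size s0) (size t0)).
Hypotheses (thK : cancel th th') (th'K : cancel th' th) (th_st : forall x, isst (th x) = isst x).
Variable emb : node (size s0) (size t0) -> node3 (size s) (size t) (size u).

Lemma comp_relabel :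
  (forall a, isst a -> con (emb a) (emb (m0 a))) ->
  (forall a, if isst a then con (outer (th a)) (emb a) else con (emb a) (outer (th a))) ->
  (forall z, (exists a, con z (emb a)) \/ exists y, con z (outer y)) ->
  ob_comp delta (diagv K (arcs_of m1)) (diagv K (arcs_of m2)) = diagv K (arcs_of (relabel th th' m0)).
Proof.
move=> em0 eth out.
have end_out a : ~~ isst a -> con (emb a) (outer (th a)).
  by move=> /negPf sa; have := eth a; rewrite sa.
apply: comp_mate => //; first exact: relabel_mate.
  move=> x; rewrite -{1}(th'K x) th_st => sx; rewrite -{1}(th'K x).
  apply: connect_trans (_ : con _ (emb (th' x))) _; first by have := eth (th' x); rewrite sx.
  apply: connect_trans (em0 _ sx) _; apply: end_out; by rewrite mm0.2 sx.
move=> z; case: (out z) => // -[a za].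
have [sa|sa] := boolP (isst a); last by exists (th a); apply: connect_trans za (end_out _ _).
exists (th (m0 a)); apply: connect_trans za _; apply: connect_trans (em0 _ sa) _.
by apply: end_out; rewrite mm0.2 sa.
Qed.
End CompRelabel.

Lemma eq_arcs_of s t (m m' : node (size s) (size t) -> node (size s) (size t)) : m =1 m' -> arcs_of m = arcs_of m'.
Proof. by move=> E; apply/setP=> e; rewrite !inE E. Qed.

Section Vert.
Variables (t u : seq bool) (p : 'I_(size t) -> 'I_(size u)) (q : 'I_(size u) -> 'I_(size t)).
Definition vert (x : node (size t) (size u)) : node (size t) (size u) :=
  match x with inl i => inr (p i) | inr j => inl (q j) end.
Hypotheses (pK : cancel p q) (qK : cancel q p) (pst : forall i, nth true u (p i) = nth true t i).
Lemma vert_mate : mate vert.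
Proof.
split=> [] [i|j] /=; rewrite ?pK ?qK ?pst ?negbK //.
by rewrite -{2}(qK j) pst.
Qed.

Section Post.
Variables (K : fieldType) (delta : K) (s : seq bool) (m : node (size s) (size t) -> node (size s) (size t)).
Hypothesis mm : mate m.
Definition toplab (x : node (size s) (size t)) : node (size s) (size u) :=
  match x with inl i => inl i | inr j => inr (p j) end.
Definition toplab' (x : node (size s) (size u)) : node (size s) (size t) :=
  match x with inl i => inl i | inr j => inr (q j) end.
Lemma post_vert : ob_comp delta (diagv K (arcs_of vert)) (diagv K (arcs_of m))
  = diagv K (arcs_of (relabel toplab toplab' m)).
Proof.
have vm := vert_mate.
apply: (@comp_relabel K delta s t s t u vert m m vm mm mm toplab toplab' _ _ _ (@lower_node _ _ _)).
- by case=> i //=; rewrite pK.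
- by case=> i //=; rewrite qK.
- by case=> i //=; rewrite pst.
- by move=> a sa; apply: con_lower.
- case=> [i|j] /=; first by case: ifP => _; apply: connect0.
  case: ifP => tj.
    by have /= := @con_upper _ _ _ vert m (inr (p j)); rewrite pK pst; apply.
  by have /= := @con_upper _ _ _ vert m (inl j); rewrite tj; apply.
- move=> [[i|j]|k].
  - by left; exists (inl i); apply: connect0.
  - by left; exists (inr j); apply: connect0.
  - by right; exists (inr k); apply: connect0.
Qed.
End Post.
End Vert.

Lemma ob_idE K s : ob_id K s = diagv K (arcs_of (vert (t := s) (u := s) id id)).
Proof.
congr (diagv K _); apply/setP=> -[a b]; rewrite inE /=; apply/imsetP/andP => [[i _]|].
  by case: ifP => si [-> ->] /=; rewrite ?si.
case: a => i [/= si /eqP -> /=]; exists i => //=; first by rewrite (negPf si).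
by rewrite si.
Qed.
Lemma id_mate s : mate (vert (t := s) (u := s) id id).
Proof. exact: vert_mate. Qed.

(** Stated for any sequence, so that it applies to a concatenation such as [plus a ++ plus b]
    without a cast. *)
Definition ob_permS (K : fieldType) (s : seq bool) (p : 'S_(size s)) : OB K s s :=
  diagv K [set (inr (p i), inl i) | i : 'I_(size s)].

Section PermS.
Variables (K : fieldType) (s : seq bool) (strue : forall i, nth true s i = true).
Implicit Types p q : 'S_(size s).
Definition vperm p := vert (t := s) (u := s) p (p^-1)%g.
Lemma vperm_mate p : mate (vperm p).
Proof. by apply: vert_mate => [i|i|i]; rewrite ?permK ?permKV ?strue. Qed.
Lemma ob_permSE p : ob_permS K p = diagv K (arcs_of (vperm p)).
Proof.
congr (diagv K _); apply/setP=> -[a b]; rewrite inE /=; apply/imsetP/andP => [[i _ [-> ->]]|].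
  by rewrite /= strue permK.
case: a => i /=; first by rewrite strue => -[].
by case=> _ /eqP->; exists (p^-1%g i); rewrite // permKV.
Qed.
Lemma ob_permS_comp delta p q : ob_comp delta (ob_permS K p) (ob_permS K q) = ob_permS K (q * p)%g.
Proof.
rewrite !ob_permSE post_vert; last exact: vperm_mate; try by move=> i; rewrite ?permK ?permKV ?strue.
congr (diagv K _); apply: eq_arcs_of => -[i|j] /=; first by rewrite permM.
by rewrite /relabel /= invMg permM.
Qed.
Lemma ob_permS1 : ob_permS K 1 = ob_id K s.
Proof.
rewrite ob_permSE ob_idE; congr (diagv K _); apply: eq_arcs_of => -[i|j] /=; first by rewrite perm1.
by rewrite invg1 perm1.
Qed.
(** With all signs + the bottom nodes are ends and the top nodes are starts, so no arc joins two
    nodes of one line. *)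
Lemma mate_permS m : mate (m : node (size s) (size s) -> _) -> exists p, arcs_of m = arcs_of (vperm p).
Proof.
move=> [mK st]; have H i : exists j, m (inl i) = inr j.
  by have := st (inl i); rewrite /= strue; case: (m _) => j /=; rewrite ?strue //; exists j.
have /fin_all_exists[f fE] := H.
have fI : injective f by move=> i j E; apply: (inl_inj (B := 'I_(size s))); apply: (can_inj mK); rewrite !fE E.
exists (perm fI); apply: eq_arcs_of => -[i|j] /=; first by rewrite permE.
by apply: (can_inj mK); rewrite mK fE -permE permKV.
Qed.
End PermS.

(** * Bending strands of diagrams *)

Section Dcon.
Variables (X : finType) (e : rel X).
(** The bent strand runs up or down according to its sign; a Boolean direction covers both cases
    with one proof. *)
Definition dcon (b : bool) x y := if b then connect e x y else connect e y x.
Lemma dcon_trans b : transitive (dcon b).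
Proof. by case: b => y x z; rewrite /dcon => xy yz; [exact: connect_trans yz|exact: connect_trans xy]. Qed.
Lemma dcon_or b x y z : dcon b x y -> dcon b y z -> connect e y x \/ connect e y z.
Proof. by case: b => ? ?; [right|left]. Qed.
Lemma dcon0 b x : dcon b x x. Proof. by case: b; apply: connect0. Qed.
End Dcon.

Section Link.
Variables (s t u : seq bool) (m1 : node (size t) (size u) -> node (size t) (size u))
  (m2 : node (size s) (size t) -> node (size s) (size t)) (mm1 : mate m1) (mm2 : mate m2).
Lemma link_lower a b : isst a = b ->
  dcon (stk m1 m2) b (lower_node (size u) a) (lower_node (size u) (m2 a)).
Proof.
move=> <-; rewrite /dcon; case: ifP => sa; first exact: con_lower.
by have := @con_lower _ _ _ m1 m2 (m2 a); rewrite mm2.1 mm2.2 sa; apply.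
Qed.
Lemma link_upper a b : isst a = b ->
  dcon (stk m1 m2) b (upper_node (size s) a) (upper_node (size s) (m1 a)).
Proof.
move=> <-; rewrite /dcon; case: ifP => sa; first exact: con_upper.
by have := @con_upper _ _ _ m1 m2 (m1 a); rewrite mm1.1 mm1.2 sa; apply.
Qed.
End Link.

Section Bend.
Variables (K : fieldType) (delta : K) (e : bool) (s t : seq bool).

Definition cupm (x : node (@size bool [::]) (size [:: ~~ e; e])) : node (@size bool [::]) (size [:: ~~ e; e]) :=
  match x with inl i => inl i | inr j => inr (rev_ord j) end.
Definition capm (x : node (size [:: e; ~~ e]) (@size bool [::])) : node (size [:: e; ~~ e]) (@size bool [::]) :=
  match x with inl i => inl (rev_ord i) | inr j => inr j end.
Lemma cupm_mate : mate (cupm : node (@size bool [::]) (size [:: ~~ e; e]) -> _).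
Proof.
split=> -[i|j] //=; [by rewrite rev_ordK|by case: i|].
by case: j => -[|[|j]] //= _; rewrite negbK.
Qed.
Lemma capm_mate : mate (capm : node (size [:: e; ~~ e]) (@size bool [::]) -> _).
Proof.
split=> -[i|j] //=; [by rewrite rev_ordK| |by case: j].
by case: i => -[|[|i]] lt //; case: (e).
Qed.
Definition cup : OB K [::] [:: ~~ e; e] := diagv K (arcs_of (s := [::]) (t := [:: ~~ e; e]) cupm).
Definition cap : OB K [:: e; ~~ e] [::] := diagv K (arcs_of (s := [:: e; ~~ e]) (t := [::]) capm).

Definition bend (D : OB K (e :: s) t) : OB K s (~~ e :: t) :=
  ob_comp delta (ob_tens (ob_id K [:: ~~ e]) D) (ob_tens cup (ob_id K s)).
Definition unbend (D : OB K s (~~ e :: t)) : OB K (e :: s) t :=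
  ob_comp delta (ob_tens cap (ob_id K t)) (ob_tens (ob_id K [:: e]) D).

Definition bn (x : node (size (e :: s)) (size t)) : node (size s) (size (~~ e :: t)) :=
  match x with
  | inl i => if unlift ord0 i is Some i' then inl i' else inr ord0
  | inr j => inr (lift ord0 j) end.
Definition bn' (x : node (size s) (size (~~ e :: t))) : node (size (e :: s)) (size t) :=
  match x with
  | inl i => inl (lift ord0 i)
  | inr j => if unlift ord0 j is Some j' then inr j' else inl ord0 end.
Lemma bnK : cancel bn bn'.
Proof. by case=> i /=; [case: unliftP => [j|] -> /=; rewrite ?unlift_none|rewrite liftK]. Qed.
Lemma bn'K : cancel bn' bn.
Proof. by case=> i /=; [rewrite liftK|case: unliftP => [j|] -> /=; rewrite ?unlift_none]. Qed.
Lemma bn_st x : isst (bn x) = isst x.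
Proof. by case: x => i //=; case: unliftP => [j|] ->. Qed.
Lemma bn'_st x : isst (bn' x) = isst x.
Proof. by rewrite -bn_st bn'K. Qed.

(** The only new path is that of the bent strand: from the new first top node down the identity
    strand ([l0]), then round the cup to the first bottom node of the given diagram ([l1]). Every
    middle node lies on this path or belongs to the given diagram, so there are no loops. *)
Lemma bend_diag m : mate m -> bend (diagv K (arcs_of m)) = diagv K (arcs_of (relabel bn bn' m)).
Proof.
move=> mm; rewrite /bend /cup !ob_idE.
have [M1 [mM1 -> M1l M1r]] := tens_mate K (id_mate [:: ~~ e]) mm.
have [M2 [mM2 -> M2l M2r]] := tens_mate K cupm_mate (id_mate s).
pose emb (a : node (size (e :: s)) (size t)) : node3 (size s) (size (~~ e :: e :: s)) (size (~~ e :: t)) :=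
  upper_node (size s) (rnode [:: ~~ e] [:: ~~ e] a).
pose dc := dcon (@stk s (~~ e :: e :: s) (~~ e :: t) M1 M2).
have l0 : dc (~~ e) (inr ord0) (inl (inr ord0)).
  have := @link_upper s (~~ e :: e :: s) (~~ e :: t) M1 M2 mM1 (lnode (e :: s) t (inr ord0 : node (size [:: ~~ e]) (size [:: ~~ e]))) _ (isst_lnode (e :: s) t (inr ord0 : node (size [:: ~~ e]) (size [:: ~~ e]))).
  rewrite M1l /= -/dc; congr (dc _ _ _).
  - by congr inr; apply: val_inj.
  - by congr (inl (inr _)); apply: val_inj.
have l1 : dc (~~ e) (inl (inr ord0)) (emb (inl ord0)).
  have := @link_lower s (~~ e :: e :: s) (~~ e :: t) M1 M2 mM2 (lnode s s (inr ord0 : node (@size bool [::]) (size [:: ~~ e; e]))) _ (isst_lnode s s (inr ord0 : node (@size bool [::]) (size [:: ~~ e; e]))).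
  rewrite M2l /= -/dc; congr (dc _ _ _).
  - by rewrite /lower_node; congr (inl (inr _)); apply: val_inj.
  - by rewrite /lower_node; congr (inl (inr _)); apply: val_inj.
apply: (comp_relabel _ mM1 mM2 mm bnK bn'K bn_st (emb := emb)).
- move=> a sa; rewrite /emb -M1r; apply: con_upper; exact: etrans (isst_rnode _ _ a) sa.
- move=> a; rewrite -[if _ then _ else _]/(dc (isst a) _ _); case: a => [i|j].
    rewrite /=; case: unliftP => [i'|] -> /=.
      have := @link_lower s (~~ e :: e :: s) (~~ e :: t) M1 M2 mM2 (rnode [::] [:: ~~ e; e] (inl i' : node (size s) (size s))) _ (isst_rnode [::] [:: ~~ e; e] (inl i' : node (size s) (size s))).
      rewrite M2r /= -/dc; congr (dc _ _ _).
      - by rewrite /lower_node; congr (inl (inl _)); apply: val_inj.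
      - by rewrite /lower_node; congr (inl (inr _)); apply: val_inj.
    exact: dcon_trans l0 l1.
  have -> : emb (inr j) = inr (lift ord0 j) by congr inr; apply: val_inj.
  exact: dcon0.
- move=> [[i|j]|k]; last by right; exists (inr k); apply: connect0.
    by right; exists (inl i); apply: connect0.
  case: (unliftP ord0 j) => [j'|] ->.
    left; exists (inl j'); have -> : emb (inl j') = inl (inr (lift ord0 j')) by congr (inl (inr _)); apply: val_inj.
    exact: connect0.
  by case: (dcon_or l0 l1) => H; [right; exists (inr ord0)|left; exists (inl ord0)].
Qed.

Lemma unbend_diag m : mate m -> unbend (diagv K (arcs_of m)) = diagv K (arcs_of (relabel bn' bn m)).
Proof.
move=> mm; rewrite /unbend /cap !ob_idE.
have [M1 [mM1 -> M1l M1r]] := tens_mate K capm_mate (id_mate t).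
have [M2 [mM2 -> M2l M2r]] := tens_mate K (id_mate [:: e]) mm.
pose emb (a : node (size s) (size (~~ e :: t))) : node3 (size (e :: s)) (size (e :: ~~ e :: t)) (size t) :=
  lower_node (size t) (rnode [:: e] [:: e] a).
pose dc := dcon (@stk (e :: s) (e :: ~~ e :: t) t M1 M2).
have l0 : dc (~~ e) (inl (inl ord0)) (inl (inr ord0)).
  have := @link_lower (e :: s) (e :: ~~ e :: t) t M1 M2 mM2 (lnode s (~~ e :: t) (inl ord0 : node (size [:: e]) (size [:: e]))) _ (isst_lnode s (~~ e :: t) (inl ord0 : node (size [:: e]) (size [:: e]))).
  rewrite M2l /= -/dc; congr (dc _ _ _).
  - by rewrite /lower_node; congr (inl (inl _)); apply: val_inj.
  - by rewrite /lower_node; congr (inl (inr _)); apply: val_inj.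
have l1 : dc (~~ e) (inl (inr ord0)) (emb (inr ord0)).
  have := @link_upper (e :: s) (e :: ~~ e :: t) t M1 M2 mM1 (lnode t t (inl ord0 : node (size [:: e; ~~ e]) (@size bool [::]))) _ (isst_lnode t t (inl ord0 : node (size [:: e; ~~ e]) (@size bool [::]))).
  rewrite M1l /= -/dc; congr (dc _ _ _).
  - by congr (inl (inr _)); apply: val_inj.
  - by rewrite /emb /lower_node; congr (inl (inr _)); apply: val_inj.
apply: (comp_relabel _ mM1 mM2 mm bn'K bnK bn'_st (emb := emb)).
- move=> a sa; rewrite /emb -M2r; apply: con_lower; exact: etrans (isst_rnode _ _ a) sa.
- move=> a; rewrite -[if _ then _ else _]/(dc (isst a) _ _); case: a => [i|j].
    have -> : emb (inl i) = inl (inl (lift ord0 i)) by rewrite /emb /lower_node; congr (inl (inl _)); apply: val_inj.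
    exact: dcon0.
  rewrite /=; case: unliftP => [j'|] -> /=; last exact: dcon_trans l0 l1.
  have := @link_upper (e :: s) (e :: ~~ e :: t) t M1 M2 mM1 (rnode [:: e; ~~ e] [::] (inr j' : node (size t) (size t))) _ (isst_rnode [:: e; ~~ e] [::] (inr j' : node (size t) (size t))).
  rewrite M1r /= -/dc; congr (dc _ _ _).
  - by congr (inr _); apply: val_inj.
  - by rewrite /emb /lower_node; congr (inl (inr _)); apply: val_inj.
- move=> [[i|j]|k]; last by right; exists (inr k); apply: connect0.
    by right; exists (inl i); apply: connect0.
  case: (unliftP ord0 j) => [j'|] ->.
    left; exists (inr j'); have -> : emb (inr j') = inl (inr (lift ord0 j')) by rewrite /emb /lower_node; congr (inl (inr _)); apply: val_inj.
    exact: connect0.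
  by case: (dcon_or l0 l1) => H; [right; exists (inl ord0)|left; exists (inr ord0)].
Qed.
End Bend.

Section BendK.
Variables (K : fieldType) (delta : K) (e : bool) (s t : seq bool).

Lemma bend_linear : linear (@bend K delta e s t).
Proof. by move=> c f g; rewrite /bend ob_tens_linearr ob_comp_linearl. Qed.
Lemma unbend_linear : linear (@unbend K delta e s t).
Proof. by move=> c f g; rewrite /unbend ob_tens_linearr ob_comp_linearr. Qed.

Lemma linear_ext s1 t1 s2 t2 (f g : OB K s1 t1 -> OB K s2 t2) : linear f -> linear g ->
  (forall m, mate m -> f (diagv K (arcs_of m)) = g (diagv K (arcs_of m))) -> f =1 g.
Proof.
move=> fl gl H; apply: OB_mate => [|c x y Hx Hy|//]; first by rewrite (lin0 fl) (lin0 gl).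
by rewrite fl gl Hx Hy.
Qed.

Lemma id_linear s1 t1 : linear (id : OB K s1 t1 -> OB K s1 t1). Proof. by []. Qed.
Lemma comp_lin (U V W : vectType K) (f : V -> W) (g : U -> V) : linear f -> linear g -> linear (f \o g).
Proof. by move=> fl gl c x y; rewrite /= gl fl. Qed.

Lemma bendK : cancel (@bend K delta e s t) (@unbend K delta e s t).
Proof.
apply: (@linear_ext _ _ _ _ (fun D => unbend delta (bend delta D)) id).
- exact: comp_lin unbend_linear bend_linear.
- exact: id_linear.
move=> m mm; rewrite bend_diag // unbend_diag; last exact: relabel_mate (@bnK _ _ _) (@bn'K _ _ _) (@bn_st _ _ _) _ mm.
by congr (diagv K _); apply: eq_arcs_of => x; rewrite /relabel !bnK.
Qed.
Lemma unbendK : cancel (@unbend K delta e s t) (@bend K delta e s t).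
Proof.
apply: (@linear_ext _ _ _ _ (fun D => bend delta (unbend delta D)) id).
- exact: comp_lin bend_linear unbend_linear.
- exact: id_linear.
move=> m mm; rewrite unbend_diag // bend_diag; last exact: relabel_mate (@bn'K _ _ _) (@bnK _ _ _) (@bn'_st _ _ _) _ mm.
by congr (diagv K _); apply: eq_arcs_of => x; rewrite /relabel !bn'K.
Qed.
End BendK.

Section PostVert.
Variables (K : fieldType) (delta : K) (t u : seq bool) (p : 'I_(size t) -> 'I_(size u)) (q : 'I_(size u) -> 'I_(size t)).
Hypotheses (pK : cancel p q) (qK : cancel q p) (pst : forall i, nth true u (p i) = nth true t i).
Lemma post_vertK s : cancel (ob_comp delta (diagv K (arcs_of (vert p q))) : OB K s t -> OB K s u)
  (ob_comp delta (diagv K (arcs_of (vert q p)))).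
Proof.
have qst i : nth true t (q i) = nth true u i by rewrite -{2}(qK i) pst.
apply: (@linear_ext K s t s t (fun D => ob_comp delta _ (ob_comp delta _ D)) id).
- by move=> c f g; rewrite !ob_comp_linearr.
- exact: id_linear.
move=> m mm; rewrite post_vert // post_vert //; last first.
  apply: relabel_mate mm; [by case=> i /=; rewrite ?pK ?qK|by case=> i /=; rewrite ?pK ?qK|].
  by case=> i /=; rewrite ?pst.
by congr (diagv K _); apply: eq_arcs_of => -[i|i]; rewrite /relabel /= ?pK ?qK; case: (m _) => j /=; rewrite ?pK ?qK.
Qed.
End PostVert.

Section TensPerm.
Variables (K : fieldType) (s s' : seq bool).
Hypotheses (strue : forall i, nth true s i = true) (strue' : forall i, nth true s' i = true).
Lemma cat_true i : nth true (s ++ s') i = true.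
Proof. by rewrite nth_cat; case: ifP. Qed.
Lemma tens_perm (p : 'S_(size s)) (p' : 'S_(size s')) (P : 'S_(size (s ++ s'))) :
  (forall i, P (lpos s' i) = lpos s' (p i)) -> (forall i, P (rpos s i) = rpos s (p' i)) ->
  ob_tens (ob_permS K p) (ob_permS K p') = ob_permS K P.
Proof.
move=> Pl Pr; rewrite (ob_permSE K strue) (ob_permSE K strue') (ob_permSE K cat_true).
have [M [mM -> Ml Mr]] := tens_mate K (vperm_mate strue p) (vperm_mate strue' p').
congr (diagv K _); apply: eq_arcs_of => z; case: (node_catP z) => -[x ->]; rewrite ?Ml ?Mr.
  case: x => i /=; first by rewrite Pl.
  by congr inl; apply: (@perm_inj _ P); rewrite permKV Pl permKV.
case: x => i /=; first by rewrite Pr.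
by congr inl; apply: (@perm_inj _ P); rewrite permKV Pr permKV.
Qed.
End TensPerm.

Lemma ob_perm_lift (K : fieldType) (s : seq bool) (strue : forall i, nth true s i = true) (p : 'S_(size s)) :
  ob_tens (ob_id K [:: true]) (ob_permS K p) = ob_permS K (s := true :: s) (lift_perm ord0 ord0 p).
Proof.
have t1 i : nth true [:: true] i = true by case: i => [|[|i]].
rewrite -(ob_permS1 K t1); apply: (tens_perm K t1 strue) => i.
  have E : lpos s i = ord0 by apply: val_inj; case: i => -[].
  by rewrite E lift_perm_id; apply: val_inj; rewrite /= perm1; case: i {E} => -[].
have E (j : 'I_(size s)) : rpos [:: true] j = lift ord0 j by apply: val_inj.
by rewrite E lift_perm_lift E.
Qed.

Lemma ob_XE (K : fieldType) : ob_X K = ob_permS K (s := [:: true; true]) (tperm ord0 ord_max).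
Proof.
congr (diagv K _); apply/setP=> -[a b]; rewrite !inE /=; apply/orP/imsetP => [[/eqP[-> ->]|/eqP[-> ->]]|[i _ [-> ->]]].
- exists ord_max => //; rewrite tpermR; congr (inr _, inl _); apply: val_inj; rewrite /= inordK //.
- exists ord0 => //; rewrite tpermL; congr (inr _, inl _); apply: val_inj; rewrite /= inordK //.
case: i => -[|[|//]] lt.
  right; apply/eqP; have -> : Ordinal lt = ord0 by apply: val_inj.
  by rewrite tpermL; congr (inr _, inl _); apply: val_inj; rewrite /= inordK.
left; apply/eqP; have -> : Ordinal lt = ord_max by apply: val_inj.
by rewrite tpermR; congr (inr _, inl _); apply: val_inj; rewrite /= inordK.
Qed.

Lemma ob_X_id (K : fieldType) (s : seq bool) (strue : forall i, nth true s i = true) :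
  ob_tens (ob_X K) (ob_id K s) =
  ob_permS K (s := true :: true :: s) (tperm ord0 (lift ord0 ord0)).
Proof.
have t2 i : nth true [:: true; true] i = true by case: i => [|[|[]]].
rewrite ob_XE -(ob_permS1 K strue); apply: (tens_perm K t2 strue) => i.
  have l0 : lpos s (ord0 : 'I_(size [:: true; true])) = ord0 :> 'I_(size (true :: true :: s)) by apply: val_inj.
  have l1 : lpos s (ord_max : 'I_(size [:: true; true])) = lift ord0 ord0 :> 'I_(size (true :: true :: s)) by apply: val_inj.
  have [->|->] : i = ord0 \/ i = ord_max by case: i => -[|[|//]] lt; [left|right]; apply: val_inj.
    by rewrite tpermL l0 l1 tpermL.
  by rewrite tpermR l0 l1 tpermR.
by rewrite perm1 tpermD // -(inj_eq val_inj).
Qed.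

(** * Closure properties of the tensor ideal *)

Section Closure.
Variables (K : fieldType) (delta : K) (m l : nat).
Notation J := (ideal_J delta m l).

Lemma J0 s t : J (0 : OB K s t).
Proof. by exists 0%N, (fun=> 0), (fun=> 0); split; [case|rewrite big_ord0]. Qed.
Lemma J_gen s t (f : OB K s t) : Defs.generated delta m l f -> J f.
Proof. by move=> gf; exists 1%N, (fun=> 1), (fun=> f); rewrite big_ord1 scale1r. Qed.
Lemma JZD s t c (f g : OB K s t) : J f -> J g -> J (c *: f + g).
Proof.
move=> [n1 [c1 [g1 [G1 ->]]]] [n2 [c2 [g2 [G2 ->]]]].
exists (n1 + n2)%N, (fun i => match split i with inl i => c * c1 i | inr i => c2 i end),
  (fun i => match split i with inl i => g1 i | inr i => g2 i end); split.
  by move=> i; case: split.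
rewrite big_split_ord /= scaler_sumr; congr (_ + _); apply: eq_bigr => i _.
  by rewrite (unsplitK (inl i)) scalerA.
by rewrite (unsplitK (inr i)).
Qed.
Lemma J_sum s t I (r : seq I) (P : pred I) (F : I -> OB K s t) :
  (forall i, P i -> J (F i)) -> J (\sum_(i <- r | P i) F i).
Proof.
move=> H; elim/big_rec: _ => [|i x Pi Jx]; first exact: J0.
by rewrite -[F i]scale1r; apply: JZD => //; apply: H.
Qed.
Lemma J_map s t s' t' (h : OB K s t -> OB K s' t') : linear h ->
  (forall f, Defs.generated delta m l f -> Defs.generated delta m l (h f)) -> forall f, J f -> J (h f).
Proof.
move=> hl hg f [n [c [g [G ->]]]].
rewrite (lin_comb hl).
by apply: J_sum => i _; rewrite -[_ *: _]addr0; apply: JZD; [apply/J_gen/hg|apply: J0].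
Qed.
Lemma J_compl s t u (f : OB K t u) (g : OB K s t) : J g -> J (ob_comp delta f g).
Proof. by apply: J_map => [|x]; [exact: ob_comp_linearr|exact: gen_compl]. Qed.
Lemma J_compr s t u (f : OB K t u) (g : OB K s t) : J f -> J (ob_comp delta f g).
Proof. by apply: J_map (fun f => ob_comp delta f g) _ _ _ => [|x]; [exact: ob_comp_linearl|exact: gen_compr]. Qed.
Lemma J_tensl s t s' t' (f : OB K s t) (g : OB K s' t') : J g -> J (ob_tens f g).
Proof. by apply: J_map => [|x]; [exact: ob_tens_linearr|exact: gen_tensl]. Qed.
Lemma J_tensr s t s' t' (f : OB K s t) (g : OB K s' t') : J f -> J (ob_tens f g).
Proof. by apply: J_map (fun f => ob_tens f g) _ _ _ => [|x]; [exact: ob_tens_linearl|exact: gen_tensr]. Qed.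
End Closure.

(** * Tensor powers *)

Section Tensors.
Variable K : fieldType.
Implicit Types U W Z : vectType K.

Lemma lfZ U W (f : 'Hom(U, W)) c u : f (c *: u) = c *: f u. Proof. exact: linearZ. Qed.
Lemma lfD U W (f : 'Hom(U, W)) u v : f (u + v) = f u + f v. Proof. exact: linearD. Qed.
Lemma lf0 U W (f : 'Hom(U, W)) : f 0 = 0. Proof. exact: linear0. Qed.
Lemma lf_sum U W (f : 'Hom(U, W)) I (r : seq I) (P : pred I) (E : I -> U) :
  f (\sum_(i <- r | P i) E i) = \sum_(i <- r | P i) f (E i).
Proof. exact: linear_sum. Qed.

Lemma coord_bas U (i j : 'I_(dimf U)) : coord (bas U) i (bas U)`_j = (i == j)%:R.
Proof. by rewrite coord_free 1?eq_sym //; apply: (basis_free (vbasisP _)). Qed.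
Lemma bas_expand U (u : U) : u = \sum_i coord (bas U) i u *: (bas U)`_i.
Proof. by apply: coord_vbasis; apply: memvf. Qed.

Lemma tensDl U W (w : W) : linear (fun u : U => tens u w).
Proof. by move=> c u u'; apply/matrixP=> i j; rewrite !mxE linearP /= mulrDl mulrA. Qed.
Lemma tensDr U W (u : U) : linear (tens u : W -> _).
Proof. by move=> c w w'; apply/matrixP=> i j; rewrite !mxE linearP /= mulrDr mulrCA. Qed.
Lemma tens_suml U W I (r : seq I) (P : pred I) (F : I -> U) (w : W) :
  tens (\sum_(i <- r | P i) F i) w = \sum_(i <- r | P i) tens (F i) w.
Proof.
apply: (big_morph (fun u => tens u w)) => [x y|].
  by have := tensDl w 1 x y; rewrite !scale1r.
by apply/matrixP=> i j; rewrite !mxE linear0 mul0r.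
Qed.
Lemma tens_sumr U W I (r : seq I) (P : pred I) (F : I -> W) (u : U) :
  tens u (\sum_(i <- r | P i) F i) = \sum_(i <- r | P i) tens u (F i).
Proof.
apply: (big_morph (tens u)) => [x y|].
  by have := tensDr u 1 x y; rewrite !scale1r.
by apply/matrixP=> i j; rewrite !mxE linear0 mulr0.
Qed.
Lemma tensZl U W c (u : U) (w : W) : tens (c *: u) w = c *: tens u w.
Proof. by apply/matrixP=> i j; rewrite !mxE linearZ /= mulrA. Qed.
Lemma tensZr U W c (u : U) (w : W) : tens u (c *: w) = c *: tens u w.
Proof. by apply/matrixP=> i j; rewrite !mxE linearZ /= mulrCA. Qed.
Lemma tens_addl U W (u u' : U) (w : W) : tens (u + u') w = tens u w + tens u' w.
Proof. by have := tensDl w 1 u u'; rewrite !scale1r. Qed.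
Lemma tens_addr U W (u : U) (w w' : W) : tens u (w + w') = tens u w + tens u w'.
Proof. by have := tensDr u 1 w w'; rewrite !scale1r. Qed.

Definition rank1_fun U W (xi : 'Hom(U, K^o)) (w : W) (u : U) : W := (xi u : K) *: w.
Lemma rank1_linear U W (xi : 'Hom(U, K^o)) (w : W) : linear (rank1_fun xi w).
Proof. by move=> c u u'; rewrite /rank1_fun linearP scalerDl -scalerA. Qed.
HB.instance Definition _ U W (xi : 'Hom(U, K^o)) (w : W) :=
  GRing.isLinear.Build K U W *:%R (rank1_fun xi w) (rank1_linear xi w).
Definition rank1 U W (xi : 'Hom(U, K^o)) (w : W) : 'Hom(U, W) := linfun (rank1_fun xi w).
Lemma rank1E U W (xi : 'Hom(U, K^o)) (w : W) u : rank1 xi w u = (xi u : K) *: w.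
Proof. by rewrite lfunE. Qed.
Definition dbas U (i : 'I_(dimf U)) : 'Hom(U, K^o) := linfun (coord (bas U) i : U -> K^o).
Lemma dbasE U (i : 'I_(dimf U)) u : dbas i u = coord (bas U) i u.
Proof. by rewrite lfunE. Qed.

Lemma tens_expand U W (x : tensT U W) :
  x = \sum_(i < dimf U) \sum_(j < dimf W) (x : 'M_(_, _)) i j *: tens (bas U)`_i (bas W)`_j.
Proof.
apply/matrixP=> a c; rewrite summxE (bigD1 a) //= summxE (bigD1 c) //= !mxE !coord_bas !eqxx !mulr1.
rewrite big1 ?addr0 => [|j /negPf jc]; last by rewrite !mxE !coord_bas [c == j]eq_sym jc !mulr0.
rewrite big1 ?addr0 // => i /negPf ia; rewrite summxE big1 // => j _.
by rewrite !mxE !coord_bas [a == i]eq_sym ia mul0r mulr0.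
Qed.

Lemma tens_ind U W (P : tensT U W -> Prop) : P 0 -> (forall c x y, P x -> P y -> P (c *: x + y)) ->
  (forall (i : 'I_(dimf U)) w, P (tens (bas U)`_i w)) -> forall x, P x.
Proof.
move=> P0 PD Pt x; rewrite [x]tens_expand; elim/big_rec: _ => [|i y _ Py] //.
by elim/big_rec: _ => [|j z _ Pz]; rewrite ?add0r // -addrA; apply: PD.
Qed.

Lemma tens_ext U W Z (f g : 'Hom(tensT U W, Z)) :
  (forall u w, f (tens u w) = g (tens u w)) -> f = g.
Proof.
move=> H; apply/lfunP=> x; rewrite [x]tens_expand !linear_sum; apply: eq_bigr => i _.
by rewrite !linear_sum; apply: eq_bigr => j _; rewrite !linearZ /= H.
Qed.

(** Defined for an arbitrary function from its values on pairs of basis vectors; bilinearity enters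
    only in the evaluation on pure tensors. *)
Definition lift_bil U W Z (f : U -> W -> Z) (x : tensT U W) : Z :=
  \sum_(i < dimf U) \sum_(j < dimf W) (x : 'M_(_, _)) i j *: f (bas U)`_i (bas W)`_j.
Lemma lift_bil_linear U W Z (f : U -> W -> Z) : linear (lift_bil f).
Proof.
move=> c x y; rewrite /lift_bil scaler_sumr -big_split; apply: eq_bigr => i _.
rewrite scaler_sumr -big_split; apply: eq_bigr => j _.
by rewrite /= !mxE scalerDl scalerA.
Qed.
HB.instance Definition _ U W Z (f : U -> W -> Z) :=
  GRing.isLinear.Build K (tensT U W) Z *:%R (lift_bil f) (lift_bil_linear f).
Definition lift2 U W Z (f : U -> W -> Z) : 'Hom(tensT U W, Z) := linfun (lift_bil f).
Lemma lift2E U W Z (f : U -> W -> Z) u w : (forall w, linear (f^~ w)) -> (forall u, linear (f u)) ->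
  lift2 f (tens u w) = f u w.
Proof.
move=> fl fr; rewrite lfunE /= /lift_bil.
have fsl (c : 'I_(dimf U) -> K) (v : 'I_(dimf U) -> U) z : f (\sum_i c i *: v i) z = \sum_i c i *: f (v i) z.
  exact: (lin_comb (fl z)).
have fsr (c : 'I_(dimf W) -> K) (v : 'I_(dimf W) -> W) z : f z (\sum_i c i *: v i) = \sum_i c i *: f z (v i).
  exact: (lin_comb (fr z)).
rewrite [in RHS](bas_expand u) fsl; apply: eq_bigr => i _; rewrite [in RHS](bas_expand w) fsr scaler_sumr.
by apply: eq_bigr => j _; rewrite mxE scalerA.
Qed.

Definition tensop U U' W W' (f : 'Hom(U, U')) (g : 'Hom(W, W')) : 'Hom(tensT U W, tensT U' W') :=
  lift2 (fun u w => tens (f u) (g w)).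
Lemma tensopE U U' W W' (f : 'Hom(U, U')) (g : 'Hom(W, W')) u w :
  tensop f g (tens u w) = tens (f u) (g w).
Proof.
by rewrite /tensop lift2E // => z c x y; rewrite linearP ?tensDl ?tensDr.
Qed.
Lemma tensop_comp U U' U'' W W' W'' (f' : 'Hom(U', U'')) (g' : 'Hom(W', W''))
    (f : 'Hom(U, U')) (g : 'Hom(W, W')) :
  (tensop f' g' \o tensop f g)%VF = tensop (f' \o f)%VF (g' \o g)%VF.
Proof. by apply: tens_ext => u w; rewrite comp_lfunE !tensopE !comp_lfunE. Qed.
Lemma tensop1 U W : tensop (\1%VF : 'End(U)) (\1%VF : 'End(W)) = \1%VF.
Proof. by apply: tens_ext => u w; rewrite tensopE !lfunE. Qed.
Lemma tensop_linearl U U' W W' (g : 'Hom(W, W')) : linear (fun f : 'Hom(U, U') => tensop f g).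
Proof.
move=> c f f'; apply: tens_ext => u w.
by rewrite add_lfunE scale_lfunE !tensopE add_lfunE scale_lfunE tensDl.
Qed.
Lemma tensop_linearr U U' W W' (f : 'Hom(U, U')) : linear (tensop f : 'Hom(W, W') -> _).
Proof.
move=> c g g'; apply: tens_ext => u w.
by rewrite add_lfunE scale_lfunE !tensopE add_lfunE scale_lfunE tensDr.
Qed.

Definition tensf U W (f : 'Hom(U, K^o)) (g : 'Hom(W, K^o)) : 'Hom(tensT U W, K^o) :=
  lift2 (fun u w => (f u : K) * (g w : K) : K^o).
Lemma tensfE U W (f : 'Hom(U, K^o)) (g : 'Hom(W, K^o)) u w : tensf f g (tens u w) = (f u : K) * (g w : K).
Proof.
rewrite /tensf lift2E // => z c x y; rewrite linearP /=; first by rewrite mulrDl /GRing.scale /= mulrA.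
by rewrite mulrDr /GRing.scale /= mulrCA.
Qed.

(** The tensor products of elementary endomorphisms span all endomorphisms of the tensor product. *)
Lemma endo_tensop_ind U W (P : 'End(tensT U W) -> Prop) :
  (forall c f g, P f -> P g -> P (c *: f + g)) -> (forall f g, P (tensop f g)) -> forall f, P f.
Proof.
move=> PD Pt f; have P0 : P 0.
  have -> : 0 = (-1) *: tensop (0 : 'End(U)) (0 : 'End(W)) + tensop 0 0 by rewrite scaleN1r addNr.
  exact: PD.
have Psum I (r : seq I) (F : I -> 'End(tensT U W)) : (forall i, P (F i)) -> P (\sum_(i <- r) F i).
  move=> H; elim/big_rec: _ => [|i x _ Px] //; by rewrite -[F i]scale1r; apply: PD.
have PZ c x : P x -> P (c *: x) by move=> Px; rewrite -[_ *: _]addr0; apply: PD.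
pose E (Z : vectType K) (i k : 'I_(dimf Z)) : 'End(Z) := rank1 (dbas i) (bas Z)`_k.
have -> : f = \sum_(i < dimf U) \sum_(j < dimf W) \sum_(k < dimf U) \sum_(h < dimf W)
    (f (tens (bas U)`_i (bas W)`_j) : 'M_(_, _)) k h *: tensop (E U i k) (E W j h); last first.
  by do 4!(apply: (Psum) => ?); exact: PZ.
have EE (Z : vectType K) i k z : E Z i k z = coord (bas Z) i z *: (bas Z)`_k.
  by rewrite rank1E dbasE.
apply: tens_ext => u w; rewrite [in LHS](bas_expand u) tens_suml linear_sum sum_lfunE; apply: eq_bigr => i _.
rewrite [in LHS](bas_expand w) tens_sumr linear_sum sum_lfunE; apply: eq_bigr => j _.
rewrite tensZl tensZr !linearZ /= [X in _ *: (_ *: X)]tens_expand !scaler_sumr sum_lfunE.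
apply: eq_bigr => k _; rewrite !scaler_sumr sum_lfunE; apply: eq_bigr => h _.
by rewrite scale_lfunE tensopE !EE tensZl tensZr !scalerA; congr (_ *: _); rewrite mulrC.
Qed.

Lemma tcat_linear (V : superspace K) s t (y : tpow V t) : linear (fun x : tpow V s => tcat x y).
Proof.
case: s => [|e s] c x x' /=; first by rewrite scalerDl scalerA.
rewrite scaler_sumr -big_split; apply: eq_bigr => i _.
rewrite scaler_sumr -big_split; apply: eq_bigr => j _.
by rewrite /= !mxE scalerDl scalerA.
Qed.
Lemma tcat_tens (V : superspace K) e s t (v : ssign V e) (x : tpow V s) (y : tpow V t) :
  @tcat K V (e :: s) t (tens v x) y = tens v (tcat x y).
Proof.
rewrite -[LHS](_ : lift2 (fun v x => tens v (tcat x y)) (tens v x) = _); last by rewrite lfunE.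
apply: lift2E => [z|z] c a b; first by rewrite tensDl.
by rewrite tcat_linear tensDr.
Qed.
Lemma tcat_pure1 (V : superspace K) e t (v : ssign V e) (y : tpow V t) : tcat (pure1 v) y = tens v y.
Proof. by rewrite /pure1 tcat_tens /= scale1r. Qed.
Lemma tcat_pure2 (V : superspace K) e e' t (v : ssign V e) (w : ssign V e') (y : tpow V t) :
  tcat (pure2 v w) y = tens v (tens w y).
Proof. by rewrite /pure2 tcat_tens tcat_pure1. Qed.
End Tensors.

(** * Extension of scalars and dual numbers *)

Section Ext.
Variables (K : fieldType) (A : superalg K).
Implicit Types U W Z : vectType K.

Lemma atensDr U (a : A) (u v : U) : atens a (u + v) = atens a u + atens a v.
Proof. by apply/rowP=> i; rewrite !mxE linearD scalerDl. Qed.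
Lemma atens0l U (u : U) : atens (0 : A) u = 0.
Proof. by apply/rowP=> i; rewrite !mxE scaler0. Qed.
Lemma atens0r U (a : A) : atens a (0 : U) = 0.
Proof. by apply/rowP=> i; rewrite !mxE linear0 scale0r. Qed.
Lemma atensZr U (a : A) c (u : U) : atens a (c *: u) = c%:A *: atens a u.
Proof. by apply/rowP=> i; rewrite !mxE linearZ /= mulr_algl scalerA. Qed.
Lemma atensZl U (a : A) c (u : U) : atens (c *: a) u = atens a (c *: u).
Proof. by apply/rowP=> i; rewrite !mxE scalerA mulrC linearZ. Qed.
Lemma atens_mul U (a b : A) (u : U) : a *: atens b u = atens (a * b) u.
Proof. by apply/rowP=> i; rewrite !mxE scalerAr. Qed.
Lemma atens_sumr U I (r : seq I) (P : pred I) (F : I -> U) (a : A) :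
  atens a (\sum_(i <- r | P i) F i) = \sum_(i <- r | P i) atens a (F i).
Proof. by apply: (big_morph (atens a)) => [x y|]; rewrite ?atensDr ?atens0r. Qed.
Lemma scal_expand U (x : scal A U) : x = \sum_i atens (x 0 i) (bas U)`_i.
Proof.
apply/rowP=> j; rewrite summxE (bigD1 j) //= !mxE coord_bas eqxx scale1r big1 ?addr0 // => i ij.
by rewrite !mxE coord_bas eq_sym (negPf ij) scale0r.
Qed.
Lemma scal_ind U (P : scal A U -> Prop) : P 0 -> (forall x y, P x -> P y -> P (x + y)) ->
  (forall a u, P (atens a u)) -> forall x, P x.
Proof.
by move=> P0 PD Pa x; rewrite [x]scal_expand; elim/big_rec: _ => [|i y _ Py] //; apply: PD.
Qed.

Lemma extD U W (f : 'Hom(U, W)) (x y : scal A U) : ext f (x + y) = ext f x + ext f y.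
Proof. by rewrite /ext -big_split; apply: eq_bigr => i _; rewrite !mxE scalerDl. Qed.
Lemma extZ U W (f : 'Hom(U, W)) a (x : scal A U) : ext f (a *: x) = a *: ext f x.
Proof. by rewrite /ext scaler_sumr; apply: eq_bigr => i _; rewrite !mxE scalerA. Qed.
Lemma ext0 U W (f : 'Hom(U, W)) : ext f (0 : scal A U) = 0.
Proof. by have := extZ f 0 (0 : scal A U); rewrite !scale0r. Qed.
Lemma ext_sum U W (f : 'Hom(U, W)) I (r : seq I) (P : pred I) (F : I -> scal A U) :
  ext f (\sum_(i <- r | P i) F i) = \sum_(i <- r | P i) ext f (F i).
Proof. by apply: (big_morph (ext f)) => [x y|]; rewrite ?extD ?ext0. Qed.
Lemma ext_atens U W (f : 'Hom(U, W)) (a : A) (u : U) : ext f (atens a u) = atens a (f u).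
Proof.
rewrite /ext [in RHS](bas_expand u) linear_sum atens_sumr; apply: eq_bigr => i _.
by rewrite mxE linearZ /= -atensZl atens_mul mulr1.
Qed.
Lemma ext_comp U W Z (f : 'Hom(W, Z)) (g : 'Hom(U, W)) (x : scal A U) : ext (f \o g)%VF x = ext f (ext g x).
Proof.
elim/scal_ind: x => [|x y Hx Hy|a u]; first by rewrite !ext0.
  by rewrite !extD Hx Hy.
by rewrite !ext_atens comp_lfunE.
Qed.

Lemma kmulDr (U : superspace K) W (x : scal A U) (y y' : scal A W) :
  kmul x (y + y') = kmul x y + kmul x y'.
Proof.
rewrite /kmul; do 4!(rewrite -big_split; apply: eq_bigr => ? _).
by rewrite /= !mxE linearD mulrDr scalerDl.
Qed.
Lemma kmulDl (U : superspace K) W (x x' : scal A U) (y : scal A W) :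
  kmul (x + x') y = kmul x y + kmul x' y.
Proof.
rewrite /kmul; do 4!(rewrite -big_split; apply: eq_bigr => ? _).
by rewrite /= extD !mxE mulrDr mulrDl scalerDl.
Qed.
Lemma kmul0r (U : superspace K) W (x : scal A U) : kmul x (0 : scal A W) = 0.
Proof. by apply: (@addrI _ (kmul x 0)); rewrite -kmulDr !addr0. Qed.

Lemma kmul_sumr (U : superspace K) W (x : scal A U) I (r : seq I) (P : pred I) (F : I -> scal A W) :
  kmul x (\sum_(i <- r | P i) F i) = \sum_(i <- r | P i) kmul x (F i).
Proof. by apply: (big_morph (kmul x)) => [y z|]; rewrite ?kmulDr ?kmul0r. Qed.

Lemma kmul_atensr (U : superspace K) W (x : scal A U) (b : A) (w : W) :
  kmul x (atens b w) = \sum_(p : bool) \sum_(q : bool) \sum_(i < dimf U)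
    ((-1) ^+ (p && q) * ext (spr U p) x 0 i * sa_pr A q b) *: atens 1 (tens (bas U)`_i w).
Proof.
rewrite /kmul; do 3!(apply: eq_bigr => ? _); rewrite [in RHS](bas_expand w).
rewrite tens_sumr atens_sumr scaler_sumr; apply: eq_bigr => j _.
by rewrite mxE linearZ /= tensZr -atensZl !atens_mul mulr1 -!scalerAr mulr1.
Qed.
Lemma kmul_atens (U : superspace K) W (a b : A) (u : U) (w : W) :
  kmul (atens a u) (atens b w) = \sum_(p : bool) \sum_(q : bool)
    atens ((-1) ^+ (p && q) * a * sa_pr A q b) (tens (spr U p u) w).
Proof.
rewrite kmul_atensr; do 2!(apply: eq_bigr => ? _).
rewrite ext_atens [in RHS](bas_expand (spr _ _ _)) tens_suml atens_sumr; apply: eq_bigr => i _.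
by rewrite mxE tensZl -atensZl atens_mul mulr1 -scalerAr -scalerAl.
Qed.
Lemma sa_pr_one : sa_pr A true 1 = 0.
Proof. by rewrite -(sa_one A) sa_prK. Qed.
Lemma kmul_atens1 (U : superspace K) W (a : A) (u : U) (w : W) :
  kmul (atens a u) (atens 1 w) = atens a (tens u w).
Proof.
rewrite kmul_atens !big_bool /= sa_pr_one sa_one !mulr0 !atens0l !add0r expr0 !mul1r !mulr1.
by rewrite -atensDr -tens_addl addrC (spr_add false).
Qed.
(** No sign arises: the sign in [kmul] involves the degree of the first vector and that of the
    coefficient of the second, and [f] changes neither. *)
Lemma ext_kmul (U : superspace K) W W' (f : 'Hom(W, W')) (x : scal A U) (y : scal A W) :
  ext (tensop \1%VF f) (kmul x y) = kmul x (ext f y).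
Proof.
elim/scal_ind: y => [|y y' Hy Hy'|b w]; first by rewrite ext0 !kmul0r ext0.
  by rewrite kmulDr !extD kmulDr Hy Hy'.
rewrite ext_atens !kmul_atensr; do 3!(rewrite ext_sum; apply: eq_bigr => ? _).
by rewrite extZ ext_atens tensopE lfunE.
Qed.

Section Act.
Variables (V : superspace K) (g : glpoint A V).

Lemma actD s (x y : scal A (tpow V s)) : Defs.act g (x + y) = Defs.act g x + Defs.act g y.
Proof.
case: s x y => [|e s] x y //=; rewrite -big_split; apply: eq_bigr => i _.
by rewrite mxE scalerDl.
Qed.
Lemma actZ s a (x : scal A (tpow V s)) : Defs.act g (a *: x) = a *: Defs.act g x.
Proof.
case: s x => [|e s] x //=; rewrite scaler_sumr; apply: eq_bigr => i _.
by rewrite mxE scalerA.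
Qed.
Lemma act0 s : Defs.act g (0 : scal A (tpow V s)) = 0.
Proof. by have := actZ 0 (0 : scal A (tpow V s)); rewrite !scale0r. Qed.
Lemma act_sum s I (r : seq I) (P : pred I) (F : I -> scal A (tpow V s)) :
  Defs.act g (\sum_(i <- r | P i) F i) = \sum_(i <- r | P i) Defs.act g (F i).
Proof. by apply: (big_morph (@Defs.act _ _ _ g s)) => [x y|]; rewrite ?actD ?act0. Qed.

Lemma act_atens1 e s (u : tpow V (e :: s)) : Defs.act g (atens 1 u) =
  \sum_(i < dimf (ssign V e)) \sum_(j < dimf (tpow V s)) ((u : 'M[K]_(_, _)) i j)%:A *:
    kmul (Defs.act1 g (atens 1 (bas (ssign V e))`_i)) (Defs.act g (atens 1 (bas (tpow V s))`_j)).
Proof.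
rewrite [LHS]/=; under eq_bigr => k _ do rewrite scaler_sumr.
rewrite exchange_big; apply: eq_bigr => i _; under eq_bigr => k _ do rewrite scaler_sumr.
rewrite exchange_big; apply: eq_bigr => j _; under eq_bigr => k _ do rewrite scalerA.
rewrite -scaler_suml; congr (_ *: _); rewrite [in RHS](bas_expand u) summxE scaler_suml.
by apply: eq_bigr => k _; rewrite !mxE mulr_algl scalerA.
Qed.
Lemma kmulZr (U : superspace K) W c (x : scal A U) (y : scal A W) :
  kmul x (c%:A *: y) = c%:A *: kmul x y.
Proof.
rewrite /kmul; do 4!(rewrite scaler_sumr; apply: eq_bigr => ? _).
by rewrite !mxE mulr_algl linearZ /= scalerA -scalerAr mulr_algl.
Qed.

(** A basis vector in the first factor is all that [tens_ind] asks for, and no linearity of [act1]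
    has to be established. *)
Lemma act_tens_bas e s (i : 'I_(dimf (ssign V e))) (w : tpow V s) :
  @Defs.act _ _ _ g (e :: s) (atens 1 (tens (bas (ssign V e))`_i w)) =
  kmul (Defs.act1 g (atens 1 (bas (ssign V e))`_i)) (Defs.act g (atens 1 w)).
Proof.
rewrite act_atens1 (bigD1 i) //= [X in _ + X]big1 ?addr0 => [|i' /negPf ii]; last first.
  by apply: big1 => j _; rewrite mxE coord_bas ii mul0r !scale0r.
rewrite [in RHS](bas_expand w) atens_sumr act_sum.
rewrite kmul_sumr.
by apply: eq_bigr => j _; rewrite mxE coord_bas eqxx mul1r atensZr actZ kmulZr.
Qed.
End Act.
End Ext.

Section GlHom.
Variables (K : fieldType) (V : superspace K).
Lemma gl_hom_comp s t u (f : 'Hom(tpow V t, tpow V u)) (g : 'Hom(tpow V s, tpow V t)) :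
  gl_hom f -> gl_hom g -> gl_hom (f \o g)%VF.
Proof. by move=> Hf Hg A p x; rewrite !ext_comp Hg Hf. Qed.
Lemma gl_hom_tensl e s t (f : 'Hom(tpow V s, tpow V t)) :
  gl_hom f -> @gl_hom K V (e :: s) (e :: t) (tensop \1%VF f).
Proof.
move=> Hf A g x; rewrite [x]scal_expand !(act_sum, ext_sum); apply: eq_bigr => k _.
have E a (W : vectType K) (w : W) : @atens K A W a w = a *: atens 1 w by rewrite atens_mul mulr1.
have TE c (v : ssign V e) w : tensop \1%VF f (c *: tens v w) = c *: tens v (f w).
  by rewrite linearZ /= tensopE lfunE.
rewrite E !(actZ, extZ); congr (_ *: _); set u := (bas _)`_k.
rewrite act_atens1 ext_atens [X in atens 1 (_ X)]tens_expand linear_sum ext_sum atens_sumr act_sum.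
apply: eq_bigr => i _; rewrite linear_sum ext_sum atens_sumr act_sum; apply: eq_bigr => j _.
rewrite extZ ext_kmul Hf ext_atens.
by rewrite -[RHS]/(@Defs.act _ _ _ g (e :: t) (atens 1 (tensop \1%VF f (((u : 'M[K]_(_, _)) i j) *: tens (bas (ssign V e))`_i (bas (tpow V s))`_j)))) TE atensZr actZ act_tens_bas.
Qed.
End GlHom.

(* K[t]/(t^2), to be graded with t in either degree. *)
Section DualNumbers.
Variable K : fieldType.
Record dualn := Dualn {dn1 : K; dn2 : K}.
Definition dualn_pair (x : dualn) := (dn1 x, dn2 x).
Lemma dualn_pairK : cancel dualn_pair (fun u => Dualn u.1 u.2). Proof. by case. Qed.
HB.instance Definition _ := Choice.copy dualn (can_type dualn_pairK).
Lemma dualn_eq (x y : dualn) : dn1 x = dn1 y -> dn2 x = dn2 y -> x = y.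
Proof. by case: x y => [a b] [c d] /= -> ->. Qed.
Definition dualn_add x y := Dualn (dn1 x + dn1 y) (dn2 x + dn2 y).
Definition dualn_opp x := Dualn (- dn1 x) (- dn2 x).
Lemma dualn_addA : associative dualn_add.
Proof. by move=> x y z; apply: dualn_eq; rewrite /= addrA. Qed.
Lemma dualn_addC : commutative dualn_add.
Proof. by move=> x y; apply: dualn_eq; rewrite /= addrC. Qed.
Lemma dualn_add0 : left_id (Dualn 0 0) dualn_add.
Proof. by move=> x; apply: dualn_eq; rewrite /= add0r. Qed.
Lemma dualn_addN : left_inverse (Dualn 0 0) dualn_opp dualn_add.
Proof. by move=> x; apply: dualn_eq; rewrite /= addNr. Qed.
HB.instance Definition _ := GRing.isZmodule.Build dualn dualn_addA dualn_addC dualn_add0 dualn_addN.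
Definition dualn_mul x y := Dualn (dn1 x * dn1 y) (dn1 x * dn2 y + dn2 x * dn1 y).
Definition dualn1 := Dualn 1 0.
Lemma dualn_mulA : associative dualn_mul.
Proof.
move=> x y z; apply: dualn_eq; rewrite /= ?mulrA //.
by rewrite mulrDr mulrDl !mulrA addrA.
Qed.
Lemma dualn_mul1x : left_id dualn1 dualn_mul.
Proof. by move=> x; apply: dualn_eq; rewrite /= ?mul1r // mul0r addr0. Qed.
Lemma dualn_mulx1 : right_id dualn1 dualn_mul.
Proof. by move=> x; apply: dualn_eq; rewrite /= ?mulr1 // mulr0 add0r. Qed.
Lemma dualn_mulDl : left_distributive dualn_mul +%R.
Proof. by move=> x y z; apply: dualn_eq; rewrite /= !mulrDl // addrACA. Qed.
Lemma dualn_mulDr : right_distributive dualn_mul +%R.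
Proof. by move=> x y z; apply: dualn_eq; rewrite /= !mulrDr // addrACA. Qed.
Lemma dualn1_neq0 : dualn1 != 0.
Proof. by apply/eqP=> /(congr1 dn1) /= /eqP; rewrite oner_eq0. Qed.
HB.instance Definition _ := GRing.Zmodule_isNzRing.Build dualn
  dualn_mulA dualn_mul1x dualn_mulx1 dualn_mulDl dualn_mulDr dualn1_neq0.
Definition dualn_scale (a : K) x := Dualn (a * dn1 x) (a * dn2 x).
Lemma dualn_scaleA a b x : dualn_scale a (dualn_scale b x) = dualn_scale (a * b) x.
Proof. by apply: dualn_eq; rewrite /= mulrA. Qed.
Lemma dualn_scale1 : left_id 1 dualn_scale.
Proof. by move=> x; apply: dualn_eq; rewrite /= mul1r. Qed.
Lemma dualn_scaleDr : right_distributive dualn_scale +%R.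
Proof. by move=> a x y; apply: dualn_eq; rewrite /= mulrDr. Qed.
Lemma dualn_scaleDl x : {morph dualn_scale^~ x : a b / a + b}.
Proof. by move=> a b; apply: dualn_eq; rewrite /= mulrDl. Qed.
HB.instance Definition _ := GRing.Zmodule_isLmodule.Build K dualn
  dualn_scaleA dualn_scale1 dualn_scaleDr dualn_scaleDl.
Lemma dualn_scalerAl (a : K) (x y : dualn) : a *: (x * y) = (a *: x) * y.
Proof. by apply: dualn_eq; rewrite /= ?mulrDr !mulrA. Qed.
HB.instance Definition _ := GRing.Lmodule_isLalgebra.Build K dualn dualn_scalerAl.
Lemma dualn_scalerAr (a : K) (x y : dualn) : a *: (x * y) = x * (a *: y).
Proof. by apply: dualn_eq; rewrite /= ?mulrDr ?(mulrCA a). Qed.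
HB.instance Definition _ := GRing.Lalgebra_isAlgebra.Build K dualn dualn_scalerAr.

Definition dualn_pr (p q : bool) (x : dualn) : dualn :=
  Dualn (if q then 0 else dn1 x) (if q == p then dn2 x else 0).
Lemma dualn_pr_linear p q : linear (dualn_pr p q).
Proof.
by move=> c x y; apply: dualn_eq; rewrite /dualn_pr; case: q; case: p => //=; rewrite ?mulr0 ?addr0.
Qed.
HB.instance Definition _ p q := GRing.isLinear.Build K dualn dualn *:%R (dualn_pr p q) (dualn_pr_linear p q).

Lemma dualn_prE p q x : dualn_pr p q x = x -> (q -> dn1 x = 0) /\ (q != p -> dn2 x = 0).
Proof.
move=> E; have := congr1 dn1 E; have := congr1 dn2 E => /=.
by case: q E; case: p => E /= H1 H2; split.
Qed.

(** Supercommutativity holds for odd t as well, because t * t = 0. *)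
Definition dualsa (p : bool) : superalg K.
Proof.
refine (@SuperAlg K dualn (fun q => dualn_pr p q) _ _ _ _ _).
- by move=> x; apply: dualn_eq; case: p => /=; rewrite ?addr0 ?add0r.
- by move=> q r x; apply: dualn_eq; case: p; case: q; case: r.
- by apply: dualn_eq; case: p.
- move=> q r x y /dualn_prE[x1 x2] /dualn_prE[y1 y2]; apply: dualn_eq; rewrite /=.
    case: q r x1 y1 {x2 y2} => -[] x1 y1 //=; [by rewrite x1 ?mul0r|by rewrite y1 ?mulr0].
  case: q r p x1 x2 y1 y2 => -[] [] /= x1 x2 y1 y2;
    rewrite ?(x1 isT) ?(y1 isT) ?(x2 isT) ?(y2 isT) ?mul0r ?mulr0 ?addr0 //.
move=> q r x y /dualn_prE[x1 x2] /dualn_prE[y1 y2]; case: q r x1 y1 x2 y2 => -[] x1 y1 _ _ /=;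
  rewrite ?expr1 ?expr0 ?mul1r ?mulN1r; apply: dualn_eq; rewrite /=.
all: rewrite ?(x1 isT) ?(y1 isT) ?mul0r ?mulr0 ?add0r ?addr0 ?oppr0 //; try exact: mulrC.
all: by rewrite addrC mulrC [X in _ + X]mulrC.
Defined.
End DualNumbers.

Section Derivations.
Variables (K : fieldType) (V : superspace K).
Implicit Type W : vectType K.

(** The sign of moving a symbol of degree [p] past a vector. *)
Definition ssgn (p : bool) : 'End(V) := \sum_(q : bool) (-1) ^+ (q && p) *: spr V q.
(* The super derivation of the tensor algebra extending E, a map of degree p. *)
Fixpoint sder (p : bool) (E : 'End(V)) (r : nat) : 'End(tpow V (plus r)) :=
  match r return 'End(tpow V (plus r)) with
  | 0 => 0
  | r'.+1 => (tensop E \1%VF : 'End(tensT V (tpow V (plus r')))) + tensop (ssgn p) (sder p E r')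
  end.
Definition homog (p : bool) (E : 'End(V)) := forall q v, E (spr V q v) = spr V (q (+) p) (E v).

Section Point.
Variables (p : bool) (E : 'End(V)) (Ep : homog p E).
Notation A := (dualsa K p).
Definition dt : A := Dualn 0 1 : dualn K.
Definition inf_mx : 'M[A]_(dimf V) := \matrix_(i, j) (coord (bas V) j (E (bas V)`_i) *: dt).

Lemma dt_sqr (a : A) : a * dt * dt = 0.
Proof. by apply: (@dualn_eq K); rewrite /= ?mulr0 ?mul0r ?add0r ?addr0 ?mulr0. Qed.
Lemma atens_inf (a : A) v : (atens a v : 'rV_(dimf V)) *m inf_mx = atens (a * dt) (E v).
Proof.
apply/rowP=> j; rewrite !mxE [in RHS](bas_expand v) !linear_sum scaler_suml; apply: eq_bigr => i _.
by rewrite !mxE !linearZ /= -scalerAl -scalerAr scalerA.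
Qed.
Lemma inf_sqr : inf_mx *m inf_mx = 0.
Proof.
apply/row_matrixP=> i; rewrite row_mul row0.
have -> : row i inf_mx = (atens (1 : A) (bas V)`_i : 'rV_(dimf V)) *m inf_mx.
  by rewrite atens_inf; apply/rowP=> j; rewrite !mxE mul1r.
by rewrite !atens_inf dt_sqr atens0l.
Qed.
Lemma dt_sqr1 : dt * dt = 0.
Proof. by have := dt_sqr 1; rewrite mul1r. Qed.
Lemma kmul_atens_dt W (a : A) (u : V) (w : W) :
  kmul (atens a u) (atens dt w) = atens (a * dt) (tens (ssgn p u) w).
Proof.
have dtE q : sa_pr A q dt = if q == p then dt else 0.
  by apply: (@dualn_eq K); case: q; case: (p).
rewrite kmul_atens /ssgn sum_lfunE tens_suml atens_sumr; apply: eq_bigr => q _.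
rewrite (bigD1 p) //= big1 ?addr0 => [|q' /negPf qp]; last by rewrite dtE qp mulr0 atens0l.
rewrite dtE eqxx scale_lfunE tensZl -atensZl.
apply: (congr1 (fun z : A => atens z (tens (spr V q u) w))).
by rewrite -mulrA -signr_odd; case: (_ && _); rewrite ?expr1 ?mulN1r ?scaleN1r // mul1r scale1r.
Qed.
Lemma apartD r (x y : scal A V) : apart r (x + y) = apart r x + apart r y.
Proof. by rewrite /apart -big_split; apply: eq_bigr => q _; rewrite extD map_mxD. Qed.
Lemma apart_atens r (a : A) (v : V) :
  apart r (atens a v) = \sum_(q : bool) atens (sa_pr A (r (+) q) a) (spr V q v).
Proof.
apply: eq_bigr => q _; rewrite ext_atens; apply/rowP=> i; rewrite !mxE linearZ //=.
Qed.
Lemma apart_inf r (x : scal A V) : apart r ((x : 'rV_(dimf V)) *m inf_mx) = (apart r x : 'rV_(dimf V)) *m inf_mx.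
Proof.
elim/scal_ind: x => [|x y Hx Hy|a v].
- have a0 : apart r (0 : scal A V) = 0 by apply: (@addrI _ (apart r 0)); rewrite -apartD !addr0.
  by rewrite mul0mx a0 mul0mx.
- by rewrite mulmxDl !apartD mulmxDl Hx Hy.
rewrite atens_inf !apart_atens mulmx_suml.
under [RHS]eq_bigr => q _ do rewrite atens_inf Ep.
rewrite [RHS](reindex_inj (h := fun q => q (+) p)) /=; last by move=> q1 q2; case: p; case: q1; case: q2.
apply: eq_bigr => q _; rewrite addbK; apply: (congr1 (fun z : A => atens z (spr V q (E v)))).
by apply: (@dualn_eq K); case: r; case: q; case: (p); rewrite /= ?mulr0 ?mul0r ?mulr1 ?addr0.
Qed.

(** The point 1 + tE, with inverse 1 - tE since t * t = 0. It is even because t is given the degree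
    of [E]. *)
Definition infpoint : glpoint A V.
Proof.
refine (@GLpoint K A V (1%:M + inf_mx) (1%:M - inf_mx) _ _ _).
- by rewrite mulmxDl !mulmxDr !mul1mx mulmxN inf_sqr oppr0 addr0 mulmx1 addrNK.
- by rewrite mulmxDr !mulmxDl !mulmx1 mulNmx inf_sqr oppr0 addr0 mul1mx addrNK.
- by move=> r x; rewrite !mulmxDr !mulmx1 apartD apart_inf.
Defined.

(** Expanding the product over the factors, the term in which t stands behind the first vector
    acquires the sign [ssgn] when t is moved to the front, and terms with two factors t vanish. *)
Lemma act_inf r (y : tpow V (plus r)) :
  Defs.act infpoint (atens 1 y) = atens 1 y + atens dt (sder p E r y) :> scal A (tpow V (plus r)).
Proof.
elim: r y => [|r IHr] y; first by rewrite /= zero_lfunE atens0r addr0.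
have [D DE] : exists D : 'End(tensT V (tpow V (plus r))), D = sder p E r.+1 by eexists.
rewrite -DE; elim/tens_ind: y => [|c x y Hx Hy|i w].
- by rewrite linear0 !atens0r addr0 (@act0 _ _ _ _ (plus r.+1)).
- rewrite linearP !atensDr !atensZr (@actD _ _ _ _ (plus r.+1)) (@actZ _ _ _ _ (plus r.+1)) Hx Hy.
  by rewrite scalerDr addrACA.
have H := @act_tens_bas K A V infpoint true (plus r) i w.
rewrite [LHS]H IHr /= mulmxDr mulmx1 atens_inf mul1r.
rewrite DE /= add_lfunE !tensopE lfunE /= atensDr kmulDl !kmulDr !kmul_atens1 !kmul_atens_dt mul1r dt_sqr1.
rewrite atens0l addr0 -!addrA; congr (_ + _); by rewrite addrC.
Qed.
End Point.
End Derivations.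

Section Homogeneous.
Variables (K : fieldType) (V : superspace K).

Lemma atens_dt_inj p (U : vectType K) (u v : U) : atens (dt K p) u = atens (dt K p) v -> u = v.
Proof.
move=> E; rewrite (bas_expand u) (bas_expand v); apply: eq_bigr => i _; congr (_ *: _).
by move/rowP/(_ i): E; rewrite !mxE => /(congr1 (fun x : dualn K => dn2 x)) /=; rewrite !mulr1.
Qed.
(** Compare the coefficients of t in the invariance under 1 + tE. *)
Lemma gl_hom_sder a b (f : 'Hom(tpow V (plus a), tpow V (plus b))) p (E : 'End(V)) :
  gl_hom f -> homog p E -> (f \o sder p E a)%VF = (sder p E b \o f)%VF.
Proof.
move=> Hf Ep; apply/lfunP=> y; rewrite !comp_lfunE; apply: (@atens_dt_inj p).
have := Hf _ (infpoint Ep) (atens 1 y).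
by rewrite act_inf extD !ext_atens act_inf => /addrI.
Qed.

Lemma spr_mem p (v : V) : spr V p v \in ss_part V p. Proof. exact: memv_pi. Qed.
Lemma spr_id p (v : V) : v \in ss_part V p -> spr V p v = v.
Proof. by move=> vp; rewrite /spr daddv_pi_id // ss_capC. Qed.
Lemma spr_part p q (v : V) : v \in ss_part V p -> spr V q v = if q == p then v else 0.
Proof.
move=> vp; case: eqP => [->|/eqP qp]; first exact: spr_id.
have -> : q = ~~ p by case: p q qp {vp} => -[].
by have := spr_add p v; rewrite {1}spr_id // => /eqP; rewrite -subr_eq0 addrAC subrr add0r => /eqP.
Qed.
Lemma ssgn_part p q (v : V) : v \in ss_part V q -> ssgn V p v = (-1) ^+ (q && p) *: v.
Proof.
move=> vq; rewrite /ssgn sum_lfunE (bigD1 q) //= big1 ?addr0 => [|q' /negPf qq].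
  by rewrite scale_lfunE spr_id.
by rewrite scale_lfunE (spr_part _ vq) qq scaler0.
Qed.
Lemma homog_part p q E (v : V) : homog p E -> v \in ss_part V q -> E v \in ss_part V (q (+) p).
Proof. by move=> Ep vq; rewrite -(spr_id vq) Ep spr_mem. Qed.
Lemma homog_ext (W : vectType K) (f g : 'Hom(V, W)) :
  (forall p v, v \in ss_part V p -> f v = g v) -> f = g.
Proof.
move=> H; apply/lfunP=> v; rewrite -(spr_add false v) !linearD /=.
by rewrite !(H _ _ (spr_mem _ _)).
Qed.
Lemma ssgnK p : (ssgn V p \o ssgn V p)%VF = \1%VF.
Proof.
apply: homog_ext => q v vq; rewrite comp_lfunE lfunE /= (ssgn_part _ vq) linearZ /= (ssgn_part _ vq).
by rewrite scalerA -signr_addb addbb scale1r.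
Qed.
Definition hpart (p : bool) (E : 'End(V)) : 'End(V) := \sum_(q : bool) (spr V (q (+) p) \o E \o spr V q)%VF.
Lemma hpart_homog p E : homog p (hpart p E).
Proof.
move=> q v; rewrite /hpart !sum_lfunE linear_sum /=; apply: eq_bigr => q' _.
rewrite !comp_lfunE (spr_part q' (spr_mem q v)); have [->|qq] := eqVneq q' q.
  by rewrite (spr_id (spr_mem _ _)).
rewrite !linear0 (spr_part (q (+) p) (spr_mem (q' (+) p) _)); case: eqP => // /addIb E'.
by rewrite E' eqxx in qq.
Qed.
Lemma hpart_sum E : E = hpart false E + hpart true E.
Proof.
apply: homog_ext => q v vq; rewrite add_lfunE /hpart !sum_lfunE -big_split (bigD1 q) //= big1 ?addr0 => [|q' /negPf qq].
  rewrite !comp_lfunE /= (spr_id vq) addbF addbT spr_add //.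
by rewrite !comp_lfunE /= (spr_part _ vq) qq !linear0 addr0.
Qed.
End Homogeneous.

Lemma tens2_ext (K : fieldType) (V : superspace K) (W Z : vectType K) (f g : 'Hom(tensT V (tensT V W), Z)) :
  (forall p q v w y, v \in ss_part V p -> w \in ss_part V q -> f (tens v (tens w y)) = g (tens v (tens w y))) -> f = g.
Proof.
move=> H; have H1 p v x : v \in ss_part V p -> f (tens v x) = g (tens v x).
  move=> vp; elim/tens_ind: x => [|c x y Hx Hy|i y].
  - by rewrite -[0](scale0r (0 : tensT V W)) tensZr !linearZ /= !scale0r.
  - by rewrite tensDr !linearP /= Hx Hy.
  rewrite -(spr_add false (bas V)`_i) tens_addl tens_addr !linearD /=.
  by rewrite !(H _ _ _ _ _ vp (spr_mem _ _)).
apply: tens_ext => v x; rewrite -(spr_add false v) tens_addl !linearD /=.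
by rewrite !(H1 _ _ _ (spr_mem _ _)).
Qed.

(** * Permutation diagrams acting on tensor powers *)

Lemma plus_true r i : nth true (plus r) i = true.
Proof. by rewrite nth_nseq; case: ifP. Qed.

Lemma perm_fix0 n (p : 'S_n.+1) : p ord0 = ord0 -> exists h : 'S_n, p = lift_perm ord0 ord0 h.
Proof.
move=> p0; have H i : exists j, p (lift ord0 i) = lift ord0 j.
  case: (unliftP ord0 (p (lift ord0 i))) => [j|]; first by exists j.
  by rewrite -[X in _ = X]p0 => /perm_inj/eqP; rewrite eq_sym (negPf (neq_lift _ _)).
have /fin_all_exists[f fE] := H.
have fI : injective f.
  by move=> i j E; apply: (@lift_inj _ ord0); apply: (@perm_inj _ p); rewrite !fE E.
exists (perm fI); apply/permP=> i; case: (unliftP ord0 i) => [j|] ->.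
  by rewrite lift_perm_lift permE.
by rewrite lift_perm_id.
Qed.
(** The stabiliser of 0 has two double cosets. Statements on permutation diagrams thus follow by
    induction from an added identity strand and one crossing of the first two strands. *)
Lemma perm_decomp n (p : 'S_n.+2) : exists h1 h2 : 'S_n.+1,
  p = lift_perm ord0 ord0 h1 \/
  p = (lift_perm ord0 ord0 h1 * tperm ord0 (lift ord0 ord0) * lift_perm ord0 ord0 h2)%g.
Proof.
case: (unliftP ord0 (p ord0)) => [j pj|/perm_fix0[h ->]]; last by exists h, h; left.
pose h2 := tperm ord0 j; pose q := (p * (lift_perm ord0 ord0 h2)^-1 * tperm ord0 (lift ord0 ord0))%g.
have [|h1 hE] := @perm_fix0 _ q; last first.
  by exists h1, h2; right; rewrite -hE /q -(mulgA _ (tperm _ _) (tperm _ _)) tperm2 mulg1 mulgKV.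
rewrite /q !permM pj.
have -> : (lift_perm ord0 ord0 h2)^-1%g (lift ord0 j) = lift ord0 ord0.
  by apply: (@perm_inj _ (lift_perm ord0 ord0 h2)); rewrite permKV lift_perm_lift /h2 tpermL.
by rewrite tpermR.
Qed.

Section Functor.
Variables (K : fieldType) (V : superspace K).
Variables (n : nat) (b : n.-tuple V) (d : 'I_n -> bool).
Hypotheses (basis_b : basis_of {:V} b) (homog_b : forall i : 'I_n, b`_i \in ss_part V (d i)).
Variable F : forall s t : seq bool, OB K s t -> 'Hom(tpow V s, tpow V t).
Hypothesis functorF : brauer_functor b d F.

Lemma F_linear s t : linear (@F s t). Proof. by have := rf_lin functorF (s := s) (t := t). Qed.
Lemma F0 s t : @F s t 0 = 0.
Proof. exact: lin0 (@F_linear s t). Qed.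
Lemma F_sum s t I (r : seq I) (P : pred I) (G : I -> OB K s t) (c : I -> K) :
  F (\sum_(i <- r | P i) c i *: G i) = \sum_(i <- r | P i) c i *: F (G i).
Proof. exact: (lin_comb (@F_linear s t)). Qed.

Lemma F_idl e s t (D : OB K s t) : F (ob_tens (ob_id K [:: e]) D) = tensop (\1%VF : 'End(ssign V e)) (F D).
Proof.
apply: tens_ext => v y; rewrite tensopE lfunE.
have := rf_tens functorF (ob_id K [:: e]) D (pure1 v) y.
by rewrite (rf_id functorF) lfunE !tcat_pure1.
Qed.
Lemma F_tens s t s' t' (f : OB K s t) (g : OB K s' t') x y :
  F (ob_tens f g) (tcat x y) = tcat (F f x) (F g y).
Proof. by have := rf_tens functorF f g x y. Qed.
Lemma F_comp s t u (f : OB K t u) (g : OB K s t) : F (ob_comp (sdim V) f g) = (F f \o F g)%VF.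
Proof. by have := rf_comp functorF f g. Qed.
Lemma F_X s p q (v w : V) (y : tpow V s) : v \in ss_part V p -> w \in ss_part V q ->
  F (ob_tens (ob_X K) (ob_id K s)) (tens v (tens w y) : tensT V (tensT V (tpow V s)))
  = (-1) ^+ (p && q) *: (tens w (tens v y) : tensT V (tensT V (tpow V s))).
Proof.
move=> vp wq; have := rf_tens functorF (ob_X K) (ob_id K s) (@pure2 K V true true v w) y.
rewrite (rf_X functorF vp wq) (rf_id functorF) lfunE => H.
have E v' w' : @tcat K V [:: true; true] s (@pure2 K V true true v' w') y = tens v' (tens w' y).
  exact: tcat_pure2.
move: H; rewrite E => ->.
by rewrite (linZ (@tcat_linear K V [:: true; true] s y)) E.
Qed.

Definition Fperm r (p : 'S_(size (plus r))) : 'End(tpow V (plus r)) := F (ob_permS K p).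
Lemma Fperm1 r : Fperm (r := r) 1 = \1%VF.
Proof. by rewrite /Fperm (ob_permS1 K (@plus_true r)) (rf_id functorF). Qed.
Lemma FpermM r (p q : 'S_(size (plus r))) : Fperm (q * p)%g = (Fperm p \o Fperm q)%VF.
Proof. by rewrite /Fperm -(ob_permS_comp (@plus_true r) (sdim V)) F_comp. Qed.
Lemma Fperm_lift r (p : 'S_(size (plus r))) :
  @Fperm r.+1 (lift_perm ord0 ord0 p) = tensop (\1%VF : 'End(V)) (Fperm p).
Proof. by rewrite /Fperm -(F_idl true) (ob_perm_lift K (@plus_true r)). Qed.
Definition s01 r : 'S_(size (plus r.+2)) := tperm ord0 (lift ord0 ord0).
Lemma Fperm_s01 r p q (v w : V) (y : tpow V (plus r)) : v \in ss_part V p -> w \in ss_part V q ->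
  Fperm (s01 r) (tens v (tens w y) : tensT V (tensT V (tpow V (plus r))))
  = (-1) ^+ (p && q) *: (tens w (tens v y) : tensT V (tensT V (tpow V (plus r)))).
Proof. by move=> vp wq; rewrite /Fperm /s01 -(ob_X_id K (@plus_true r)); apply: F_X. Qed.
End Functor.

HB.instance Definition _ (K : fieldType) (U W : vectType K) (u : U) :=
  GRing.isLinear.Build K W (tensT U W) *:%R (tens u) (tensDr u).

Section Words.
Variables (K : fieldType) (V : superspace K).
Variables (n : nat) (b : n.-tuple V).
Hypothesis basis_b : basis_of {:V} b.

(** The basis tensor of the word [w]; [ed] below is the matching coordinate form. *)
Fixpoint ew r : ('I_(size (plus r)) -> 'I_n) -> tpow V (plus r) :=
  match r return ('I_(size (plus r)) -> 'I_n) -> tpow V (plus r) with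
  | 0 => fun _ => (1 : K^o)
  | r'.+1 => fun w => tens (b`_(w ord0) : V) (ew (fun i => w (lift ord0 i)))
  end.
Fixpoint ed r : ('I_(size (plus r)) -> 'I_n) -> 'Hom(tpow V (plus r), K^o) :=
  match r return ('I_(size (plus r)) -> 'I_n) -> 'Hom(tpow V (plus r), K^o) with
  | 0 => fun _ => \1%VF
  | r'.+1 => fun w => tensf (linfun (coord b (w ord0) : V -> K^o)) (ed (fun i => w (lift ord0 i)))
  end.

Lemma eq_ew r (w w' : 'I_(size (plus r)) -> 'I_n) : w =1 w' -> ew w = ew w'.
Proof.
elim: r w w' => [//|r IHr] w w' E /=; rewrite E; congr tens.
by apply: IHr => i; rewrite E.
Qed.
Lemma coord_b (i j : 'I_n) : coord b i b`_j = (i == j)%:R.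
Proof. by rewrite coord_free 1?eq_sym //; apply: basis_free basis_b. Qed.
Lemma ed_ew r (w : 'I_(size (plus r)) -> 'I_n) : ed w (ew w) = 1.
Proof.
elim: r w => [|r IHr] w /=; first by rewrite lfunE.
by rewrite tensfE IHr lfunE /= coord_b eqxx mulr1.
Qed.
Lemma ed_ew0 r (w w' : 'I_(size (plus r)) -> 'I_n) x : w x != w' x -> ed w (ew w') = 0.
Proof.
elim: r w w' x => [|r IHr] w w' x; first by case: x.
rewrite /= tensfE lfunE /= coord_b; case: (unliftP ord0 x) => [y|] -> xx; last by rewrite (negPf xx) mul0r.
by rewrite (IHr (fun i => w (lift ord0 i)) (fun i => w' (lift ord0 i)) y xx) mulr0.
Qed.
Definition fcons r (i : 'I_n) (w : 'I_(size (plus r)) -> 'I_n) : 'I_(size (plus r.+1)) -> 'I_n :=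
  fun x => if unlift ord0 x is Some y then w y else i.
Lemma ew_fcons r i (w : 'I_(size (plus r)) -> 'I_n) : ew (fcons i w) = tens (b`_i : V) (ew w).
Proof.
rewrite /= /fcons unlift_none; congr tens; apply: eq_ew => x; by rewrite liftK.
Qed.
Lemma ew_ext r (W : vectType K) (f g : 'Hom(tpow V (plus r), W)) : (forall w, f (ew w) = g (ew w)) -> f = g.
Proof.
elim: r W f g => [|r IHr] W f g H.
  apply/lfunP=> x; have E : x = (x : K) *: (1 : K^o) by rewrite /GRing.scale /= mulr1.
  (* The empty word must be exhibited as a function into ['I_n], a type that is empty when V = 0. *)
  by rewrite E !lfZ; congr (_ *: _); have [w _|/= N] := pickP (fun w : {ffun 'I_(size (plus 0)) -> 'I_n} => true); [exact: (H w)|have := N [ffun x : 'I_0 => False_rect _ (notF (ltn_ord x))]].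
apply: tens_ext => v y; rewrite [v](coord_basis basis_b) ?memvf // !tens_suml !lf_sum.
apply: eq_bigr => i _; rewrite tensZl !lfZ; congr (_ *: _).
have := IHr _ (f \o linfun (tens (b`_i : V)))%VF (g \o linfun (tens (b`_i : V)))%VF.
move=> E; have /lfunP/(_ y) : (f \o linfun (tens (b`_i : V)) = g \o linfun (tens (b`_i : V)))%VF.
  by apply: E => w; rewrite !comp_lfunE !lfunE /= -ew_fcons.
by rewrite !comp_lfunE !lfunE.
Qed.
End Words.

Section Theta.
Variables (K : fieldType) (s : seq bool).
Notation KG := (galg K {perm 'I_(size s)}).
(* The inverse accounts for [p * q] being [p] followed by [q], whereas [ob_comp] stacks its second
   argument below the first. *)
Definition theta (x : KG) : OB K s s := \sum_p x p *: ob_permS K p^-1%g.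
Lemma theta_linear : linear theta.
Proof.
move=> c x y; rewrite /theta scaler_sumr -big_split; apply: eq_bigr => p _.
by rewrite galgD galgZ scalerDl scalerA.
Qed.
Lemma theta_dl p : theta (dl K p) = ob_permS K p^-1%g.
Proof.
rewrite /theta (bigD1 p) //= dlE eqxx scale1r big1 ?addr0 // => q /negPf qp.
by rewrite dlE qp scale0r.
Qed.
Lemma theta0 : theta 0 = 0.
Proof. exact: lin0 theta_linear. Qed.
Lemma thetaZ c x : theta (c *: x) = c *: theta x.
Proof. exact: linZ theta_linear _ _. Qed.
Lemma theta_sum I (r : seq I) (P : pred I) (G : I -> KG) :
  theta (\sum_(i <- r | P i) G i) = \sum_(i <- r | P i) theta (G i).
Proof. exact: (lin_sum theta_linear). Qed.
Hypothesis strue : forall i, nth true s i = true.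
Variable delta : K.
Lemma thetaM x y : theta (x * y) = ob_comp delta (theta x) (theta y).
Proof.
apply: (@galg_lin_ext _ _ _ (fun x => theta (x * y)) (fun x => ob_comp delta (theta x) (theta y))).
- by move=> c x1 x2; rewrite mulrDl -scalerAl theta_linear.
- by move=> c x1 x2; rewrite theta_linear ob_comp_linearl.
move=> p; apply: (@galg_lin_ext _ _ _ (fun y => theta (dl K p * y)) (fun y => ob_comp delta (theta (dl K p)) (theta y))).
- by move=> c x1 x2; rewrite mulrDr -scalerAr theta_linear.
- by move=> c x1 x2; rewrite theta_linear ob_comp_linearr.
by move=> q; rewrite -dlM !theta_dl (ob_permS_comp strue) invMg.
Qed.
End Theta.

Section Action.
Variables (K : fieldType) (V : superspace K).
Variables (n : nat) (b : n.-tuple V) (d : 'I_n -> bool).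
Hypotheses (basis_b : basis_of {:V} b) (homog_b : forall i : 'I_n, b`_i \in ss_part V (d i)).
Variable F : forall s t : seq bool, OB K s t -> 'Hom(tpow V s, tpow V t).
Hypothesis functorF : brauer_functor b d F.
Notation FP := (Fperm F).
Notation ew := (ew b).
Notation ed := (ed b).

(** The sign is left unspecified: it either cancels or is irrelevant, and [Fperm_tperm] computes the
    only ones needed. *)
Definition mono r (p : 'S_(size (plus r))) := forall w, exists e : bool,
  FP p (ew w) = (-1) ^+ e *: ew (fun i => w (p^-1%g i)).
Lemma mono1 r : mono (r := r) 1.
Proof.
move=> w; exists false; rewrite (Fperm1 functorF) lfunE expr0 scale1r; apply: eq_ew => i.
by rewrite invg1 perm1.
Qed.
Lemma monoM r (p q : 'S_(size (plus r))) : mono p -> mono q -> mono (p * q)%g.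
Proof.
move=> mp mq w; have [e1 E1] := mp w; have [e2 E2] := mq (fun i => w (p^-1%g i)).
exists (e1 (+) e2); rewrite (FpermM functorF) comp_lfunE E1 lfZ E2 scalerA signr_addb.
by congr (_ *: _); apply: eq_ew => i; rewrite invMg permM.
Qed.
Lemma mono_lift r (p : 'S_(size (plus r))) : mono p -> @mono r.+1 (lift_perm ord0 ord0 p).
Proof.
move=> mp w; have [e E] := mp (fun i => w (lift ord0 i)); exists e.
rewrite (Fperm_lift functorF) /= tensopE E tensZr lfunE /=; congr (_ *: tens _ _).
  by rewrite lift_permV lift_perm_id.
by apply: eq_ew => i; rewrite lift_permV lift_perm_lift.
Qed.
Lemma Fperm_s01_ew r w : FP (s01 r) (ew w) = (-1) ^+ (d (w ord0) && d (w (lift ord0 ord0))) *: ew (fun i => w (s01 r i)).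
Proof.
rewrite [ew w]/= (Fperm_s01 functorF _ (homog_b _) (homog_b _)) /=; congr (_ *: tens _ (tens _ _)).
- by rewrite /s01 tpermL.
- by rewrite /s01 tpermR.
- by apply: eq_ew => i; rewrite /s01 tpermD // -(inj_eq val_inj).
Qed.
Lemma Fperm_mono r (p : 'S_(size (plus r))) : mono p.
Proof.
elim: r p => [|[|r] IHr] p.
- by have -> : p = 1%g; [apply/permP=> -[]|exact: mono1].
- have [|h ->] := @perm_fix0 _ p; first by case: (p ord0) => -[|//] ?; apply: val_inj.
  exact: mono_lift.
have ms : mono (s01 r).
  by move=> w; rewrite Fperm_s01_ew; eexists; congr (_ *: _); apply: eq_ew => i; rewrite tpermV.
by case: (perm_decomp p) => h1 [h2 [->|->]]; do ?apply: monoM => //; apply: mono_lift.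
Qed.

Lemma perm01 r (x y : 'I_r.+2) : x != y -> exists g : 'S_r.+2, g ord0 = x /\ g (lift ord0 ord0) = y.
Proof.
move=> xy; pose g0 := tperm (ord0 : 'I_r.+2) x; pose z := g0 (lift ord0 ord0).
have g00 : g0 ord0 = x by exact: tpermL.
exists (g0 * tperm z y)%g; split; rewrite permM; last by rewrite -/z tpermL.
have zx : z != x by rewrite -g00 /z (inj_eq perm_inj) eq_sym neq_lift.
by rewrite g00 tpermD // eq_sym.
Qed.
(** Conjugation moves [x] and [y] to the first two places, where the crossing is known. The unknown
    sign of the conjugating permutation enters twice and cancels. *)
Lemma Fperm_tperm r (x y : 'I_(size (plus r))) w : x != y -> w x = w y ->
  FP (tperm x y) (ew w) = (-1) ^+ d (w x) *: ew w.
Proof.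
case: r x y w => [|[|r]] x y w xy wxy; first by case: x {xy wxy}.
  by case/eqP: xy; apply: val_inj; case: x {wxy} => -[|//] ?; case: y => -[|//] ?.
have [g [gx gy]] : exists g : 'S_(size (plus r.+2)), g ord0 = x /\ g (lift ord0 ord0) = y.
  exact: perm01.
have -> : tperm x y = (g^-1 * (s01 r * g))%g by rewrite -gx -gy -tpermJ.
rewrite !(FpermM functorF) !comp_lfunE.
have [e E] := @Fperm_mono r.+2 g^-1%g w; rewrite E !lfZ Fperm_s01_ew !invgK gx gy -wxy andbb lfZ.
rewrite !scalerA mulrC -scalerA; congr (_ *: _).
rewrite (_ : ew _ = ew (fun i => w (g i))); last first.
  by apply: eq_ew => i; rewrite /s01; case: tpermP => [->|->|//]; rewrite gx gy wxy.
have -> : ew (fun i => w (g i)) = (-1) ^+ e *: FP g^-1%g (ew w).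
  by rewrite E scalerA -signr_addb addbb scale1r invgK.
rewrite lfZ scalerA -signr_addb addbb scale1r -comp_lfunE -(FpermM functorF) mulVg.
by rewrite (Fperm1 functorF) lfunE.
Qed.

Section Rho.
Variable r : nat.
Notation KG := (galg K {perm 'I_(size (plus r))}).
Definition rho (x : KG) : 'End(tpow V (plus r)) := F (theta x).
Lemma rho_linear : linear rho.
Proof. by move=> c x y; rewrite /rho theta_linear (F_linear functorF). Qed.
Lemma rhoM x y : rho (x * y) = (rho x \o rho y)%VF.
Proof. by rewrite /rho (thetaM (@plus_true r) (sdim V)) (F_comp functorF). Qed.
Lemma rho_dl p : rho (dl K p) = FP p^-1%g.
Proof. by rewrite /rho theta_dl. Qed.
Lemma rho1 : rho 1 = \1%VF.
Proof. by rewrite -dl1 rho_dl invg1 (Fperm1 functorF). Qed.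
Lemma rhoD x y : rho (x + y) = rho x + rho y.
Proof. exact: linD rho_linear _ _. Qed.
Lemma rhoZ c x : rho (c *: x) = c *: rho x.
Proof. exact: linZ rho_linear _ _. Qed.
Lemma rho0 : rho 0 = 0. Proof. exact: lin0 rho_linear. Qed.
Lemma rho_sum I (s : seq I) (P : pred I) (G : I -> KG) :
  rho (\sum_(i <- s | P i) G i) = \sum_(i <- s | P i) rho (G i).
Proof. exact: (lin_sum rho_linear). Qed.
Lemma rho_expand x : rho x = \sum_p x p *: rho (dl K p).
Proof. by rewrite {1}[x]galg_expand rho_sum; apply: eq_bigr => p _; rewrite rhoZ. Qed.

Section Word.
Variable w : 'I_(size (plus r)) -> 'I_n.
(* The sign by which the stabiliser of the word w acts on the tensor [ew w]. *)
Definition eps p : K := ed w (rho (dl K p) (ew w)).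
Lemma epsP p : p \in stab w -> eps p * eps p = 1 /\ rho (dl K p) (ew w) = eps p *: ew w.
Proof.
move=> pw; rewrite /eps rho_dl; have [e ->] := Fperm_mono p^-1%g w; rewrite lfZ invgK.
rewrite (eq_ew b (stabP _ _ pw : (fun i => w (p i)) =1 w)) (ed_ew basis_b) /GRing.scale /= mulr1.
by rewrite -signr_addb addbb.
Qed.
Lemma epsM p q : p \in stab w -> q \in stab w -> eps (p * q)%g = eps p * eps q.
Proof.
move=> pw qw; have [_ pE] := epsP pw; have [_ qE] := epsP qw.
rewrite {1}/eps dlM rhoM comp_lfunE qE lfZ pE !lfZ (ed_ew basis_b).
by rewrite /GRing.scale /= mulr1 mulrC.
Qed.
Lemma eps1 : eps 1 = 1.
Proof. by rewrite /eps dl1 rho1 lfunE (ed_ew basis_b). Qed.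
Lemma epsV p : p \in stab w -> eps p^-1%g = eps p.
Proof.
move=> pw; have [pp _] := epsP pw; have := epsM pw (stabV pw); rewrite mulgV eps1.
by move/(congr1 (fun z => eps p * z)); rewrite mulr1 mulrA pp mul1r => <-.
Qed.
Lemma eps_tperm x y : x != y -> w x = w y -> eps (tperm x y) = (-1) ^+ d (w x).
Proof.
move=> xy wxy; rewrite /eps rho_dl tpermV Fperm_tperm // lfZ (ed_ew basis_b).
by rewrite /GRing.scale /= mulr1.
Qed.

(** Up to the factor [#|stab w|], the idempotent of the sign character [eps] of the stabiliser of
    [w]. *)
Definition wsum : KG := \sum_(p in stab w) eps p *: dl K p.
Lemma wsum_mull p : p \in stab w -> dl K p * wsum = eps p *: wsum.
Proof.
move=> pw; rewrite mulr_sumr scaler_sumr [RHS](reindex_inj (mulgI p)) /=.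
apply: eq_big => q; rewrite ?stabMl // => qw; rewrite -scalerAr -dlM scalerA epsM // mulrA.
by rewrite (epsP pw).1 mul1r.
Qed.
Lemma wsum_mulr p : p \in stab w -> wsum * dl K p = eps p *: wsum.
Proof.
move=> pw; rewrite mulr_suml scaler_sumr [RHS](reindex_inj (mulIg p)) /=.
apply: eq_big => q; rewrite ?stabMr // => qw; rewrite -scalerAl -dlM scalerA epsM // mulrCA.
by rewrite (epsP pw).1 mulr1.
Qed.
Lemma wsum_ew : rho wsum (ew w) = #|stab w|%:R *: ew w.
Proof.
rewrite rho_sum sum_lfunE (eq_bigr (fun=> ew w)) ?sumr_const ?scaler_nat // => p pw.
by rewrite rhoZ scale_lfunE (epsP pw).2 scalerA (epsP pw).1 scale1r.
Qed.
Lemma wsum_hook : hook_vec w d wsum.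
Proof. by move=> x y xy wxy; rewrite wsum_mull ?stab_tperm // eps_tperm. Qed.
Lemma hook_vec_stab (v : KG) p : hook_vec w d v -> p \in stab w -> dl K p * v = eps p *: v.
Proof.
move=> wv pw; suff: p \in stab w /\ dl K p * v = eps p *: v by case.
move: p pw; apply: stab_ind => [|p q [pw pE] [qw qE]|x y wxy].
- by split; [exact: stab1|rewrite eps1 dl1 mul1r scale1r].
- by split; [exact: stabM|rewrite dlM -mulrA qE -scalerAr pE scalerA epsM // mulrC].
split; first exact: stab_tperm.
have [->|xy] := eqVneq x y; first by rewrite tperm1 eps1 dl1 mul1r scale1r.
by rewrite wv // eps_tperm.
Qed.
Lemma wsum_hook_vec (v : KG) : hook_vec w d v -> wsum * v = #|stab w|%:R *: v.
Proof.
move=> wv; rewrite mulr_suml (eq_bigr (fun=> v)) ?sumr_const ?scaler_nat // => p pw.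
by rewrite -scalerAl (hook_vec_stab wv pw) scalerA (epsP pw).1 scale1r.
Qed.

Hypothesis charK : [pchar K] =i pred0.
(** On a coset of the stabiliser the coefficients of [x * wsum] vary by the same signs as the images
    of the basis tensor. So they add up without cancellation: the coefficient of the word [w]
    composed with [g0] is, up to sign, [#|stab w|] times the value at [g0]. *)
Lemma wsum_faithful x : rho (x * wsum) (ew w) = 0 -> x * wsum = 0.
Proof.
set c := x * wsum => c0; apply/ffunP=> g0; rewrite [RHS]ffunE; apply/eqP/negPn/negP=> cg.
have cE h : h \in stab w -> c (g0 * h)%g = eps h * c g0.
  move=> hw; have := wsum_mulr (stabV hw); rewrite epsV // => /(congr1 (fun z => x * z)).
  by rewrite mulrA -scalerAr -/c => /ffunP/(_ g0); rewrite mulr_dlE invgK galgZ.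
have [e gE] : exists e : bool, rho (dl K g0) (ew w) = (-1) ^+ e *: ew (fun i => w (g0 i)).
  by rewrite rho_dl; have [e E] := Fperm_mono g0^-1%g w; exists e; rewrite E invgK.
have := congr1 (ed (fun i => w (g0 i))) c0.
rewrite lf0 rho_expand sum_lfunE lf_sum (bigID (fun g => (g0^-1 * g)%g \in stab w)) /=.
rewrite [X in _ + X]big1 ?addr0 => [|g gw]; last first.
  rewrite scale_lfunE lfZ rho_dl; have [e' ->] := Fperm_mono g^-1%g w; rewrite lfZ invgK.
  have /existsP[y yP] : [exists y, w ((g0^-1 * g)%g y) != w y].
    by move: gw; rewrite inE -negb_forall.
  rewrite (ed_ew0 basis_b (x := g0^-1%g y)) ?scaler0 //; move: yP; rewrite permM permKV eq_sym //.
rewrite (reindex_inj (mulgI g0)) /= (eq_big (fun g => g \in stab w) (fun=> c g0 * (-1) ^+ e)).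
- rewrite sumr_const -mulr_natl => /eqP; rewrite !mulf_eq0 (negPf (card_stab_neq0 charK _)).
  by rewrite (negPf cg) signr_eq0.
- by move=> g; rewrite mulKg.
- move=> g; rewrite mulKg => gw; rewrite scale_lfunE dlM rhoM comp_lfunE (epsP gw).2 !lfZ gE.
  rewrite !lfZ (ed_ew basis_b) cE // /GRing.scale /= mulr1 !mulrA.
  by rewrite [eps g * _]mulrC -(mulrA (c g0)) (epsP gw).1 mulr1.
Qed.
End Word.
End Rho.
End Action.

(** * The kernel of the group algebra on tensor powers *)

Lemma eq_ext_perm (T T' : finType) (io io' : T -> T') (ioI : injective io) (ioI' : injective io') p :
  io =1 io' -> ext_perm ioI p = ext_perm ioI' p.
Proof.
move=> E; apply/permP=> z; case: (io_case io z) => [[u ->]|H]; first by rewrite ext_permE !E ext_permE.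
by rewrite !ext_perm_out // => u; rewrite -E.
Qed.
Lemma eq_young (K : fieldType) (T T' : finType) (C D : eqType) (c : T -> C) (f : T -> D)
  (io io' : T -> T') (ioI : injective io) (ioI' : injective io') :
  io =1 io' -> young K c f ioI = young K c f ioI'.
Proof.
move=> E; rewrite /young /rsum /csum; congr (_ * _); apply: eq_bigr => p _.
  by rewrite /dl_ext (eq_ext_perm _ ioI').
by rewrite /dl_ext (eq_ext_perm _ ioI').
Qed.

Section Letters.
Variables (K : fieldType) (V : superspace K) (m l : nat).
Hypotheses (dimV0 : \dim (ss_part V false) = m) (dimV1 : \dim (ss_part V true) = l).
Variables (n : nat) (b : n.-tuple V) (d : 'I_n -> bool).
Hypotheses (basis_b : basis_of {:V} b) (homog_b : forall i : 'I_n, b`_i \in ss_part V (d i)).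

Lemma dim_n : n = (m + l)%N.
Proof.
rewrite -dimV0 -dimV1 -dimv_disjoint_sum ?ss_direct // ss_full.
by rewrite (size_basis basis_b).
Qed.
(** In each degree the homogeneous basis vectors are free, so there are at most as many as the
    dimension; both counts add up to [n]. *)
Lemma card_letters p : #|[set i | d i == p]| = \dim (ss_part V p).
Proof.
have le q : (#|[set i | d i == q]| <= \dim (ss_part V q))%N.
  pose bn := fun i : 'I_n => b`_i; pose s := [seq bn i | i <- rowseq d q].
  have fs : free s.
    apply: (@catl_free _ _ [seq bn i | i <- [seq i <- enum 'I_n | predC (fun i => d i == q) i]] s).
    have bE : [seq bn i | i <- enum 'I_n] = b.
      apply: (@eq_from_nth _ 0) => [|i]; rewrite size_map size_enum_ord ?size_tuple // => lt.
      by rewrite (nth_map (Ordinal lt)) ?size_enum_ord // /bn nth_enum_ord.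
    rewrite -map_cat (perm_free (Y := [seq bn i | i <- enum 'I_n])); first by rewrite bE (basis_free basis_b).
    by apply: perm_map; rewrite perm_filterC.
  rewrite -[#|_|]/(rowsize d q) -size_rowseq -(size_map bn) -/s -(eqP fs); apply: dimvS.
  apply/span_subvP => v /mapP[i]; rewrite mem_rowseq => /eqP <- ->; exact: homog_b.
apply/eqP; rewrite eqn_leq le /= leqNgt; apply/negP=> lt.
have : (#|[set i | d i == p]| + #|[set i | d i == ~~ p]| < \dim (ss_part V p) + \dim (ss_part V (~~ p)))%N.
  by rewrite -addSn leq_add.
have -> : (\dim (ss_part V p) + \dim (ss_part V (~~ p)) = n)%N.
  by rewrite dim_n; case: p {lt}; rewrite dimV0 dimV1 // addnC.
have -> : (#|[set i | d i == p]| + #|[set i | d i == ~~ p]| = n)%N; last by rewrite ltnn.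
transitivity #|{: 'I_n}|; last exact: card_ord.
rewrite -(cardsC [set i | d i == p]); congr (_ + _)%N; apply: eq_card => i.
by rewrite !inE; case: (d i); case: (p).
Qed.

Lemma letters_bij : exists (ka : 'I_n -> 'I_m + 'I_l) (ka' : 'I_m + 'I_l -> 'I_n),
  [/\ cancel ka ka', cancel ka' ka & forall a, d (ka' a) = @oddl m l a].
Proof.
have c0 := esym (etrans (card_letters false) dimV0); have c1 := esym (etrans (card_letters true) dimV1).
pose ka' (a : 'I_m + 'I_l) : 'I_n :=
  match a with inl i => enum_val (cast_ord c0 i) | inr j => enum_val (cast_ord c1 j) end.
have dka a : d (ka' a) = @oddl m l a.
  case: a => i /=; first by have := enum_valP (cast_ord c0 i); rewrite inE => /eqP.
  by have := enum_valP (cast_ord c1 i); rewrite inE => /eqP.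
have kaI : injective ka'.
  move=> a a' E; have := congr1 d E; rewrite !dka.
  case: a a' E => i [j|j] //= /enum_val_inj/cast_ord_inj-> //.
have [|ka kaK kaK'] := inj_card_bij kaI; first by rewrite card_sum !card_ord dim_n.
by exists ka, ka'; split.
Qed.
End Letters.

Section Kernel.
Variables (K : fieldType) (charK : [pchar K] =i pred0) (V : superspace K) (m l : nat).
Hypotheses (dimV0 : \dim (ss_part V false) = m) (dimV1 : \dim (ss_part V true) = l).
Variables (n : nat) (b : n.-tuple V) (d : 'I_n -> bool).
Hypotheses (basis_b : basis_of {:V} b) (homog_b : forall i : 'I_n, b`_i \in ss_part V (d i)).
Variable F : forall s t : seq bool, OB K s t -> 'Hom(tpow V s, tpow V t).
Hypothesis functorF : brauer_functor b d F.
Variable r : nat.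
Notation T := 'I_(size (plus r)).
Notation KG := (galg K {perm T}).
Notation rho := (@rho K V F r).
Notation ew := (@ew K V n b r).
Notation wsum := (@wsum K V n b F r).
Let rhoM' := rhoM functorF.

Lemma hook_vec_comp (C C' : eqType) (w : T -> C) (o : C -> bool) (f : C -> C') (f' : C' -> C) (o' : C' -> bool) v :
  cancel f f' -> (forall c, o' (f c) = o c) -> hook_vec w o v -> hook_vec (f \o w) o' (v : KG).
Proof. by move=> fK oo wv x y xy /= /(can_inj fK) wxy; rewrite wv // oo. Qed.
Lemma hook_vec_mulr (C : eqType) (w : T -> C) (o : C -> bool) (v u : KG) : hook_vec w o v -> hook_vec w o (v * u).
Proof. by move=> wv x y xy wxy; rewrite mulrA wv // -scalerAl. Qed.

(** If the element z moved the tensor of a word [w], then z * wsum would be nonzero. Writing z *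
    wsum * y * z * wsum = z * wsum, the factor wsum * y * z has the symmetry of [w] and lies in the
    left ideal of z, so [rect_hook_vec0] makes it 0. *)
Lemma rho_rect (t : T -> 'I_m.+1) (cc : T -> 'I_l.+1) : (forall i, rowsize t i = l.+1) ->
  rho (rsum (dl K (gT := {perm T})) t * csum (dl K (gT := {perm T})) cc) = 0.
Proof.
move=> tsize; set z := _ * _; apply: (ew_ext basis_b) => w; rewrite zero_lfunE.
apply/eqP/negPn/negP=> zw.
have zs0 : z * wsum w != 0.
  apply/eqP=> /(congr1 (fun x => rho x (ew w))); rewrite rhoM' comp_lfunE (wsum_ew basis_b homog_b functorF) lfZ.
  rewrite (rho0 functorF) zero_lfunE => /eqP; rewrite scaler_eq0 (negPf zw).
  by rewrite (negPf (card_stab_neq0 charK _)).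
have [y yE] := galg_regular charK (z * wsum w).
have [ka [ka' [kaK kaK' dka]]] := letters_bij dimV0 dimV1 basis_b homog_b.
have hv : hook_vec (ka \o w) (@oddl m l) (wsum w * y * z).
  rewrite -mulrA; apply: hook_vec_mulr; apply: (hook_vec_comp (f' := ka') (o := d)) => //.
    by move=> c; rewrite -dka kaK.
  exact: (wsum_hook basis_b homog_b functorF).
have v0 : wsum w * y * z = 0 by apply: (rect_hook_vec0 charK tsize) hv.
case/eqP: zs0; rewrite -yE.
by have -> : z * wsum w * y * (z * wsum w) = z * (wsum w * y * z) * wsum w; [rewrite !mulrA|rewrite v0 mulr0 mul0r].
Qed.

Notation B := ('I_m.+1 * 'I_l.+1)%type.
(** A finite family, so that the ideal is a subspace: a placement of the rectangle with translations
    on both sides. Placements that are not injective contribute 0. *)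
Definition rect_gen (u : {ffun B -> T} * {perm T} * {perm T}) : KG :=
  if @injectiveP _ _ u.1.1 is ReflectT io then dl K u.1.2 * young K fst snd io * dl K u.2 else 0.
Definition rect_ideal : {vspace KG} := (\sum_u <[rect_gen u]>)%VS.

Lemma rect_idealP x : x \in rect_ideal -> exists k, x = \sum_u k u *: rect_gen u.
Proof.
case/memv_sumP=> xs xsP ->.
have /fin_all_exists[k kP] : forall u, exists k, xs u = k *: rect_gen u.
  by move=> u; apply/vlineP/xsP.
by exists k; apply: eq_bigr => u _; rewrite kP.
Qed.
Lemma rect_gen_in u : rect_gen u \in rect_ideal.
Proof. by rewrite /rect_ideal (bigD1 u) //=; apply: (subvP (addvSl _ _)); apply: memv_line. Qed.
Lemma rect_ideal_mull g x : x \in rect_ideal -> dl K g * x \in rect_ideal.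
Proof.
case/rect_idealP=> k ->; rewrite mulr_sumr memv_suml // => u _; rewrite -scalerAr memvZ //.
have <- : rect_gen (u.1.1, (g * u.1.2)%g, u.2) = dl K g * rect_gen u; last exact: rect_gen_in.
rewrite /rect_gen /=; case: injectiveP => io; last by rewrite mulr0.
by rewrite dlM !mulrA.
Qed.
Lemma rect_ideal_mulr g x : x \in rect_ideal -> x * dl K g \in rect_ideal.
Proof.
case/rect_idealP=> k ->; rewrite mulr_suml memv_suml // => u _; rewrite -scalerAl memvZ //.
have <- : rect_gen (u.1.1, u.1.2, (u.2 * g)%g) = rect_gen u * dl K g; last exact: rect_gen_in.
rewrite /rect_gen /=; case: injectiveP => io; last by rewrite mul0r.
by rewrite dlM !mulrA.
Qed.
Lemma rect_ideal_young (f : {ffun B -> T}) (io : injective f) : young K fst snd io \in rect_ideal.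
Proof.
have := rect_gen_in (f, 1%g, 1%g); rewrite /rect_gen /=; case: injectiveP => // io'.
by rewrite dl1 mul1r mulr1 (eq_young _ _ _ _ io).
Qed.
Lemma rect_ideal_mulgl z x : x \in rect_ideal -> z * x \in rect_ideal.
Proof.
move=> xI; rewrite [z]galg_expand mulr_suml memv_suml // => g _; rewrite -scalerAl memvZ //.
exact: rect_ideal_mull.
Qed.
Lemma rect_ideal_mulgr z x : x \in rect_ideal -> x * z \in rect_ideal.
Proof.
move=> xI; rewrite [z]galg_expand mulr_sumr memv_suml // => g _; rewrite -scalerAr memvZ //.
exact: rect_ideal_mulr.
Qed.

Lemma rho_ker x : rho x = 0 -> x \in rect_ideal.
Proof.
move=> x0; have [e eI eE] := left_ideal_idem charK rect_ideal_mull.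
suff : x - x * e = 0 by move/eqP; rewrite subr_eq0 => /eqP->; apply: rect_ideal_mulgl.
pose M v := rho v = 0 /\ forall z, z \in rect_ideal -> z * v = 0.
have My : M (x - x * e).
  split=> [|z zI]; last by rewrite mulrBr mulrA eE ?subrr // rect_ideal_mulgr.
  have -> : x - x * e = x * (1 - e) by rewrite mulrBr mulr1.
  by rewrite rhoM' x0 comp_lfun0l.
apply/eqP/negPn/negP=> y0.
have [||||w [v [[v0 _] vn wv]]] := @hook_vector K charK _ m l M _ _ _ _ _ My y0.
- move=> g v [v0 vI]; split=> [|z zI]; first by rewrite rhoM' v0 comp_lfun0r.
  by rewrite mulrA vI // rect_ideal_mulr.
- move=> v v' [v0 vI] [v0' vI']; split=> [|z zI]; first by rewrite (rhoD functorF) v0 v0' addr0.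
  by rewrite mulrDr vI // vI' // addr0.
- move=> a v [v0 vI]; split=> [|z zI]; first by rewrite (rhoZ functorF) v0 scaler0.
  by rewrite -scalerAr vI // scaler0.
- move=> io ioI v [_ vI].
  have fI : injective (finfun io) by move=> u u'; rewrite !ffunE => /ioI.
  by rewrite -(eq_young _ _ _ fI ioI (ffunE _)); apply/vI/rect_ideal_young.
have [ka [ka' [kaK kaK' dka]]] := letters_bij dimV0 dimV1 basis_b homog_b.
have wv' : hook_vec (ka' \o w) d v by apply: (hook_vec_comp (f' := ka) (o := @oddl m l)).
have sv := wsum_hook_vec basis_b homog_b functorF wv'.
(* As [rho v = 0], the element v * y * wsum acts by zero and so is 0 by [wsum_faithful]. But wsum *
   v is a nonzero multiple of [v], whence v = v y v = 0. *)
have [y yE] := galg_regular charK v.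
have c0 : v * y * wsum (ka' \o w) = 0.
  apply: (wsum_faithful basis_b homog_b functorF charK).
  by rewrite -mulrA rhoM' v0 comp_lfun0l zero_lfunE.
case/eqP: vn; apply: (scalerI (card_stab_neq0 charK (ka' \o w))); rewrite scaler0.
by rewrite -{1}yE scalerAr -sv mulrA c0 mul0r.
Qed.
End Kernel.

(** * Rectangular Young elements in the tensor ideal *)

Lemma inj_perm_ext (B T : finType) (io io' : B -> T) : injective io -> injective io' ->
  exists g : {perm T}, forall x, io' x = g (io x).
Proof.
move=> ioI ioI'.
(* Each image is completed to an enumeration of [T]; [h] below matches the two enumerations position
   by position. *)
pose s (f : B -> T) := codom f ++ [seq x <- enum T | x \notin codom f].
have sP f : injective f -> perm_eq (s f) (enum T).
  move=> fI; apply: uniq_perm; rewrite ?enum_uniq //.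
    rewrite cat_uniq (map_inj_uniq fI) enum_uniq filter_uniq ?enum_uniq // andbT.
    by apply/hasPn=> x; rewrite mem_filter => /andP[].
  by move=> x; rewrite mem_cat mem_filter !mem_enum !andbT orbN.
have us f : injective f -> uniq (s f) by move=> fI; rewrite (perm_uniq (sP _ fI)) enum_uniq.
have ss : size (s io) = size (s io') by rewrite !(perm_size (sP _ _)).
have ms f (fI : injective f) x : x \in s f by rewrite (perm_mem (sP _ fI)) mem_enum.
pose h x := nth x (s io') (index x (s io)).
have hI : injective h.
  move=> x y; have lt z : (index z (s io) < size (s io'))%N by rewrite -ss index_mem ms.
  rewrite /h (set_nth_default y) // => /eqP; rewrite nth_uniq ?us // => /eqP E.
  by rewrite -(nth_index x (ms io ioI x)) E nth_index // ms.
exists (perm hI) => x; rewrite permE /h /s index_cat nth_cat codom_f !codomE index_map // size_map.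
by rewrite index_mem mem_enum (nth_map x) ?index_mem ?mem_enum // nth_index ?mem_enum.
Qed.

Section ExtComp.
Variables (T1 T T' : finType).
Lemma ext_perm_comp (h : T1 -> T) (io : T -> T') (hI : injective h) (ioI : injective io)
  (iohI : injective (io \o h)) p : ext_perm iohI p = ext_perm ioI (ext_perm hI p).
Proof.
apply/permP=> z; case: (io_case io z) => [[u ->]|H]; last by rewrite !ext_perm_out // => u; apply: H.
rewrite ext_permE; case: (io_case h u) => [[y ->]|H]; first by rewrite (ext_permE iohI) ext_permE.
by rewrite (ext_perm_out _ _ H) ext_perm_out // => y; rewrite /= (inj_eq ioI).
Qed.
Lemma ext_perm_conj (io io' : T -> T') (ioI : injective io) (ioI' : injective io') (g : {perm T'}) p :
  (forall x, io' x = g (io x)) -> ext_perm ioI' p = (g^-1 * ext_perm ioI p * g)%g.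
Proof.
move=> gE; apply/permP=> z; rewrite !permM; case: (io_case io' z) => [[u ->]|H].
  by rewrite ext_permE !gE permK ext_permE.
by rewrite (ext_perm_out _ _ H) (ext_perm_out ioI) ?permKV // => y; rewrite -(inj_eq (@perm_inj _ g)) permKV -gE.
Qed.
End ExtComp.

Section Young.
Variables (K : fieldType) (T T' : finType) (C D : eqType) (c : T -> C) (f : T -> D).
Lemma young_conj (io io' : T -> T') (ioI : injective io) (ioI' : injective io') (g : {perm T'}) :
  (forall x, io' x = g (io x)) -> young K c f ioI' = dl K g^-1%g * young K c f ioI * dl K g.
Proof.
move=> gE; have E p : dl_ext K ioI' p = dl K g^-1%g * dl_ext K ioI p * dl K g.
  by rewrite /dl_ext (ext_perm_conj ioI _ _ gE) !dlM.
have -> : young K c f ioI' = (dl K g^-1%g * rsum (dl_ext K ioI) c * dl K g) * (dl K g^-1%g * csum (dl_ext K ioI) f * dl K g).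
  rewrite /young; congr (GRing.mul _ _); rewrite /rsum /csum mulr_sumr mulr_suml; apply: eq_bigr => p _; rewrite E //.
  by rewrite -scalerAr -scalerAl.
by rewrite /young !mulrA -(mulrA _ (dl K g)) -dlM mulgV dl1 mulr1.
Qed.

Lemma young_bij (T1 : finType) (io : T -> T') (ioI : injective io) (h : T1 -> T) (h' : T -> T1)
  (hK : cancel h h') (h'K : cancel h' h) (iohI : injective (io \o h)) :
  young K (c \o h) (f \o h) iohI = young K c f ioI.
Proof.
have hI := can_inj hK; have h'I := can_inj h'K.
have bij : bijective (ext_perm hI).
  exists (ext_perm h'I) => p; apply/permP=> x; first by rewrite -{1}[x]hK !ext_permE hK.
  by rewrite -{1}[x]h'K !ext_permE h'K.
have stE (E : eqType) (k : T -> E) p : (ext_perm hI p \in stab k) = (p \in stab (k \o h)).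
  apply/stabP/stabP => H x /=; first by rewrite -(ext_permE hI) H.
  by rewrite -[x]h'K ext_permE -[LHS]/((k \o h) _) H.
rewrite /young /rsum /csum; congr (_ * _); rewrite [RHS](reindex _ (onW_bij _ bij)).
  by apply: eq_big => p; rewrite ?stE // /dl_ext (ext_perm_comp hI ioI iohI).
by apply: eq_big => p; rewrite ?stE // /dl_ext (ext_perm_comp hI ioI iohI) odd_ext.
Qed.
End Young.

Section ThetaTens.
Variables (K : fieldType) (s s' : seq bool).
Hypotheses (strue : forall i, nth true s i = true) (strue' : forall i, nth true s' i = true).
Lemma lpos_inj : injective (@lpos s s').
Proof. by move=> i j /(congr1 val) /= /val_inj. Qed.
Lemma tens_ob_id p : ob_tens (ob_permS K p) (ob_id K s') = ob_permS K (ext_perm lpos_inj p).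
Proof.
rewrite -(ob_permS1 K strue'); apply: tens_perm => // i; first by rewrite ext_permE.
rewrite perm1 ext_perm_out // => j; apply/eqP=> /(congr1 val) /= E.
by have := ltn_ord j; rewrite E ltnNge leq_addr.
Qed.
End ThetaTens.

Lemma ext_permV (T T' : finType) (io : T -> T') (ioI : injective io) p :
  ext_perm ioI p^-1%g = (ext_perm ioI p)^-1%g.
Proof. by apply/(mulgI (ext_perm ioI p)); rewrite -ext_permM !mulgV ext_perm1. Qed.

Lemma theta_young (K : fieldType) s (T : finType) (C D : eqType) (c : T -> C) (f : T -> D)
  (io : T -> 'I_(size s)) (ioI : injective io) :
  theta (young K c f ioI) = \sum_(u | (u.1 \in stab c) && (u.2 \in stab f))
    (-1) ^+ odd_perm u.2 *: ob_permS K (ext_perm ioI (u.1 * u.2))^-1%g.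
Proof.
have -> : young K c f ioI = \sum_(p in stab c) \sum_(q in stab f) (-1) ^+ odd_perm q *: dl K (ext_perm ioI (p * q)).
  rewrite /young /rsum mulr_suml; apply: eq_bigr => p _; rewrite /csum mulr_sumr; apply: eq_bigr => q _.
  by rewrite -scalerAr /dl_ext ext_permM dlM.
rewrite pair_big theta_sum; apply: eq_bigr => u _; rewrite thetaZ theta_dl //.
Qed.

Lemma theta_young_tens (K : fieldType) s s' (T : finType) (C D : eqType) (c : T -> C) (f : T -> D)
  (io : T -> 'I_(size s)) (ioI : injective io) (ioI' : injective (@lpos s s' \o io)) :
  (forall i, nth true s i = true) -> (forall i, nth true s' i = true) ->
  ob_tens (theta (young K c f ioI)) (ob_id K s') = theta (young K c f ioI').
Proof.
move=> strue strue'; rewrite !theta_young.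
rewrite (lin_comb (ob_tens_linearl (ob_id K s'))); apply: eq_bigr => u _; congr (_ *: _).
by rewrite tens_ob_id // ext_permV (ext_perm_comp ioI (@lpos_inj s s')).
Qed.

Section Box.
Variables (K : fieldType) (m l : nat).
Notation T := 'I_(size (plus (rc m l))).
Definition brow (i : T) : 'I_m.+1 := inord (i %/ l.+1)%N.
Definition bcol (i : T) : 'I_l.+1 := inord (i %% l.+1)%N.
Fact box_lt (u : 'I_m.+1 * 'I_l.+1) : (u.1 * l.+1 + u.2 < rc m l)%N.
Proof.
apply: (@leq_trans (u.1.+1 * l.+1)); first by rewrite mulSn addnC ltn_add2r ltn_ord.
by rewrite leq_mul2r ltn_ord.
Qed.
Definition box u : T := cast_ord (esym (size_nseq (rc m l) true)) (Ordinal (box_lt u)).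
Lemma T_lt (i : T) : (i < m.+1 * l.+1)%N. Proof. by rewrite -[X in (_ < X)%N](size_nseq _ true) ltn_ord. Qed.
Lemma browE (i : T) : brow i = (i %/ l.+1)%N :> nat.
Proof. by rewrite inordK // ltn_divLR // T_lt. Qed.
Lemma bcolE (i : T) : bcol i = (i %% l.+1)%N :> nat.
Proof. by rewrite inordK // ltn_mod. Qed.
Lemma boxK : cancel box (fun i => (brow i, bcol i)).
Proof.
move=> [i j]; congr (_, _); apply: ord_inj; rewrite ?browE ?bcolE /=.
  by rewrite divnMDl // divn_small ?addn0.
by rewrite modnMDl modn_small.
Qed.
Lemma rcboxK : cancel (fun i => (brow i, bcol i)) box.
Proof. by move=> i; apply: ord_inj; rewrite /= browE bcolE -divn_eq. Qed.
Lemma row_stabE : row_stab m l = stab brow.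
Proof.
apply/setP=> p; rewrite !inE; apply: eq_forallb => i.
by rewrite -(inj_eq val_inj) /= !browE.
Qed.
Lemma col_stabE : col_stab m l = stab bcol.
Proof.
apply/setP=> p; rewrite !inE; apply: eq_forallb => i.
by rewrite -(inj_eq val_inj) /= !bcolE.
Qed.
Lemma rowsize_box i : rowsize brow i = l.+1.
Proof.
transitivity #|[set box (i, j) | j : 'I_l.+1]|; last first.
  by rewrite card_imset ?card_ord // => j j' /(can_inj boxK) [].
apply: eq_card => x; rewrite inE; apply/eqP/imsetP=> [<-|[j _ ->]]; first by exists (bcol x); rewrite ?rcboxK.
by have [] := boxK (i, j).
Qed.
(** [theta] inverts permutations, so both sums are reindexed by inversion, which preserves the
    stabilisers and the signs. *)
Lemma young_eE delta : young_e delta m l = theta (rsum (dl K (gT := {perm T})) brow * csum (dl K (gT := {perm T})) bcol).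
Proof.
rewrite (thetaM (@plus_true _) delta) /young_e row_stabE col_stabE /rsum /csum !theta_sum; congr ob_comp.
  rewrite (reindex_inj invg_inj); apply: eq_big => p; first by rewrite stabVE.
  by rewrite theta_dl.
rewrite (reindex_inj invg_inj); apply: eq_big => p; first by rewrite stabVE.
by rewrite thetaZ theta_dl odd_permV.
Qed.
Lemma young_id : young K brow bcol (@inj_id T) = rsum (dl K (gT := {perm T})) brow * csum (dl K (gT := {perm T})) bcol.
Proof.
have E p : dl_ext K (@inj_id T) p = dl K p.
  by congr dl; apply/permP=> x; rewrite -[x in LHS]/(id x) ext_permE.
by rewrite /young /rsum /csum; congr (GRing.mul _ _); apply: eq_bigr => p _; rewrite E.
Qed.

(** Permuting strands moves the rectangle to the first (m + 1)(l + 1) places, where its Young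
    element is the generator tensored with identity strands. *)
Lemma J_young delta s (io : 'I_m.+1 * 'I_l.+1 -> 'I_(size s)) (ioI : injective io) :
  (forall i, nth true s i = true) -> ideal_J delta m l (theta (young K fst snd ioI)).
Proof.
move=> strue; have rs : (rc m l <= size s)%N.
  by have := leq_card io ioI; rewrite card_prod !card_ord.
have sE : s = plus (rc m l) ++ plus (size s - rc m l).
  apply: (@eq_from_nth _ true) => [|i _]; first by rewrite size_cat !size_nseq subnKC.
  by rewrite strue cat_true // => j; apply: plus_true.
move: (size s - rc m l)%N sE => k sE; move: strue {rs}; subst s => strue.
pose io0 : 'I_m.+1 * 'I_l.+1 -> _ := (@lpos _ (plus k) \o id) \o box.
have ioI1 : injective (@lpos (plus (rc m l)) (plus k) \o id) by move=> x y /lpos_inj.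
have ioI0 : injective io0 by move=> x y /ioI1/(can_inj boxK).
have [g gE] := inj_perm_ext ioI0 ioI.
rewrite (young_conj K _ _ ioI0 ioI gE) 2!(thetaM strue delta).
apply: J_compr; apply: J_compl.
have -> : young K fst snd ioI0 = young K brow bcol ioI1.
  rewrite -(young_bij K brow bcol ioI1 boxK rcboxK ioI0) /young /rsum /csum.
  have br x : brow (box x) = x.1 := congr1 fst (boxK x).
  have bc x : bcol (box x) = x.2 := congr1 snd (boxK x).
  have -> : stab (brow \o box) = stab fst.
    by apply/setP=> p; rewrite !inE; apply: eq_forallb => x; rewrite /= !br.
  have -> // : stab (bcol \o box) = stab snd.
  by apply/setP=> p; rewrite !inE; apply: eq_forallb => x; rewrite /= !bc.
rewrite -(theta_young_tens K brow bcol (@inj_id T) ioI1 (@plus_true _) (@plus_true _)).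
by apply: J_tensr; apply: J_gen; rewrite young_id -(young_eE delta); apply: gen_e.
Qed.
End Box.

Section TcatExt.
Variables (K : fieldType) (V : superspace K).
Lemma tcat_linearr s t (x : tpow V s) : linear (fun y : tpow V t => tcat x y).
Proof.
elim: s x => [|e s IHs] x c y y' /=; first by rewrite scalerDr !scalerA mulrC.
rewrite scaler_sumr -big_split; apply: eq_bigr => i _.
rewrite scaler_sumr -big_split; apply: eq_bigr => j _.
by rewrite IHs tensDr scalerDr !scalerA mulrC.
Qed.
Lemma tcat_ext s t (W : vectType K) (f : 'Hom(tpow V (s ++ t), W)) : (forall x y, f (tcat x y) = 0) -> f = 0.
Proof.
elim: s W f => [|e s IHs] W f H; first by apply/lfunP=> y; rewrite -[y]scale1r zero_lfunE; apply: (H 1).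
apply: tens_ext => v z; rewrite zero_lfunE.
have /lfunP/(_ z) : (f \o linfun (tens v))%VF = 0.
  by apply: IHs => x y; rewrite comp_lfunE lfunE /= -tcat_tens H.
by rewrite comp_lfunE lfunE zero_lfunE.
Qed.
End TcatExt.

Section KernelJ.
Variables (K : fieldType) (charK : [pchar K] =i pred0) (V : superspace K) (m l : nat).
Hypotheses (dimV0 : \dim (ss_part V false) = m) (dimV1 : \dim (ss_part V true) = l).
Variables (n : nat) (b : n.-tuple V) (d : 'I_n -> bool).
Hypotheses (basis_b : basis_of {:V} b) (homog_b : forall i : 'I_n, b`_i \in ss_part V (d i)).
Variable F : forall s t : seq bool, OB K s t -> 'Hom(tpow V s, tpow V t).
Hypothesis functorF : brauer_functor b d F.
Notation J := (ideal_J (sdim V) m l).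

Lemma J_rect_ideal r x : x \in rect_ideal K m l r -> J (theta x).
Proof.
case/rect_idealP=> k ->; rewrite theta_sum; apply: J_sum => u _; rewrite thetaZ -[_ *: _]addr0.
apply: JZD; last exact: J0.
rewrite /rect_gen; case: injectiveP => io; last by rewrite theta0; apply: J0.
rewrite 2!(thetaM (@plus_true r) (sdim V)); apply: J_compr; apply: J_compl; apply: J_young.
exact: plus_true.
Qed.

Lemma rho_ker_J r (x : galg K {perm 'I_(size (plus r))}) : rho F x = 0 -> J (theta x).
Proof. by move=> x0; apply/J_rect_ideal/(rho_ker charK dimV0 dimV1 basis_b homog_b functorF). Qed.

Lemma F_generated s t (D : OB K s t) : Defs.generated (sdim V) m l D -> F D = 0.
Proof.
elim=> {s t D} [|s t u f g _ IH|s t u f g _ IH|s t s' t' f g _ IH|s t s' t' f g _ IH].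
- by rewrite young_eE; apply: (rho_rect charK dimV0 dimV1 basis_b homog_b functorF); apply: rowsize_box.
- by rewrite (F_comp functorF) IH comp_lfun0r.
- by rewrite (F_comp functorF) IH comp_lfun0l.
- apply: tcat_ext => x y; rewrite (F_tens functorF) IH zero_lfunE.
  exact: (lin0 (tcat_linearr (F f x))).
- apply: tcat_ext => x y; rewrite (F_tens functorF) IH zero_lfunE.
  exact: (lin0 (tcat_linear (F g y))).
Qed.

Lemma F_J s t (D : OB K s t) : J D -> F D = 0.
Proof.
case=> k [c [g [gG ->]]]; rewrite (F_sum functorF) big1 // => i _.
by rewrite F_generated ?scaler0.
Qed.
End KernelJ.

(** * Invariant endomorphisms of tensor powers *)

Section CompSum.
Variables (K : fieldType) (U V W : vectType K).
Lemma comp_lfun_sumr I (r : seq I) (P : pred I) (G : I -> 'Hom(U, V)) (f : 'Hom(V, W)) :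
  (f \o (\sum_(i <- r | P i) G i))%VF = \sum_(i <- r | P i) (f \o G i)%VF.
Proof. by apply: (big_morph (fun g => (f \o g)%VF)) => [g h|]; rewrite ?comp_lfunDr ?comp_lfun0r. Qed.
End CompSum.

Section LComp.
Variables (K : fieldType) (U : vectType K) (f : 'End(U)).
Definition lcomp (g : 'End(U)) : 'End(U) := (f \o g)%VF.
Fact lcomp_linear : linear lcomp.
Proof. by move=> c g h; rewrite /lcomp comp_lfunDr comp_lfunZr. Qed.
HB.instance Definition _ := GRing.isLinear.Build K 'End(U) 'End(U) *:%R lcomp lcomp_linear.
End LComp.

Section FFT.
Variables (K : fieldType) (charK : [pchar K] =i pred0) (V : superspace K).
Variables (n : nat) (b : n.-tuple V) (d : 'I_n -> bool).
Variable F : forall s t : seq bool, OB K s t -> 'Hom(tpow V s, tpow V t).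
Hypothesis functorF : brauer_functor b d F.
Notation FP := (Fperm F).
Notation X r := (tpow V (plus r)).

Lemma FP_inv r (p : 'S_(size (plus r))) : (FP p \o FP p^-1%g)%VF = \1%VF.
Proof. by rewrite -(FpermM functorF) mulVg (Fperm1 functorF). Qed.

Definition conjF r (p : 'S_(size (plus r))) (Z : 'End(X r)) : 'End(X r) := (FP p \o Z \o FP p^-1%g)%VF.
Definition Sym r (Z : 'End(X r)) : 'End(X r) := \sum_p conjF p Z.
Lemma conjF_linear r p : linear (@conjF r p).
Proof. by move=> c Z Z'; rewrite /conjF comp_lfunDr comp_lfunDl -comp_lfunZr -comp_lfunZl. Qed.
Lemma Sym_linear r : linear (@Sym r).
Proof. by move=> c Z Z'; rewrite scaler_sumr -big_split; apply: eq_bigr => p _; rewrite conjF_linear. Qed.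
Lemma conjFM r p q (Z : 'End(X r)) : conjF p (conjF q Z) = conjF (q * p) Z.
Proof. by rewrite /conjF invMg !(FpermM functorF) !comp_lfunA. Qed.
Lemma Sym_conjF r p (Z : 'End(X r)) : Sym (conjF p Z) = Sym Z.
Proof.
rewrite /Sym [RHS](reindex_inj (mulgI p)); apply: eq_bigr => q _; exact: conjFM.
Qed.
Lemma Sym_fixed r (Z : 'End(X r)) : (forall p, (FP p \o Z = Z \o FP p)%VF) -> Sym Z = #|{: 'S_(size (plus r))}|%:R *: Z.
Proof.
move=> H; rewrite /Sym (eq_bigr (fun=> Z)) ?sumr_const ?scaler_nat // => p _.
by rewrite /conjF H -comp_lfunA FP_inv comp_lfun1r.
Qed.
Lemma Fperm_sder r p (E : 'End(V)) (g : 'S_(size (plus r))) : homog p E ->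
  (FP g \o sder p E r = sder p E r \o FP g)%VF.
Proof. by move=> Ep; apply: gl_hom_sder Ep; apply: (rf_gl functorF). Qed.
Lemma Sym_sderl r p (E : 'End(V)) (Z : 'End(X r)) : homog p E ->
  Sym (sder p E r \o Z)%VF = (sder p E r \o Sym Z)%VF.
Proof.
move=> Ep; rewrite /Sym comp_lfun_sumr; apply: eq_bigr => g _.
by rewrite /conjF !comp_lfunA (Fperm_sder _ Ep).
Qed.

Definition mone (r : nat) (E : 'End(V)) : 'End(X r.+1) := tensop E (\1%VF : 'End(X r)).
(** Two permutations with the same image of 0 differ by one that fixes 0, and this commutes with
    [mone r E]. *)
Lemma mone_lift r E (p q : 'S_(size (plus r.+1))) : p ord0 = q ord0 -> conjF p (mone r E) = conjF q (mone r E).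
Proof.
move=> pq; have [|h hE] := @perm_fix0 _ (q * p^-1)%g; first by rewrite permM -pq permK.
have -> : q = (lift_perm ord0 ord0 h * p)%g by rewrite -hE mulgKV.
rewrite -conjFM; congr conjF; rewrite /conjF.
have -> : ((lift_perm ord0 ord0 h : 'S_(size (plus r.+1)))^-1 = lift_perm ord0 ord0 h^-1)%g.
  by rewrite -lift_permV.
rewrite !(Fperm_lift functorF) /mone !tensop_comp.
by rewrite comp_lfun1l !comp_lfun1r FP_inv.
Qed.
(** The signs of the two crossings differ exactly by the sign of moving [E] past the first
    vector. *)
Lemma conj_s01 r p E : homog p E ->
  conjF (s01 r) (mone r.+1 E) = tensop (ssgn V p) (mone r E) :> 'End(X r.+2).
Proof.
move=> Ep; apply: tens2_ext => p1 q1 v w y vp wq.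
rewrite /conjF tpermV !comp_lfunE (Fperm_s01 functorF _ vp wq) !lfZ /mone.
rewrite [tensop E _ _]tensopE lfunE /= (Fperm_s01 functorF _ (homog_part Ep wq) vp) scalerA.
by rewrite tensopE (ssgn_part _ vp) tensZl tensopE lfunE -signr_addb; congr (_ *: _); case: p1 q1 p {vp wq Ep} => -[] [].
Qed.
Definition swap0 r (j : 'I_(size (plus r.+1))) : 'S_(size (plus r.+1)) := tperm ord0 j.
Lemma tensop0r (U U' W W' : vectType K) (f : 'Hom(U, U')) : tensop f (0 : 'Hom(W, W')) = 0.
Proof. exact: (lin0 (tensop_linearr f)). Qed.
Lemma tensop_sumr (U U' W W' : vectType K) (f : 'Hom(U, U')) I (r : seq I) (P : pred I) (G : I -> 'Hom(W, W')) :
  tensop f (\sum_(i <- r | P i) G i) = \sum_(i <- r | P i) tensop f (G i).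
Proof. exact: (lin_sum (tensop_linearr f)). Qed.
Lemma conj_lift r (h : 'S_(size (plus r))) (E : 'End(V)) (Z : 'End(X r)) :
  conjF (lift_perm ord0 ord0 h : 'S_(size (plus r.+1))) (tensop E Z) = tensop E (conjF h Z) :> 'End(X r.+1).
Proof.
rewrite /conjF.
have -> : ((lift_perm ord0 ord0 h : 'S_(size (plus r.+1)))^-1 = lift_perm ord0 ord0 h^-1)%g.
  by rewrite -lift_permV.
by rewrite !(Fperm_lift functorF) !tensop_comp comp_lfun1l comp_lfun1r.
Qed.
(** Conjugating by the transposition of 0 and j makes [E] act in place j, with the sign of passing
    the places before it; the derivation is the sum over all places. *)
Lemma sum_conj r p E : homog p E -> \sum_j conjF (@swap0 r j) (mone r E) = sder p E r.+1.
Proof.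
move=> Ep; elim: r => [|r IHr].
  rewrite big_ord1 /swap0 tperm1 /conjF invg1 (Fperm1 functorF) comp_lfun1l comp_lfun1r /mone /=.
  by rewrite tensop0r addr0.
have -> : sder p E r.+2 = mone r.+1 E + tensop (ssgn V p) (sder p E r.+1) by [].
rewrite big_ord_recl; congr (_ + _).
  by rewrite /swap0 tperm1 /conjF invg1 (Fperm1 functorF) comp_lfun1l comp_lfun1r.
rewrite -IHr tensop_sumr; apply: eq_bigr => i _.
rewrite -(conj_lift (swap0 i)) -(conj_s01 _ Ep) conjFM; apply: mone_lift.
by rewrite /swap0 /s01 permM !tpermL lift_perm_lift tpermL.
Qed.

(* Averaging over all pairs of a permutation and a point avoids counting the permutations with a
   given image of 0. *)
Lemma Sym_mone r p E : homog p E -> exists c, Sym (mone r E) = c *: sder p E r.+1.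
Proof.
move=> Ep; set T := 'I_(size (plus r.+1)).
have E1 : #|T|%:R *: Sym (mone r E) = #|{: {perm T}}|%:R *: sder p E r.+1.
  transitivity (\sum_(k : T) \sum_(g : {perm T}) conjF (swap0 (g k)) (mone r E)).
    rewrite (eq_bigr (fun=> Sym (mone r E))) ?sumr_const ?scaler_nat // => k _.
    rewrite /Sym [RHS](reindex_inj (mulgI (swap0 k))); apply: eq_bigr => g _.
    by apply: mone_lift; rewrite permM /swap0 !tpermL.
  rewrite exchange_big /= (eq_bigr (fun=> sder p E r.+1)) ?sumr_const ?scaler_nat // => g _.
  rewrite -(sum_conj _ Ep) [RHS](reindex_inj (@perm_inj _ g)); exact: eq_bigr.
exists (#|T|%:R^-1 * #|{: {perm T}}|%:R); rewrite -scalerA -E1 scalerA mulVf ?scale1r //.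
by apply: natr_neq0 => //; rewrite card_ord.
Qed.

(** The unital algebra generated by the derivations of homogeneous endomorphisms, built by left
    multiplication because derivations leave [Sym] on the left ([Sym_sderl]). *)
Inductive der_alg r : 'End(X r) -> Prop :=
| der_alg1 : der_alg \1%VF
| der_algZD c f g : der_alg f -> der_alg g -> der_alg (c *: f + g)
| der_algM p E f : homog p E -> der_alg f -> der_alg (sder p E r \o f)%VF.

Lemma der_alg0 r : @der_alg r 0.
Proof. by rewrite -(addNr (\1%VF : 'End(X r))) -scaleN1r; apply: der_algZD; apply: der_alg1. Qed.
Lemma der_algZ r c f : der_alg f -> @der_alg r (c *: f).
Proof. by move=> Hf; rewrite -[_ *: _]addr0; apply: der_algZD => //; apply: der_alg0. Qed.
Lemma SymD r (Z Z' : 'End(X r)) : Sym (Z + Z') = Sym Z + Sym Z'.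
Proof. exact: (linD (@Sym_linear r)). Qed.
Lemma SymZ r c (Z : 'End(X r)) : Sym (c *: Z) = c *: Sym Z.
Proof. exact: (linZ (@Sym_linear r)). Qed.

(** Induction on [Y]. With S for [ssgn V p], and d for the derivation of D on either tensor power,
    the Leibniz rule gives E (x) (d f) = d (S E (x) f) - (D S E) (x) f, and both terms on the right
    involve only [f]. *)
Lemma Sym_der_alg_tensop r (Y : 'End(X r)) (E : 'End(V)) : @der_alg r Y -> @der_alg r.+1 (Sym (tensop E Y : 'End(X r.+1))).
Proof.
move=> DY; elim: DY E => [|c f g _ IHf _ IHg|p D f Dp _ IHf] E.
- rewrite (hpart_sum E) -[hpart false E]scale1r tensop_linearl Sym_linear.
  have base q : @der_alg r.+1 (Sym (mone r (hpart q E))).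
    have [c ->] := Sym_mone r (hpart_homog q E).
    by apply: der_algZ; rewrite -[sder _ _ _]comp_lfun1r; apply: der_algM (hpart_homog q E) (der_alg1 _).
  exact: der_algZD (base false) (base true).
- by rewrite tensop_linearr Sym_linear; apply: der_algZD.
have -> : tensop E (sder p D r \o f)%VF = (-1) *: tensop (D \o (ssgn V p \o E))%VF f
    + (sder p D r.+1 \o tensop (ssgn V p \o E) f)%VF :> 'End(X r.+1).
  rewrite [sder p D r.+1]/= comp_lfunDl !tensop_comp comp_lfun1l [(ssgn V p \o (_ \o _))%VF]comp_lfunA ssgnK comp_lfun1l.
  by rewrite scaleN1r addKr.
rewrite (@Sym_linear r.+1) (Sym_sderl _ Dp); apply: der_algZD => //.
by apply: der_algM => //; apply: IHf.
Qed.

(** Permutations of the last r places are among all permutations, so [Sym] of E (x) Y changes only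
    by a factor when [Y] is replaced by [Sym Y], to which the induction hypothesis applies. *)
Lemma Sym_der_alg r (Z : 'End(X r)) : der_alg (Sym Z).
Proof.
elim: r Z => [|r IHr] Z.
  have -> : Z = (Z 1 : K) *: \1%VF.
    apply/lfunP=> x; rewrite scale_lfunE lfunE /=; have {1}-> : x = (x : K) *: (1 : K^o) by rewrite /GRing.scale /= mulr1.
    by rewrite lfZ /GRing.scale /= mulrC.
  rewrite SymZ Sym_fixed => [|p]; last by rewrite comp_lfun1l comp_lfun1r.
  by do 2!apply: der_algZ; apply: der_alg1.
elim/endo_tensop_ind: Z => [c f g Hf Hg|E Y]; first by rewrite (@Sym_linear r.+1); apply: der_algZD.
have N0 : #|{: 'S_(size (plus r))}|%:R != 0 :> K.
  by apply: natr_neq0 => //; apply/card_gt0P; exists 1%g.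
have <- : #|{: 'S_(size (plus r))}|%:R^-1 *: Sym (tensop E (Sym Y) : 'End(X r.+1)) = Sym (tensop E Y : 'End(X r.+1)).
  have -> : Sym (tensop E (Sym Y) : 'End(X r.+1)) = \sum_(h : 'S_(size (plus r))) Sym (tensop E Y : 'End(X r.+1)).
    rewrite {2}/Sym tensop_sumr (big_morph _ (@SymD r.+1) (_ : Sym 0 = 0)).
      by apply: eq_bigr => h _; rewrite -conj_lift Sym_conjF.
    by rewrite -[Z in Sym Z](scale0r (0 : 'End(X r.+1))) SymZ scale0r.
  by rewrite sumr_const -scaler_nat scalerA mulVf ?scale1r.
by apply: der_algZ; apply: Sym_der_alg_tensop; apply: IHr.
Qed.

Lemma gl_hom_der_alg r (f Y : 'End(X r)) : gl_hom f -> der_alg Y -> (f \o Y = Y \o f)%VF.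
Proof.
move=> Hf; elim=> [|c g h _ IHg _ IHh|p E g Ep _ IHg]; first by rewrite comp_lfun1l comp_lfun1r.
  by rewrite comp_lfunDr comp_lfunDl -comp_lfunZr -comp_lfunZl IHg IHh.
by rewrite comp_lfunA (gl_hom_sder Hf Ep) -!comp_lfunA IHg.
Qed.
Lemma gl_hom_central r (f Z : 'End(X r)) : gl_hom f -> (forall p, (FP p \o Z = Z \o FP p)%VF) -> (f \o Z = Z \o f)%VF.
Proof.
move=> Hf HZ; have N0 : #|{: 'S_(size (plus r))}|%:R != 0 :> K.
  by apply: natr_neq0 => //; apply/card_gt0P; exists 1%g.
apply: (scalerI N0); rewrite comp_lfunZr comp_lfunZl -!(Sym_fixed HZ).
exact: gl_hom_der_alg (Sym_der_alg Z).
Qed.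

(** The inverse makes this a homomorphism, as [Fperm] reverses products. *)
Definition lact r (p : 'S_(size (plus r))) : 'End('End(X r)) := linfun (lcomp (FP p^-1%g)).
Lemma lactE r p (Z : 'End(X r)) : lact p Z = (FP p^-1%g \o Z)%VF.
Proof. by rewrite lfunE. Qed.

Section DoubleCentralizer.
Variables (r : nat) (f : 'End(X r)).
Hypothesis Hf : gl_hom f.
Definition perm_span : {vspace 'End(X r)} := (\sum_(p : 'S_(size (plus r))) <[FP p]>)%VS.
Lemma perm_spanP x : x \in perm_span -> exists k, x = \sum_p k p *: FP p.
Proof.
case/memv_sumP=> xs xsP ->.
have /fin_all_exists[k kP] : forall p, exists k, xs p = k *: FP p by move=> p; apply/vlineP/xsP.
by exists k; apply: eq_bigr => p _; rewrite kP.
Qed.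
Lemma Fperm_span p : FP p \in perm_span.
Proof. by rewrite /perm_span (bigD1 p) //=; apply: (subvP (addvSl _ _)); apply: memv_line. Qed.

(* Maps commuting with the permutations arise from the Maschke projection P by
   w |-> P (rank1 xi w) w0, and this makes f commute with P. *)
Lemma gl_hom_perm_span : f \in perm_span.
Proof.
have [||p x xU|P PC [PU Pid]] := @maschke K charK _ _ (@lact r) _ _ perm_span.
- by apply/lfunP=> Z; rewrite lactE invg1 (Fperm1 functorF) comp_lfun1l lfunE.
- by move=> p q; apply/lfunP=> Z; rewrite comp_lfunE !lactE invMg (FpermM functorF) comp_lfunA.
- have [k ->] := perm_spanP xU; rewrite lactE comp_lfun_sumr memv_suml // => q _.
  by rewrite -comp_lfunZr memvZ // -(FpermM functorF) Fperm_span.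
pose Zf (xi : 'Hom(X r, K^o)) w0 := (fun w : X r => P (rank1 xi w) w0).
have Zl xi w0 : linear (Zf xi w0).
  move=> c w w'; rewrite /Zf; have -> : rank1 xi (c *: w + w') = c *: rank1 xi w + rank1 xi w'.
    by apply/lfunP=> x; rewrite add_lfunE scale_lfunE !rank1E scalerDr !scalerA mulrC.
  by rewrite linearP add_lfunE scale_lfunE.
have PF g (xi : 'Hom(X r, K^o)) w : (P (g \o rank1 xi w) = P (rank1 xi (g w)))%VF.
  by congr (P _); apply/lfunP=> x; rewrite comp_lfunE !rank1E lfZ.
have fP xi w : (f \o P (rank1 xi w) = P (f \o rank1 xi w))%VF.
  apply/lfunP=> w0; rewrite comp_lfunE PF.
  pose ZL := GRing.isLinear.Build K (X r) (X r) *:%R (Zf xi w0) (Zl xi w0).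
  pose Z : {linear X r -> X r} := HB.pack (Zf xi w0) ZL.
  have ZE x : linfun Z x = P (rank1 xi x) w0 by rewrite lfunE.
  rewrite -!ZE -!comp_lfunE; congr (fun_of_lfun _ _); apply: gl_hom_central => // p.
  apply/lfunP=> x; rewrite !comp_lfunE !ZE -PF.
  by have := PC p^-1%g (rank1 xi x); rewrite !lactE invgK => ->; rewrite comp_lfunE.
have id_rank1 : \sum_k rank1 (dbas k) (bas (X r))`_k = \1%VF.
  apply/lfunP=> x; rewrite sum_lfunE lfunE /= [RHS]bas_expand; apply: eq_bigr => k _.
  by rewrite rank1E dbasE.
(* Summing over the rank-one maps that add up to the identity gives f = f P(1) = P(f), which lies in
   the span. *)
have P1 : P \1%VF = \1%VF by apply: Pid; rewrite -(Fperm1 functorF) Fperm_span.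
have -> : f = P f; last exact: PU.
rewrite -{1}[f]comp_lfun1r -P1 -id_rank1 lf_sum comp_lfun_sumr (eq_bigr _ (fun k _ => fP _ _)).
by rewrite -lf_sum -comp_lfun_sumr id_rank1 comp_lfun1r.
Qed.
End DoubleCentralizer.

Lemma fft_plus r (f : 'End(X r)) : gl_hom f -> exists D : OB K (plus r) (plus r), F D = f.
Proof.
move=> /gl_hom_perm_span/perm_spanP[k ->]; exists (\sum_p k p *: ob_permS K p).
by rewrite (F_sum functorF).
Qed.

Lemma sder_id r : sder false \1%VF r = r%:R *: \1%VF :> 'End(X r).
Proof.
elim: r => [|r IHr]; first by rewrite scale0r.
have -> : sder false \1%VF r.+1 = mone r \1%VF + tensop (ssgn V false) (sder false \1%VF r) by [].
have -> : ssgn V false = \1%VF.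
  by apply: homog_ext => q v vq; rewrite (ssgn_part _ vq) andbF scale1r lfunE.
rewrite IHr /mone tensop1; have := tensop_linearr (\1%VF : 'End(V)) r%:R (\1%VF : 'End(X r)) 0.
by rewrite tensop0r !addr0 tensop1 => ->; rewrite [in RHS]mulrS scalerDl scale1r.
Qed.
Lemma gl_hom_plus0 a c (f : 'Hom(X a, X c)) : gl_hom f -> a != c -> f = 0.
Proof.
move=> Hf ac; have h1 : homog false (\1%VF : 'End(V)) by move=> q v; rewrite !lfunE addbF.
have := gl_hom_sder Hf h1; rewrite !sder_id -comp_lfunZr -comp_lfunZl comp_lfun1l comp_lfun1r => E.
apply/eqP; have /eqP : (a%:R - c%:R) *: f = 0 by rewrite scalerBl E subrr.
rewrite scaler_eq0 => /orP[|//] => /idPn[].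
have [lt|ge] := ltnP a c; last first.
  by rewrite -natrB //; apply: (natr_neq0 charK); rewrite subn_gt0 ltn_neqAle eq_sym ac.
by rewrite -opprB oppr_eq0 -natrB ?(ltnW lt) //; apply: (natr_neq0 charK); rewrite subn_gt0.
Qed.

End FFT.

(** * Reduction by bending strands *)

Lemma mate_plus a c (m : node (size (plus a)) (size (plus c)) -> node (size (plus a)) (size (plus c))) :
  mate m -> a = c.
Proof.
case=> mK st.
have H i : exists j, m (inl i) = inr j.
  by have := st (inl i); rewrite /= plus_true; case: (m _) => j /=; rewrite ?plus_true //; exists j.
have H' j : exists i, m (inr j) = inl i.
  by have := st (inr j); rewrite /= plus_true; case: (m _) => i /=; rewrite ?plus_true //; exists i.
have /fin_all_exists[f fE] := H; have /fin_all_exists[f' fE'] := H'.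
have fI : injective f.
  by move=> i j E; apply: (inl_inj (B := 'I_(size (plus c)))); apply: (can_inj mK); rewrite !fE E.
have fI' : injective f'.
  by move=> i j E; apply: (inr_inj (A := 'I_(size (plus a)))); apply: (can_inj mK); rewrite !fE' E.
have := leq_card f fI; have := leq_card f' fI'; rewrite !card_ord !size_nseq => ca ac.
by apply/eqP; rewrite eqn_leq ac.
Qed.

Section Assembly.
Variables (K : fieldType) (charK : [pchar K] =i pred0) (V : superspace K) (m l : nat).
Hypotheses (dimV0 : \dim (ss_part V false) = m) (dimV1 : \dim (ss_part V true) = l).
Variables (n : nat) (b : n.-tuple V) (d : 'I_n -> bool).
Hypotheses (basis_b : basis_of {:V} b) (homog_b : forall i : 'I_n, b`_i \in ss_part V (d i)).
Variable F : forall s t : seq bool, OB K s t -> 'Hom(tpow V s, tpow V t).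
Hypothesis functorF : brauer_functor b d F.
Notation J := (ideal_J (sdim V) m l).
Notation dV := (sdim V).

(** Only one inclusion of the kernel statement is carried along; the other one, [F_J], holds for all
    objects at once. *)
Definition good s t :=
  (forall f : 'Hom(tpow V s, tpow V t), gl_hom f -> exists D : OB K s t, F D = f) /\
  (forall D : OB K s t, F D = 0 -> J D).

Lemma good_plus a c : good (plus a) (plus c).
Proof.
have [<-|ac] := eqVneq a c.
  split=> [f|D]; first exact: (fft_plus charK functorF).
  have [x ->] : exists x, D = theta x.
    apply: (OB_mate (P := fun D => exists x, D = theta x)) D => [|k f g [x ->] [y ->]|mt mm].
    - by exists 0; rewrite theta0.
    - by exists (k *: x + y); rewrite theta_linear.
    have [p ->] := mate_permS (@plus_true a) mm; exists (dl K p^-1%g).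
    by rewrite theta_dl invgK (ob_permSE K (@plus_true a)).
  exact: (rho_ker_J charK dimV0 dimV1 basis_b homog_b functorF).
split=> [f Hf|D _].
  by exists 0; rewrite (F0 functorF) (gl_hom_plus0 charK Hf ac).
apply: (OB_mate (P := fun D => J D)) D => [|k f g|mt /mate_plus E]; [exact: J0|exact: JZD|].
by rewrite E eqxx in ac.
Qed.

Lemma tensop_tcat e e' s t (h : 'Hom(tpow V s, tpow V t)) (z : tpow V [:: e; e']) (y : tpow V s) :
  tensop \1 (tensop \1 h) (tcat z y : tensT (ssign V e) (tensT (ssign V e') (tpow V s))) = tcat z (h y).
Proof.
elim/tens_ind: z => [|c z z' Hz Hz'|i z].
- by rewrite !(lin0 (@tcat_linear K V [:: e; e'] _ _)) lf0.
- by rewrite !(@tcat_linear K V [:: e; e']) lfD lfZ Hz Hz'.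
rewrite !tcat_tens tensopE lfunE; congr tens.
elim/tens_ind: z => [|c z z' Hz Hz'|j a].
- by rewrite !(lin0 (@tcat_linear K V [:: e'] _ _)) lf0.
- by rewrite !(@tcat_linear K V [:: e']) lfD lfZ Hz Hz'.
by rewrite !tcat_tens tensopE lfunE /= lfZ.
Qed.
Lemma hom_tcat_ext s t (W : vectType K) (f g : 'Hom(tpow V (s ++ t), W)) :
  (forall x y, f (tcat x y) = g (tcat x y)) -> f = g.
Proof.
move=> H; apply/eqP; rewrite -subr_eq0; apply/eqP; apply: tcat_ext => x y.
by rewrite add_lfunE opp_lfunE H subrr.
Qed.

Section BendF.
Variables (e : bool).
Definition Cup s : 'Hom(tpow V s, tensT (ssign V (~~ e)) (tensT (ssign V e) (tpow V s))) :=
  F (ob_tens (cup K e) (ob_id K s)).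
Definition Cap t : 'Hom(tensT (ssign V e) (tensT (ssign V (~~ e)) (tpow V t)), tpow V t) :=
  F (ob_tens (cap K e) (ob_id K t)).
Definition bendF s t (f : 'Hom(tensT (ssign V e) (tpow V s), tpow V t)) :
  'Hom(tpow V s, tensT (ssign V (~~ e)) (tpow V t)) := (tensop \1%VF f \o Cup s)%VF.
Definition unbendF s t (h : 'Hom(tpow V s, tensT (ssign V (~~ e)) (tpow V t))) :
  'Hom(tensT (ssign V e) (tpow V s), tpow V t) := (Cap t \o tensop \1%VF h)%VF.
Lemma F_bend s t (D : OB K (e :: s) t) : F (bend dV D) = bendF (F D).
Proof. by rewrite /bend (F_comp functorF) (F_idl functorF). Qed.
Lemma F_unbend s t (D : OB K s (~~ e :: t)) : F (unbend dV D) = unbendF (F D).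
Proof. by rewrite /unbend (F_comp functorF) (F_idl functorF). Qed.
Lemma Cap_tcat t (z : tpow V [:: e; ~~ e]) (y : tpow V t) : Cap t (tcat z y) = (F (cap K e) z : K) *: y.
Proof.
have := F_tens functorF (cap K e) (ob_id K t) z y.
by rewrite (rf_id functorF) lfunE.
Qed.
Lemma Cup_tcat s (y : tpow V s) : Cup s y = tcat (F (cup K e) (1 : K^o)) y.
Proof.
have := F_tens functorF (cup K e) (ob_id K s) (1 : K^o) y.
by rewrite (rf_id functorF) lfunE /= scale1r.
Qed.
Lemma Cap_natural t t' (f : 'Hom(tpow V t, tpow V t')) :
  (Cap t' \o tensop \1 (tensop \1 f) = f \o Cap t)%VF.
Proof.
apply: (@hom_tcat_ext [:: e; ~~ e]) => z y.
by rewrite !comp_lfunE tensop_tcat !Cap_tcat lfZ.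
Qed.
Lemma Cup_natural s s' (f : 'Hom(tpow V s, tpow V s')) :
  (tensop \1 (tensop \1 f) \o Cup s = Cup s' \o f)%VF.
Proof. by apply/lfunP=> y; rewrite !comp_lfunE !Cup_tcat tensop_tcat. Qed.
(** Obtained without basis vectors, as the image under [F] of bending and unbending the identity
    diagram. *)
Lemma zigzag s : (Cap (e :: s) \o tensop \1 (Cup s) = \1)%VF.
Proof.
have := F_unbend (bend dV (ob_id K (e :: s))); rewrite bendK (rf_id functorF) F_bend (rf_id functorF).
by rewrite /unbendF /bendF tensop1 comp_lfun1l.
Qed.
Lemma zagzig s : (tensop \1 (Cap s) \o Cup (~~ e :: s) = \1)%VF.
Proof.
have := F_bend (unbend dV (ob_id K (~~ e :: s))); rewrite unbendK (rf_id functorF) F_unbend (rf_id functorF).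
by rewrite /unbendF /bendF tensop1 comp_lfun1r.
Qed.
Lemma bendFK s t : cancel (@bendF s t) (@unbendF s t).
Proof.
move=> f; rewrite /unbendF /bendF.
have -> : tensop (\1 : 'End(ssign V e))%VF (tensop \1 f \o Cup s)%VF = (tensop \1 (tensop \1 f) \o tensop \1 (Cup s))%VF.
  by rewrite tensop_comp comp_lfun1l.
by rewrite comp_lfunA (@Cap_natural (e :: s) t f) -comp_lfunA zigzag comp_lfun1r.
Qed.
Lemma unbendFK s t : cancel (@unbendF s t) (@bendF s t).
Proof.
move=> f; rewrite /unbendF /bendF.
have -> : tensop (\1 : 'End(ssign V (~~ e)))%VF (Cap t \o tensop \1 f)%VF = (tensop \1 (Cap t) \o tensop \1 (tensop \1 f))%VF.
  by rewrite tensop_comp comp_lfun1l.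
by rewrite -comp_lfunA (@Cup_natural s (~~ e :: t) f) comp_lfunA zagzig comp_lfun1l.
Qed.
Lemma bendF_gl s t (f : 'Hom(tpow V (e :: s), tpow V t)) : gl_hom f -> @gl_hom K V s (~~ e :: t) (@bendF s t f).
Proof. by move=> Hf; exact: (gl_hom_comp (gl_hom_tensl Hf) (rf_gl functorF _)). Qed.
Lemma unbendF_gl s t (h : 'Hom(tpow V s, tpow V (~~ e :: t))) : gl_hom h -> @gl_hom K V (e :: s) t (@unbendF s t h).
Proof. by move=> Hf; exact: (gl_hom_comp (rf_gl functorF _) (gl_hom_tensl Hf)). Qed.

Lemma J_bend s t (D : OB K (e :: s) t) : J D -> J (bend dV D).
Proof.
move=> JD; apply: J_compr.
exact: (@J_tensl K dV m l [:: ~~ e] [:: ~~ e] (e :: s) t (ob_id K _) D JD).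
Qed.
Lemma J_unbend s t (D : OB K s (~~ e :: t)) : J D -> J (unbend dV D).
Proof.
move=> JD; apply: J_compl.
exact: (@J_tensl K dV m l [:: e] [:: e] s (~~ e :: t) (ob_id K _) D JD).
Qed.

Lemma good_unbend s t : good s (~~ e :: t) -> good (e :: s) t.
Proof.
move=> [full ker]; split=> [f Hf|D D0].
  by have [D DE] := full _ (bendF_gl Hf); exists (unbend dV D); rewrite F_unbend DE bendFK.
rewrite -(bendK dV D); apply/J_unbend/ker; rewrite F_bend D0 /bendF.
by have := @tensop0r K (ssign V (~~ e)) (ssign V (~~ e)) (tpow V (e :: s)) (tpow V t) \1%VF => ->; rewrite comp_lfun0l.
Qed.
Lemma good_bend s t : good (e :: s) t -> good s (~~ e :: t).
Proof.
move=> [full ker]; split=> [f Hf|D D0].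
  by have [D DE] := full _ (unbendF_gl Hf); exists (bend dV D); rewrite F_bend DE unbendFK.
rewrite -(unbendK dV D); apply/J_bend/ker; rewrite F_unbend D0 /unbendF.
by have := @tensop0r K (ssign V e) (ssign V e) (tpow V s) (tpow V (~~ e :: t)) \1%VF => ->; rewrite comp_lfun0r.
Qed.
End BendF.

Lemma good_vert s t t' (p : 'I_(size t) -> 'I_(size t')) (q : 'I_(size t') -> 'I_(size t)) :
  cancel p q -> cancel q p -> (forall i, nth true t' (p i) = nth true t i) -> good s t' -> good s t.
Proof.
move=> pK qK pst [full ker].
pose v := diagv K (arcs_of (vert p q)); pose v' := diagv K (arcs_of (vert q p)).
have vK s' : cancel (ob_comp dV v : OB K s' t -> _) (ob_comp dV v') by apply: post_vertK.
have Fv : (F v' \o F v)%VF = \1%VF.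
  by rewrite -(rf_id functorF) -(vK _ (ob_id K t)) !(F_comp functorF) (rf_id functorF) comp_lfun1r.
split=> [f Hf|D D0].
  have [D DE] := full _ (gl_hom_comp (rf_gl functorF v) Hf); exists (ob_comp dV v' D).
  by rewrite (F_comp functorF) DE comp_lfunA Fv comp_lfun1l.
by rewrite -(vK _ D); apply/J_compl/ker; rewrite (F_comp functorF) D0 comp_lfun0r.
Qed.

Lemma good_perm s t t' : perm_eq t t' -> good s t' -> good s t.
Proof.
move=> tt'; have /tuple_permP[p pE] : perm_eq t (in_tuple t') by [].
have st := perm_size tt'.
apply: (good_vert (p := fun i => p (cast_ord st i)) (q := fun j => cast_ord (esym st) (p^-1%g j))).
- by move=> i; rewrite permK cast_ordK.
- by move=> i; rewrite cast_ordKV permKV.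
move=> i; have -> : nth true t i = nth true [tuple tnth (in_tuple t') (p i) | i < size t'] i by rewrite -pE.
have -> : nat_of_ord i = cast_ord st i by [].
by rewrite -tnth_nth tnth_mktuple (tnth_nth true).
Qed.

(** All bottom signs are bent to the top. The top is sorted into minus signs followed by plus signs,
    and the minus signs are bent down again, where they become plus signs. *)
Lemma good_all s t : good s t.
Proof.
elim: s t => [|e s IHs] t; last exact/good_unbend/IHs.
have H a u : good (plus a) u -> good [::] (nseq a false ++ u).
  elim: a u => [//|a IHa] u /(@good_bend true (plus a) u) /IHa.
  by apply: good_perm; rewrite -[nseq a.+1 _ ++ _]/([:: false] ++ nseq a false ++ u) perm_catCA.
apply: (good_perm (t' := nseq (count negb t) false ++ plus (count id t))); last exact/H/good_plus.
apply/seq.permP => f; rewrite count_cat !count_nseq; elim: t => [|x t IHt] /=; first by rewrite !muln0.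
by rewrite IHt; case: x => /=; rewrite !mulnDr muln1 muln0 ?add0n addnCA // addnA [(_ + f false)%N]addnC.
Qed.
End Assembly.

Theorem theorem6p4 (K : fieldType) (charK : [pchar K] =i pred0)
    (V : superspace K) (m l : nat)
    (dimV0 : \dim (ss_part V false) = m) (dimV1 : \dim (ss_part V true) = l)
    (n : nat) (b : n.-tuple V) (d : 'I_n -> bool)
    (basis_b : basis_of {:V} b)
    (homog_b : forall i : 'I_n, b`_i \in ss_part V (d i))
    (F : forall s t : seq bool, OB K s t -> 'Hom(tpow V s, tpow V t))
    (functorF : brauer_functor b d F) :
  (forall (s t : seq bool) (f : 'Hom(tpow V s, tpow V t)),
     gl_hom f -> exists D : OB K s t, F s t D = f) /\
  (forall (s t : seq bool) (D : OB K s t),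
     F s t D = 0 <-> ideal_J (sdim V) m l D).
Proof.
have H s t := good_all charK dimV0 dimV1 basis_b homog_b functorF s t.
split=> [s t f|s t D]; first exact: (H s t).1.
by split; [exact: (H s t).2|exact: (F_J charK dimV0 dimV1 basis_b homog_b functorF)].
Qed.
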